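(* Let $r$ be a positive integer, and let $(x_n)_{n\ge1}$ be the sequence of Laurent polynomials in $\mathbb{Z}[x_1^{\pm1},x_2^{\pm1}]$ generated from the initial variables $x_1,x_2$ by the recurrence $x_{n+2}x_n=x_{n+1}^r+1$, so that in particular $$x_3=\frac{x_2^r+1}{x_1},\qquad x_4=\frac{(x_2^r+1)^r+x_1^r}{x_1^rx_2},\qquad x_5=\frac{1}{x_2^r}\left(\sum_{j=1}^r\binom{r}{j}x_3^{jr-1}+x_1\right).$$ Then for each positive integer $r$ the Mahler measure of $x_4$ is $$m(x_4)=\frac{r}{\pi}D(e^{\mathrm{i}\pi/3}),$$ which equals $r$ times the value $m(x_1+x_2+1)=L'(\chi_{-3},-1)$ found by Smyth. For each $r\geq2$ the Mahler measure of $x_5$ is $$m(x_5)=\frac{r}{\pi}\sum_{j=1}^r(-1)^{j+1}\Big(D(e^{\mathrm{i}rt_j^*})-D(e^{\mathrm{i}t_j^*})\Big),$$ where $0<t_1^*<\cdots<t_r^*<\pi$ are the solutions of $$2^{r-1}\left|\sin\left(\tfrac{rt}{2}\right)\right|^r=\sin\left(\tfrac{t}{2}\right)$$ on $(0,\pi)$, or equivalently are given by $t_j^*=\arccos X_j^*$, with $X_j^*$ being a root of the polynomial $$P_r(X)=\frac{\big(1-T_r(X)\big)^r}{2^{1-r}(1-X)}-1$$ on the interval $-1<X<1$.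
   Context: For a non-zero Laurent polynomial $P\in\mathbb{C}[x_1^{\pm1},x_2^{\pm1}]$, the (logarithmic) Mahler measure is $$m(P)=\frac{1}{(2\pi)^2}\int_{-\pi}^{\pi}\int_{-\pi}^{\pi}\log|P(e^{\mathrm{i}t_1},e^{\mathrm{i}t_2})|\,\mathrm{d}t_1\,\mathrm{d}t_2 .$$ $D$ denotes the Bloch–Wigner dilogarithm, $D(z)=\mathrm{Im}(\mathrm{Li}_2(z))+\log|z|\arg(1-z)$, where $\mathrm{Li}_2(z)=\sum_{n\ge1}z^n/n^2$ for $|z|<1$; on the unit circle $D(e^{\mathrm{i}\theta})=\sum_{n=1}^\infty\frac{\sin(n\theta)}{n^2}$ for $\theta\in\mathbb{R}$. $T_r$ denotes the Chebyshev polynomial of the first kind, defined by $T_r(\cos\theta)=\cos(r\theta)$. $L(\chi_{-3},s)$ is the Dirichlet $L$-function of the Dirichlet character $\chi_{-3}$ (the nontrivial character modulo $3$). *)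

(* Defs.v *)
From HB Require Import structures.
From mathcomp Require Import all_boot all_order all_algebra finmap.
From mathcomp.multinomials Require Import monalg.
From mathcomp Require Import all_classical all_reals all_analysis.
From mathcomp Require Import complex.
From mathcomp Require Import ring.

Set Implicit Arguments.
Unset Strict Implicit.
Unset Printing Implicit Defensive.

Import Order.TTheory GRing.Theory Num.Theory.
Import numFieldNormedType.Exports.

Local Open Scope classical_set_scope.
Local Open Scope ring_scope.
Local Open Scope complex_scope.

(* [laurent A] is A[x1^{+-1}, x2^{+-1}]: finitely supported families of
   coefficients indexed by exponent vectors in Z^2, with the convolution
   product.  The product of [monalg] is not available here, since it requires
   a monomial monoid without nontrivial units. *)
Definition laurent (A : comNzRingType) : Type := {malg A[(int * int)%type]}.

HB.instance Definition _ (A : comNzRingType) :=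
  GRing.Lmodule.copy (laurent A) {malg A[(int * int)%type]}.

Definition lmonom (A : comNzRingType) (a : A) (k : int * int) : laurent A :=
  mkmalgU k a.

HB.lock Definition lmul (A : comNzRingType) (g1 g2 : laurent A) : laurent A :=
  \sum_(k1 <- msupp g1) \sum_(k2 <- msupp g2)
     lmonom (mcoeff k1 g1 * mcoeff k2 g2) (k1 + k2).
Canonical lmul_unlockable := Unlockable lmul.unlock.

Section LaurentRing.
Variable A : comNzRingType.
Implicit Types (g : laurent A) (k : int * int).

Local Notation lmul := (@lmul A).

Definition lone : laurent A := lmonom 1 0.

Lemma lmulw (d1 d2 : {fset int * int}) g1 g2 :
  (msupp g1 `<=` d1)%fset -> (msupp g2 `<=` d2)%fset ->
  lmul g1 g2 = \sum_(k1 <- d1) \sum_(k2 <- d2)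
     lmonom (mcoeff k1 g1 * mcoeff k2 g2) (k1 + k2).
Proof.
move=> le_d1 le_d2; rewrite unlock (big_fset_incl _ le_d1) /=.
  apply/eq_bigr=> k1 _; apply/big_fset_incl => // k _ /mcoeff_outdom ->.
  by rewrite mulr0 /lmonom monalgU0.
move=> k _ /mcoeff_outdom g1k.
by rewrite big1 => // k' _; rewrite g1k mul0r /lmonom monalgU0.
Qed.

Lemma lmulC : commutative lmul.
Proof.
move=> g1 g2; rewrite unlock exchange_big /=; apply: eq_bigr => k2 _.
by apply: eq_bigr => k1 _; rewrite mulrC [k1 + k2]addrC.
Qed.

Lemma lmulUg c k g : lmul (lmonom c k) g =
  \sum_(k' <- msupp g) lmonom (c * mcoeff k' g) (k + k').
Proof.
rewrite (lmulw (msuppU_le (x := c)) (fsubset_refl _)) big_seq_fset1.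
by apply/eq_bigr => k' _; rewrite mcoeffUU.
Qed.

Lemma lmulUU c1 c2 k1 k2 :
  lmul (lmonom c1 k1) (lmonom c2 k2) = lmonom (c1 * c2) (k1 + k2).
Proof.
by rewrite (lmulw (msuppU_le (x := c1)) (msuppU_le (x := c2)))
  !big_seq_fset1 !mcoeffUU.
Qed.

Lemma lmul1 : left_id lone lmul.
Proof.
move=> g; rewrite lmulUg [RHS]monalgE.
by apply/eq_bigr=> kg _; rewrite mul1r add0r.
Qed.

Lemma lmulDl : left_distributive lmul +%R.
Proof.
move=> g1 g2 g.
rewrite (lmulw (fsubsetUl (msupp g1) (msupp g2)) (fsubset_refl (msupp g))).
rewrite (lmulw (fsubsetUr (msupp g1) (msupp g2)) (fsubset_refl (msupp g))).
rewrite (lmulw (msuppD_le g1 g2) (fsubset_refl (msupp g))).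
rewrite -big_split /=; apply/eq_bigr=> k1 _.
rewrite -big_split /=; apply/eq_bigr=> k2 _.
by rewrite mcoeffD mulrDl /lmonom monalgUD.
Qed.

Lemma lmul0g : left_zero 0 lmul.
Proof. by move=> g; rewrite unlock msupp0 big_seq_fset0. Qed.

Lemma lmulDr : right_distributive lmul +%R.
Proof. by move=> g g1 g2; rewrite !(lmulC g) lmulDl. Qed.

Lemma lmulg0 : right_zero 0 lmul.
Proof. by move=> g; rewrite lmulC lmul0g. Qed.

Lemma lmulEl1 g1 g2 : lmul g1 g2 =
  \sum_(k1 <- msupp g1) lmul (lmonom (mcoeff k1 g1) k1) g2.
Proof. by rewrite {1}unlock; apply/eq_bigr=> k _; rewrite lmulUg. Qed.

Lemma lmulEr1 g1 g2 : lmul g1 g2 =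
  \sum_(k2 <- msupp g2) lmul g1 (lmonom (mcoeff k2 g2) k2).
Proof. by rewrite lmulC lmulEl1; apply: eq_bigr => k _; rewrite lmulC. Qed.

Lemma lmulA : associative lmul.
Proof.
move=> g1 g2 g3; rewrite (lmulEl1 g1 g2) (lmulEl1 g1 (lmul _ _)).
rewrite [RHS](big_morph (lmul^~ _) (fun _ _ => lmulDl _ _ _) (lmul0g _)).
apply/eq_bigr=> k1 _; rewrite (lmulEl1 g2 g3) (lmulEr1 _ g2).
rewrite [LHS](big_morph (lmul _) (fun _ _ => lmulDr _ _ _) (lmulg0 _)).
rewrite [RHS](big_morph (lmul^~ _) (fun _ _ => lmulDl _ _ _) (lmul0g _)).
apply/eq_bigr=> k2 _; rewrite lmulUU !(lmulEr1 _ g3).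
rewrite [LHS](big_morph (lmul _) (fun _ _ => lmulDr _ _ _) (lmulg0 _)).
by apply/eq_bigr=> k3 _; rewrite !lmulUU mulrA addrA.
Qed.

Lemma lone_neq0 : lone != 0.
Proof.
by apply/eqP/malgP=> /(_ 0) /eqP; rewrite mcoeffUU mcoeff0 oner_eq0.
Qed.

HB.instance Definition _ := GRing.Zmodule_isComNzRing.Build (laurent A)
  lmulA lmulC lmul1 lmulDl lone_neq0.

End LaurentRing.


(* The monomial x1^a x2^b. *)
Definition lX {A : comNzRingType} (a b : int) : laurent A := lmonom 1 (a, b).

Definition cluster_seq (r : nat) (x : nat -> laurent int) : Prop :=
  [/\ x 1%N = lX 1 0, x 2%N = lX 0 1 &
      forall n, (1 <= n)%N -> x n.+2 * x n = x n.+1 ^+ r + 1].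

(* A cluster sequence exists for every r >= 1: each x_(n+4) is a polynomial
   in x_n, x_(n+2) and x_(n+3). *)
Section ClusterExists.
Variable r : nat.
Local Notation L := (laurent int).

Definition cluster_q (y : L) : L :=
  \sum_(1 <= j < r.+1) y ^+ (j * r - 1) *+ 'C(r, j).

Definition cluster_step (s : L * L * L * L) : L * L * L * L :=
  let: (a, b, c, d) := s in (b, c, d, a * d ^+ r - cluster_q c).

Definition cluster_init : L * L * L * L :=
  let x3 := (lX 0 1 ^+ r + 1) * lX (-1) 0 in
  (lX 1 0, lX 0 1, x3, (x3 ^+ r + 1) * lX 0 (-1)).

Lemma lXD a b c d : lX a b * lX c d = lX (a + c) (b + d) :> L.
Proof. by rewrite -[LHS]/(lmul _ _) lmulUU mulr1. Qed.

Lemma lX1V : lX (-1) 0 * lX 1 0 = 1 :> L.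
Proof. by rewrite lXD addNr addr0. Qed.

Lemma lX2V : lX 0 (-1) * lX 0 1 = 1 :> L.
Proof. by rewrite lXD addNr addr0. Qed.

Lemma cluster_qE y : (0 < r)%N -> y * cluster_q y = (y ^+ r + 1) ^+ r - 1.
Proof.
move=> r0; rewrite exprDn -(big_mkord xpredT
  (fun i => (y ^+ r) ^+ (r - i) * 1 ^+ i *+ 'C(r, i))) big_nat_rev /=.
rewrite big_ltn // add0n subn1 /= subnn expr0 expr1n mul1r binn addrAC subrr add0r.
rewrite /cluster_q mulr_sumr; apply: eq_big_nat => j /andP[j1 jr].
rewrite subSS subKn // expr1n mulr1 bin_sub // mulrnAr -exprS -exprM.
by rewrite subn1 prednK ?muln_gt0 ?j1 // mulnC.
Qed.

Let inv (s : L * L * L * L) :=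
  s.1.2 * s.1.1.1 = s.1.1.2 ^+ r + 1 /\ s.2 * s.1.1.2 = s.1.2 ^+ r + 1.

Lemma cluster_stepP s : (0 < r)%N -> inv s -> inv (cluster_step s).
Proof.
rewrite /inv; case: s => [[[a b] c] d] r0 /= [ca db]; split; first exact: db.
rewrite mulrBl [cluster_q c * c]mulrC cluster_qE // -db.
by rewrite mulrAC [a * c]mulrC ca mulrDl mul1r exprMn opprB addrC
  mulrC addrA subrK addrC.
Qed.

Lemma cluster_initP : inv cluster_init.
Proof.
by split=> /=; [rewrite -mulrA lX1V mulr1 | rewrite -mulrA lX2V mulr1].
Qed.

Lemma cluster_step1 s : (cluster_step s).1.1.1 = s.1.1.2.
Proof. by case: s => [[[]]]. Qed.

Lemma cluster_step2 s : (cluster_step s).1.1.2 = s.1.2.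
Proof. by case: s => [[[]]]. Qed.

Lemma cluster_seq_exists : (0 < r)%N -> exists x, cluster_seq r x.
Proof.
move=> r0; exists (fun n => (iter n.-1 cluster_step cluster_init).1.1.1).
split; [by [] | by [] | case=> [//|n] _].
rewrite !succnK !iterS !cluster_step1 cluster_step2.
have : inv (iter n cluster_step cluster_init).
  by elim: n => [|n ih]; [exact: cluster_initP | exact: cluster_stepP].
by case.
Qed.
End ClusterExists.

Definition laurentC (F : fieldType) (P : laurent int) : laurent F :=
  [malg k in msupp P => (mcoeff k P)%:~R].

Definition laurent_eval (F : fieldType) (P : laurent F) (z w : F) : F :=
  \sum_(k <- msupp P) mcoeff k P * z ^ k.1 * w ^ k.2.

Section ComplexFunctions.
Variable R : realType.
Implicit Types (t : R) (s z : R[i]).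

Definition expi t : R[i] := cos t +i* sin t.

Definition cexp z : R[i] := (expR (complex.Re z))%:C * expi (complex.Im z).

(* The principal argument, with values in ]-pi, pi]. *)
Definition carg z : R :=
  let a := acos (complex.Re z / Normc.normc z) in
  if 0 <= complex.Im z then a else - a.

(* Mahler measure as an iterated Lebesgue integral; [lne 0 = -oo]. *)
Definition mahler (P : laurent R[i]) : \bar R :=
  (((2 * pi) ^- 2)%:E *
   \int[lebesgue_measure]_(t1 in `[(- pi)%R, pi])
   \int[lebesgue_measure]_(t2 in `[(- pi)%R, pi])
     lne (Normc.normc (laurent_eval P (expi t1) (expi t2)))%:E)%E.

(* [Li2] and [bloch_wigner] take the values of the dilogarithm and of the
   Bloch-Wigner function on the closed unit disc, where the series converges;
   no analytic continuation outside it is attempted. *)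
Definition Li2 z : R[i] :=
  limn (series (fun n => z ^+ n.+1 / n.+1%:R ^+ 2 : R[i]^o)).

Definition bloch_wigner z : R :=
  complex.Im (Li2 z) + ln (Normc.normc z) * carg (1 - z).

Definition chi3 (n : nat) : R[i] :=
  match (n %% 3)%N with 1%N => 1 | 2%N => -1 | _ => 0 end.

(* L is the entire function which continues the Dirichlet series of [chi3];
   there is only one, by the identity theorem. *)
Definition is_dirichletL_chi3 (L : R[i]^o -> R[i]^o) : Prop :=
  (forall s : R[i]^o, derivable L s 1) /\
  (forall s : R[i]^o, 1 < complex.Re s ->
     series (fun n => chi3 n.+1 * cexp (- s * (ln n.+1%:R)%:C) : R[i]^o)
       @ \oo --> L s).

Fixpoint chebyshev2 (n : nat) : {poly R} * {poly R} :=
  if n is n'.+1 then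
    let: (p, q) := chebyshev2 n' in (q, 2%:P * 'X * q - p)
  else (1, 'X).

Definition chebyshev (n : nat) : {poly R} := (chebyshev2 n).1.

Lemma chebyshev_cos n t : (chebyshev n).[cos t] = cos (n%:R * t).
Proof.
suff: (chebyshev2 n).1.[cos t] = cos (n%:R * t) /\
      (chebyshev2 n).2.[cos t] = cos (n.+1%:R * t) by case.
elim: n => [|n] /=; first by rewrite mul0r cos0 mul1r hornerC hornerX.
case: (chebyshev2 n) => p q /= [hp hq]; split=> //.
rewrite !hornerE hp hq.
have -> : n.+2%:R * t = n.+1%:R * t + t by rewrite -natr1; ring.
have -> : n%:R * t = n.+1%:R * t - t by rewrite -[in RHS]natr1; ring.
by rewrite cosB cosD; ring.
Qed.

(* The division is exact: see [chebP_exact]. *)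
Definition chebP (r : nat) : {poly R} :=
  (1 - chebyshev r) ^+ r %/ ((2 ^ (1 - r%:Z))%:P * (1 - 'X)) - 1.

Lemma chebP_exact r : (0 < r)%N ->
  (chebP r + 1) * ((2 ^ (1 - r%:Z))%:P * (1 - 'X)) = (1 - chebyshev r) ^+ r.
Proof.
move=> r0; rewrite /chebP subrK divpK // mul_polyC dvdpZl; last first.
  by rewrite expfz_neq0 // pnatr_eq0.
rewrite -opprB dvdpNl; apply: dvdp_trans (dvdp_exp2l _ r0).
rewrite expr1 dvdp_XsubCl rootE !hornerE.
by rewrite -cos0 chebyshev_cos mulr0 cos0 subrr.
Qed.

End ComplexFunctions.

(* Main.v *)
(* Up to a monomial, x4 is the product over z^r = -1 of the factors
   x2^r + 1 - z x1.  Jensen's formula in x2 turns each of them into the mean of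
   log^+ |1 + e^(it)|, which is also what it gives for x1 + x2 + 1; this mean is
   found from the fact that - D(e^(it)) is a primitive of log |1 - e^(it)|.

   For x5, a monomial in x1 removed, Jensen's formula in x1 leaves r times the
   mean of log max(|2 sin(rt/2)|^r, |2 sin(t/2)|).  On each arch
   2 pi k/r < t < 2 pi (k+1)/r the function
   r log |2 sin(rt/2)| - log |2 sin(t/2)| is strictly concave and changes sign
   at exactly two points; these are the t_j^* and their reflections 2 pi - t_j^*.
   The two terms have the primitives - D(e^(irt)) and D(e^(it)).

   L(chi_(-3), s) is continued by repeated summation by parts.  At s = -1 its
   derivative becomes - lim (3 f_N(1/3) + N log N), where f_N(x) is the sum over
   m < N of a(m+x) - a(m+1-x) with a(t) = t log t.  Since f_N(1/2) = 0, it is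
   obtained by integrating f_N' over [1/3, 1/2], and
   f_N'(x) - 2 N log N converges uniformly to log (2 sin(pi x)) by the product
   formula for the cosine and Stirling's formula.  Hence
   L'(chi_(-3), -1) = 3 D(e^(2 pi i/3)) / (2 pi) = D(e^(pi i/3)) / pi. *)

Require Import Defs.
From HB Require Import structures.
From mathcomp Require Import all_boot all_order all_algebra finmap.
From mathcomp.multinomials Require Import monalg.
From mathcomp Require Import all_classical all_reals all_analysis.
From mathcomp Require Import complex.
From mathcomp Require Import measurable_realfun ring lra zify.

Set Implicit Arguments.
Unset Strict Implicit.
Unset Printing Implicit Defensive.

Import Order.TTheory GRing.Theory Num.Theory.
Import numFieldNormedType.Exports.

Local Open Scope classical_set_scope.
Local Open Scope ring_scope.
Local Open Scope complex_scope.

(** * Real calculus *)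

Section RealCalculus.
Variable R : realType.
Implicit Types (f g F G : R -> R) (a b c l x y : R).

Definition dv f x l := is_derive x (1 : R) f l.

Lemma dv_eq f x l l' : dv f x l -> l = l' -> dv f x l'.
Proof. by move=> h <-. Qed.

Lemma dv_cst c x : dv (fun=> c) x 0.
Proof. exact: is_derive_cst. Qed.

Lemma dv_id x : dv (fun y => y) x 1.
Proof. exact: is_derive_id. Qed.

Lemma dvD f g x a b : dv f x a -> dv g x b -> dv (fun y => f y + g y) x (a + b).
Proof. by move=> hf hg; exact: (@is_deriveD _ _ _ f g). Qed.

Lemma dvN f x a : dv f x a -> dv (fun y => - f y) x (- a).
Proof. by move=> hf; exact: (@is_deriveN _ _ _ f). Qed.

Lemma dvB f g x a b : dv f x a -> dv g x b -> dv (fun y => f y - g y) x (a - b).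
Proof. by move=> hf hg; exact: dvD hf (dvN hg). Qed.

Lemma dvM f g x a b : dv f x a -> dv g x b ->
  dv (fun y => f y * g y) x (a * g x + f x * b).
Proof.
move=> hf hg; apply: (@dv_eq _ _ (f x *: b + g x *: a)).
  exact: (@is_deriveM _ _ f g).
by rewrite addrC [a * _]mulrC.
Qed.

Lemma dvZ c f x a : dv f x a -> dv (fun y => c * f y) x (c * a).
Proof. by move=> hf; apply: dv_eq (dvM (dv_cst c x) hf) _; rewrite mul0r add0r. Qed.

Lemma dv_comp f g x a b : dv f (g x) a -> dv g x b -> dv (fun y => f (g y)) x (a * b).
Proof. by move=> hf hg; exact: (@is_derive1_comp _ f g). Qed.

Lemma dv_near f g x a : (\near x, f x = g x) -> dv f x a -> dv g x a.
Proof. by move=> fg hf; apply: near_eq_is_derive fg hf. Qed.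

Lemma dvX f n x a : dv f x a -> dv (fun y => f y ^+ n) x (n%:R * f x ^+ n.-1 * a).
Proof.
move=> hf; elim: n => [|n ih]; first by rewrite !mul0r; exact: dv_cst.
apply: (@dv_near (fun y => f y * f y ^+ n)); first by apply: filterE => y; rewrite exprS.
apply: dv_eq (dvM hf ih) _; case: n {ih} => [|n] /=; first by rewrite expr0; ring.
by rewrite [f x ^+ n.+1]exprS -[n.+2%:R]natr1; ring.
Qed.

Lemma dv_sum (h dh : nat -> R -> R) n x : (forall i, dv (h i) x (dh i x)) ->
  dv (fun y => \sum_(i < n) h i y) x (\sum_(i < n) dh i x).
Proof.
move=> hh; elim: n => [|n ih].
  rewrite big_ord0 (_ : (fun=> _) = fun=> 0); first exact: dv_cst.
  by apply/funext => y; rewrite big_ord0.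
rewrite big_ord_recr /= (_ : (fun y => _) =
  fun y => \sum_(i < n) h i y + h n y); first exact: dvD.
by apply/funext => y; rewrite big_ord_recr.
Qed.

Lemma dv_ln f x a : 0 < f x -> dv f x a -> dv (fun y => ln (f y)) x (a / f x).
Proof.
move=> f0 hf; apply: dv_eq (dv_comp _ hf) _; first exact: is_derive1_ln.
by rewrite mulrC.
Qed.

Lemma dvV f x a : f x != 0 -> dv f x a -> dv (fun y => (f y)^-1) x (- a / f x ^+ 2).
Proof.
move=> f0 [df hf]; split; first exact: derivableV.
by rewrite deriveV// hf -[_ *: _]/(_ * _) mulrC mulrN mulNr.
Qed.

Lemma dv_sin f x a : dv f x a -> dv (fun y => sin (f y)) x (cos (f x) * a).
Proof. by move=> hf; exact: dv_comp (is_derive_sin _) hf. Qed.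

Lemma dv_cos f x a : dv f x a -> dv (fun y => cos (f y)) x (- sin (f x) * a).
Proof. by move=> hf; exact: dv_comp (is_derive_cos _) hf. Qed.

Lemma dv_exp f x a : dv f x a -> dv (fun y => expR (f y)) x (expR (f x) * a).
Proof. by move=> hf; exact: dv_comp (is_derive_expR _) hf. Qed.

Lemma dv_cont f x a : dv f x a -> {for x, continuous f}.
Proof.
by move=> [hf _]; apply: differentiable_continuous; exact/derivable1_diffP.
Qed.

Lemma dv_mvt f (df : R -> R) a b : a <= b ->
  (forall x, a <= x <= b -> dv f x (df x)) ->
  exists2 c, a <= c <= b & f b - f a = df c * (b - a).
Proof.
move=> ab hf; have [||c cab E] := @MVT_segment _ f df a b ab.
- move=> x /[!in_itv]/= /andP[ax xb]; apply: hf; by rewrite !ltW.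
- apply: continuous_in_subspaceT => x; rewrite inE/= in_itv/= => /hf; exact: dv_cont.
by exists c.
Qed.

Lemma dv_mvt_oo f (df : R -> R) a b : a < b ->
  (forall x, a < x < b -> dv f x (df x)) ->
  {for a, continuous f} -> {for b, continuous f} ->
  exists2 c, a < c < b & f b - f a = df c * (b - a).
Proof.
move=> ab hf fa fb; have [||c cab E] := @MVT _ f df a b ab.
- by move=> x /[!in_itv]/=; exact: hf.
- apply: continuous_in_subspaceT => x; rewrite inE/= in_itv/= => /andP[].
  rewrite !le_eqVlt => /orP[/eqP <- //|ax] /orP[/eqP -> //|xb].
  by apply: dv_cont (hf _ _); rewrite ax.
by exists c.
Qed.

Lemma dv_ge0_le f (df : R -> R) a b : a <= b ->
  (forall x, a <= x <= b -> dv f x (df x)) ->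
  (forall x, a <= x <= b -> 0 <= df x) -> f a <= f b.
Proof.
move=> ab hf d0; have [c cab E] := dv_mvt ab hf.
by rewrite -subr_ge0 E mulr_ge0 ?d0// subr_ge0.
Qed.

Lemma dv_norm_le f (df : R -> R) G (dG : R -> R) a b : a <= b ->
  (forall x, a <= x <= b -> dv f x (df x)) ->
  (forall x, a <= x <= b -> dv G x (dG x)) ->
  (forall x, a <= x <= b -> `|df x| <= dG x) -> `|f b - f a| <= G b - G a.
Proof.
move=> ab hf hG le; rewrite ler_norml opprB; apply/andP; split.
  have : G a + f a <= G b + f b; last by lra.
  apply: (@dv_ge0_le (fun x => G x + f x) (fun x => dG x + df x)) => // x xab.
    exact: dvD (hG _ xab) (hf _ xab).
  by have := le _ xab; rewrite ler_norml => /andP[]; lra.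
have : G a - f a <= G b - f b; last by lra.
apply: (@dv_ge0_le (fun x => G x - f x) (fun x => dG x - df x)) => // x xab.
  exact: dvB (hG _ xab) (hf _ xab).
by have := le _ xab; rewrite ler_norml => /andP[]; lra.
Qed.

Lemma dv0_cst f a b : a <= b -> (forall x, a <= x <= b -> dv f x 0) -> f b = f a.
Proof.
move=> ab hf; have [c _] := @dv_mvt f (fun=> 0) a b ab hf.
by rewrite mul0r => /eqP; rewrite subr_eq0 => /eqP.
Qed.

Lemma dvP f x l : (forall e : R, 0 < e -> exists2 d : R, 0 < d &
    forall y : R, `|y - x| < d -> `|f y - f x - l * (y - x)| <= e * `|y - x|) ->
  dv f x l.
Proof.
move=> H; have hc : h^-1 *: (f (h *: 1 + x) - f x) @[h --> 0^'] --> l.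
  apply/cvgrPdist_le => e e0; have [d d0 Hd] := H e e0.
  near=> h; have h0 : h != 0 by near: h; exact: nbhs_dnbhs_neq.
  have := Hd (h + x); rewrite addrK => /(_ _)/wrap[].
    near: h; apply: dnbhs0_lt; exact: d0.
  rewrite -[h *: 1]/(h * 1) mulr1 -[_ *: _]/(_ * _) => le.
  rewrite distrC -(@ler_pM2r _ `|h|) ?normr_gt0// -normrM mulrBl mulrAC mulVf// mul1r.
  exact: le.
by split; [apply/cvg_ex; exists l | exact/cvg_lim].
Unshelve. all: by end_near. Qed.

Lemma dv_lim (S C : nat -> R -> R) (e : nat -> R) F g x d : 0 < d ->
  (forall N y, `|y - x| < d -> dv (S N) y (C N y)) ->
  (forall N y, `|y - x| < d -> `|C N y - g y| <= e N) ->
  e @ \oo --> (0 : R) ->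
  (forall y, S ^~ y @ \oo --> F y) ->
  {for x, continuous g} -> dv F x (g x).
Proof.
move=> d0 dS Cg e0 SF gx; apply: dvP => eps eps0.
have /cvgrPdist_le/(_ _ eps0)/nbhs_ballP[d1 /= d10 Hd1] := gx.
exists (Num.min d d1); first by rewrite lt_min d0.
move=> y; rewrite lt_min => /andP[yd yd1].
have key : forall N, `|S N y - S N x - g x * (y - x)| <= (eps + e N) * `|y - x|.
  move=> N; have [z zx E] : exists2 z, `|z - x| <= `|y - x| &
      S N y - S N x = C N z * (y - x).
    have [xy|yx] := leP x y.
      have [|z zxy E] := @dv_mvt (S N) (C N) x y xy.
        move=> z zxy; apply: dS; apply: le_lt_trans yd.
        by rewrite !ger0_norm; lra.
      by exists z => //; rewrite !ger0_norm; lra.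
    have [|z zxy E] := @dv_mvt (S N) (C N) y x (ltW yx).
      move=> z zxy; apply: dS; apply: le_lt_trans yd.
      by rewrite !ler0_norm; lra.
    exists z; first by rewrite !ler0_norm; lra.
    by rewrite -opprB E -mulrN opprB.
  rewrite E -mulrBl normrM ler_wpM2r//.
  have -> : C N z - g x = (C N z - g z) - (g x - g z) by ring.
  apply: le_trans (ler_normB _ _) _; rewrite addrC lerD//.
    apply: Hd1; rewrite /ball/= distrC; exact: le_lt_trans zx yd1.
  by apply: Cg; exact: le_lt_trans zx yd.
have lim1 : `|S N y - S N x - g x * (y - x)| @[N --> \oo] -->
    `|F y - F x - g x * (y - x)|.
  by apply: cvg_norm; apply: cvgB (cvg_cst _); apply: cvgB.
have lim2 : (eps + e N) * `|y - x| @[N --> \oo] --> (eps + 0) * `|y - x|.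
  by apply: cvgMl; apply: cvgD e0; exact: cvg_cst.
rewrite addr0 in lim2.
by apply: ler_cvg_to lim1 lim2 _; apply: nearW.
Qed.

Lemma cont_lim (S : nat -> R -> R) (e : nat -> R) F x :
  (forall N, {for x, continuous (S N)}) ->
  (forall N y, `|S N y - F y| <= e N) -> e @ \oo --> (0 : R) ->
  {for x, continuous F}.
Proof.
move=> cS SF e0; apply/cvgrPdist_le => eps eps0.
have eps30 : 0 < eps / 3 by lra.
have /cvgrPdist_le/(_ _ eps30)[N _ /(_ N (leqnn N))/= eN] := e0.
have /cvgrPdist_le/(_ _ eps30) := cS N.
apply: filterS => y Sy.
have := SF N x; have := SF N y; move: Sy eN; rewrite sub0r normrN.
have := ler_norm (e N).
rewrite !ler_norml => ? /andP[? ?] ? /andP[? ?] /andP[? ?]; apply/andP; split; lra.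
Qed.

Lemma cvg_shiftnC N (u : nat -> R) l :
  ((fun k => u (N + k)%N) @ \oo --> l) = (u @ \oo --> l).
Proof.
rewrite -(cvg_shiftn N u (nbhs l)) (_ : (fun k => _) = fun k => u (k + N)%N)//.
by apply/funext => k; rewrite addnC.
Qed.

Lemma cvg_dom_telescope (u e : nat -> R) :
  (forall n, `|u n| <= e n - e n.+1) -> e @ \oo --> (0 : R) ->
  exists2 l, series u @ \oo --> l & forall N, `|series u N - l| <= e N.
Proof.
move=> ue e0.
have le : forall N k, `|series u (N + k)%N - series u N| <= e N - e (N + k)%N.
  move=> N; elim=> [|k ih]; first by rewrite addn0 !subrr normr0.
  rewrite addnS seriesSr addrAC; apply: le_trans (ler_normD _ _) _.
  by have := ue (N + k)%N; lra.
have tele N : (fun k => e N - e (N + k)%N) @ \oo --> e N.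
  rewrite -[X in _ --> X]subr0; apply: cvgB; first exact: cvg_cst.
  rewrite cvg_shiftnC; exact: e0.
have cu : cvgn (series u).
  apply: normed_cvg; apply: (@nondecreasing_is_cvgn); first by apply/nondecreasing_seqP => n;
    rewrite /= -[leRHS]/(series (fun k => `|u k|) n.+1) seriesSr lerDl.
  exists (e 0%N) => _ [n _ <-].
  rewrite -[leLHS]/(series (fun k => `|u k|) n).
  have : series (fun k => `|u k|) n <= e 0%N - e n.
    elim: n => [|n ih]; first by rewrite seriesEnat/= big_geq// subrr.
    by rewrite seriesSr; have := ue n; lra.
  have e_ge0 : 0 <= e n.
    rewrite -(cvg_lim _ e0)//; apply: nonincreasing_cvgn_ge; last by apply/cvg_ex; exists 0.
    apply/nonincreasing_seqP => k; rewrite -subr_ge0.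
    exact: le_trans (normr_ge0 _) (ue k).
  lra.
exists (limn (series u)) => // N.
have lim1 : `|series u (N + k)%N - series u N| @[k --> \oo] --> `|limn (series u) - series u N|.
  apply: cvg_norm; apply: cvgB; last exact: cvg_cst.
  by rewrite (cvg_shiftnC N).
rewrite distrC; apply: ler_cvg_to lim1 (tele N) _.
by apply: nearW => k; exact: le.
Qed.
Lemma cvg_subseq (u : nat -> R) l (p : nat -> nat) :
  u @ \oo --> l -> (forall n, (n <= p n)%N) -> (fun n => u (p n)) @ \oo --> l.
Proof.
move=> ul np P /ul[N _ NP]; exists N => // n /= Nn.
by apply: NP; exact: leq_trans Nn (np n).
Qed.

End RealCalculus.

(** * The Clausen function *)

Section Clausen.
Variable R : realType.
Implicit Types (a b t x y : R).

Lemma cos_lip x y : `|cos x - cos y| <= `|x - y|.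
Proof.
wlog xy : x y / y <= x.
  by move=> H; have [/H//|/ltW/H] := leP y x; rewrite distrC (distrC y).
rewrite (ger0_norm (_ : 0 <= x - y)) ?subr_ge0//.
apply: (@dv_norm_le _ cos (fun z => - sin z) (fun z => z) (fun=> 1)) => // z _.
- exact: is_derive_cos.
- exact: dv_id.
- by rewrite normrN sin_max.
Qed.

(* |1 - a e^(it)|^2 *)
Definition qnorm a t : R := 1 - 2 * a * cos t + a ^+ 2.

Lemma qnormE a t : qnorm a t = (1 - a * cos t) ^+ 2 + (a * sin t) ^+ 2.
Proof. by rewrite exprMn sin2cos2 /qnorm; ring. Qed.

Lemma qnorm_ge0 a t : 0 <= qnorm a t.
Proof. by rewrite qnormE addr_ge0 ?sqr_ge0. Qed.

Lemma qnorm_ge_sqr a t : 0 <= a -> (1 - a) ^+ 2 <= qnorm a t.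
Proof. by move=> a0; have := cos_le1 t; rewrite /qnorm; nra. Qed.

Lemma qnorm_ge_cos a t : 0 <= a <= 1 -> (1 - cos t) / 2 <= qnorm a t.
Proof.
move=> a01; have := cos_le1 t; have := cos_geN1 t; rewrite /qnorm.
have [c0|c0] := leP 0 (cos t); last by nra.
have := sqr_ge0 (a - cos t); nra.
Qed.

Definition csum a t n : R := \sum_(k < n) a ^+ k.+1 * cos (k.+1%:R * t) / k.+1%:R.

Lemma geom_cos a t n :
  (\sum_(k < n) a ^+ k * cos (k.+1%:R * t)) * qnorm a t =
  cos t - a - a ^+ n * cos (n.+1%:R * t) + a ^+ n.+1 * cos (n%:R * t).
Proof.
elim: n => [|n ih].
  by rewrite big_ord0 !mul0r cos0 !mul1r expr1 mulr1; ring.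
rewrite big_ord_recr /= mulrDl ih.
have -> : n.+2%:R * t = n.+1%:R * t + t by rewrite -[n.+2%:R]natr1; ring.
have -> : n%:R * t = n.+1%:R * t - t by rewrite -[n.+1%:R]natr1; ring.
by rewrite cosB cosD /qnorm !exprS; ring.
Qed.

Lemma dv_qnorm a t : dv (qnorm ^~ t) a (2 * (a - cos t)).
Proof.
rewrite /qnorm; apply: dv_eq.
  apply: dvD; last by apply: dvX (dv_id _).
  apply: dvB (dv_cst _ _) _; apply: (dvM (a := 2)) (dv_cst _ _).
  by apply: dv_eq (dvZ _ (dv_id _)) _; rewrite mulr1.
by rewrite /= expr1; ring.
Qed.

Lemma csum_ln a t n m : 0 <= a <= 1 -> 0 < m ->
  (forall b, 0 <= b <= a -> m <= qnorm b t) ->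
  `|csum a t n + ln (qnorm a t) / 2| <= 2 / m / n.+1%:R.
Proof.
move=> /andP[a0 a1] m0 qm.
pose f b := csum b t n + ln (qnorm b t) / 2.
pose df b := \sum_(k < n) b ^+ k * cos (k.+1%:R * t) + (b - cos t) / qnorm b t.
pose G b := 2 / m * (b ^+ n.+1 / n.+1%:R).
pose dG b := 2 / m * b ^+ n.
have : `|f a - f 0| <= G a - G 0.
  apply: (@dv_norm_le _ f df G dG) => // b /andP[b0 ba].
  - have qb : 0 < qnorm b t by apply: lt_le_trans (qm _ _) => //; rewrite b0.
    apply: dvD.
      apply: (@dv_sum _ (fun k b => b ^+ k.+1 * cos (k.+1%:R * t) / k.+1%:R)
        (fun k b => b ^+ k * cos (k.+1%:R * t))) => i;
          apply: (@dv_eq _ _ _ (i.+1%:R * b ^+ i * 1 * (cos (i.+1%:R * t) / i.+1%:R))).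
        apply: (@dv_near _ (fun b => (cos (i.+1%:R * t) / i.+1%:R) * b ^+ i.+1)).
          by apply: filterE => z; rewrite mulrC mulrA.
        by apply: dv_eq (dvZ _ (dvX _ (dv_id _))) _; rewrite mulrC.
      by field; rewrite nat1r pnatr_eq0.
    apply: (@dv_near _ (fun b => 2^-1 * ln (qnorm b t))).
      by apply: filterE => z; rewrite mulrC.
    apply: dv_eq (dvZ _ (@dv_ln _ (qnorm ^~ t) _ _ qb (dv_qnorm _ _))) _.
    by field; exact: lt0r_neq0.
  - apply: (@dv_eq _ _ _ (2 / m * (n.+1%:R^-1 * (n.+1%:R * b ^+ n * 1)))).
      apply: (@dv_near _ (fun b => 2 / m * (n.+1%:R^-1 * b ^+ n.+1))).
        by apply: filterE => z; rewrite /G [n.+1%:R^-1 * _]mulrC.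
      exact: dvZ (dvZ _ (dvX _ (dv_id _))).
    by rewrite /dG mulr1 [_^-1 * _]mulrA mulVf ?mul1r// pnatr_eq0.
  have qb : m <= qnorm b t by apply: qm; rewrite b0.
  have q0 : 0 < qnorm b t by exact: lt_le_trans qb.
  rewrite /df -[X in X + _](mulfK (lt0r_neq0 q0)) geom_cos -mulrDl.
  rewrite normrM normfV (gtr0_norm q0) /dG ler_pdivrMr//.
  have -> : cos t - b - b ^+ n * cos (n.+1%:R * t) + b ^+ n.+1 * cos (n%:R * t) + (b - cos t)
    = b ^+ n * (b * cos (n%:R * t) - cos (n.+1%:R * t)) by rewrite exprS; ring.
  have bn : 0 <= b ^+ n by rewrite exprn_ge0.
  rewrite normrM (ger0_norm bn) [2 / m * _]mulrC -mulrA ler_wpM2l//.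
  apply: (@le_trans _ _ 2).
    apply: le_trans (ler_normB _ _) _; rewrite normrM (ger0_norm b0).
    have := cos_max (n%:R * t); have := cos_max (n.+1%:R * t).
    have b1 : b <= 1 by exact: le_trans ba a1.
    have := normr_ge0 (cos (n%:R * t)); nra.
  by rewrite -mulrA ler_peMr// mulrC ler_pdivlMr// mul1r.
have -> : f 0 = 0.
  rewrite /f /csum big1 ?add0r; last by move=> i _; rewrite expr0n/= !mul0r.
  by rewrite /qnorm expr0n/= mulr0 mul0r subr0 addr0 ln1 mul0r.
rewrite /G expr0n/= mul0r mulr0 !subr0 => /le_trans -> //.
rewrite ler_wpM2l ?divr_ge0 ?(ltW m0)// ler_piMl ?invr_ge0//.
exact: exprn_ile1.
Qed.

Definition clterm a t (k : nat) : R := a ^+ k.+1 * sin (k.+1%:R * t) / k.+1%:R ^+ 2.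

(* - [clausen a] is a primitive of log |1 - a e^(it)| for every [a] in [0, 1];
   this yields Jensen's formula.  [clausen 1 t] is D(e^(it)). *)
Definition clausen a t : R := limn (series (clterm a t)).

Lemma clterm_le a t k : 0 <= a <= 1 ->
  `|clterm a t k| <= 2 / k.+1%:R - 2 / k.+2%:R.
Proof.
move=> /andP[a0 a1].
have k0 : 0 < k.+1%:R :> R by rewrite ltr0n.
have -> : 2 / k.+1%:R - 2 / k.+2%:R = 2 / (k.+1%:R * (k.+1%:R + 1)) :> R.
  by rewrite -[k.+2%:R]natr1; field; rewrite !gt_eqF// addr_gt0.
rewrite /clterm normrM normfV normrX (ger0_norm (ltW k0)).
apply: (@le_trans _ _ (1 / k.+1%:R ^+ 2)).
  rewrite ler_wpM2r ?invr_ge0 ?exprn_ge0 ?(ltW k0)// normrM normrX (ger0_norm a0).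
  by rewrite mulr_ile1 ?exprn_ge0 ?exprn_ile1 ?sin_max.
have : 1 <= k.+1%:R :> R by rewrite ler1n.
move: (k.+1%:R : R) k0 => z z0 z1.
rewrite ler_pdivlMr ?mulr_gt0 ?addr_gt0// mul1r mulrC ler_pdivrMr ?exprn_gt0//.
nra.
Qed.

Lemma cvg_2Vn : (fun k => 2 / k.+1%:R : R) @ \oo --> (0 : R).
Proof.
rewrite -[X in _ --> X](mulr0 2); apply: cvgMr; exact: cvg_harmonic.
Qed.

Lemma clausen_cvg a t : 0 <= a <= 1 -> series (clterm a t) @ \oo --> clausen a t.
Proof.
move=> a01; have [l sl _] := cvg_dom_telescope (fun k => clterm_le t k a01) cvg_2Vn.
by rewrite /clausen (cvg_lim _ sl).
Qed.

Lemma clausen_tail a t n : 0 <= a <= 1 ->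
  `|series (clterm a t) n - clausen a t| <= 2 / n.+1%:R.
Proof.
move=> a01; have [l sl le] := cvg_dom_telescope (fun k => clterm_le t k a01) cvg_2Vn.
by rewrite /clausen (cvg_lim _ sl).
Qed.

Lemma dv_clterm a t n : dv (fun t => series (clterm a t) n) t (csum a t n).
Proof.
apply: (@dv_near _ (fun t => \sum_(k < n) clterm a t k)).
  by apply: filterE => z; rewrite seriesEord.
apply: (@dv_sum _ (fun k t => clterm a t k) (fun k t => a ^+ k.+1 * cos (k.+1%:R * t) / k.+1%:R)).
move=> k; rewrite /clterm.
apply: (@dv_near _ (fun t => a ^+ k.+1 / k.+1%:R ^+ 2 * sin (k.+1%:R * t))).
  by apply: filterE => z; rewrite mulrAC.
apply: dv_eq (dvZ _ (dv_sin (dvZ _ (dv_id _)))) _.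
by field; rewrite nat1r pnatr_eq0.
Qed.

Lemma clausen_cont a : 0 <= a <= 1 -> continuous (clausen a).
Proof.
move=> a01 t; apply: (@cont_lim _ (fun n t => series (clterm a t) n) _ _ _ _ _ cvg_2Vn).
  by move=> n; exact: dv_cont (dv_clterm a t n).
by move=> n y; exact: clausen_tail.
Qed.

Lemma cont_lnqnorm a t : 0 < qnorm a t ->
  {for t, continuous (fun y => - (ln (qnorm a y) / 2))}.
Proof.
move=> q0; apply: dv_cont; apply: dvN.
apply: (@dv_near _ (fun y => 2^-1 * ln (qnorm a y))).
  by apply: filterE => z; rewrite mulrC.
apply: dvZ; apply: (@dv_ln _ (qnorm a) _ _ q0); apply: dvD (dv_cst _ _).
apply: dvB (dv_cst _ _) _; apply: dvZ; exact: dv_cos (dv_id _).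
Qed.

Lemma clausen_dv a t : 0 <= a <= 1 -> 0 < qnorm a t ->
  dv (clausen a) t (- (ln (qnorm a t) / 2)).
Proof.
move=> a01 q0; have /andP[a0 a1] := a01.
have [d d0 [m m0 H]] : exists2 d : R, 0 < d & exists2 m : R, 0 < m &
   forall y, `|y - t| < d -> forall b, 0 <= b <= a -> m <= qnorm b y.
  have [al|ag] := ltP a 1.
    exists 1 => //; exists ((1 - a) ^+ 2); first by rewrite exprn_gt0 ?subr_gt0.
    move=> y _ b /andP[b0 ba]; apply: le_trans (qnorm_ge_sqr _ b0).
    by rewrite lerXn2r ?nnegrE ?subr_ge0 ?lerB// (le_trans ba).
  have a_1 : a = 1 by apply/le_anti; rewrite a1.
  have c1 : 0 < 1 - cos t by move: q0; rewrite a_1 /qnorm expr1n; lra.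
  exists ((1 - cos t) / 2); first lra.
  exists ((1 - cos t) / 4); first lra.
  move=> y yt b /andP[b0 ba]; apply: le_trans (@qnorm_ge_cos _ _ _).
    have := le_lt_trans (cos_lip y t) yt; rewrite ltr_norml; lra.
  by rewrite b0 (le_trans ba).
apply: (@dv_lim _ (fun n t => series (clterm a t) n) (fun n t => csum a t n)
  (fun n => 2 / m / n.+1%:R) (clausen a) (fun t => - (ln (qnorm a t) / 2)) t d) => //.
- by move=> n y _; exact: dv_clterm.
- by move=> n y yt; rewrite opprK; apply: csum_ln => // b; apply: H.
- rewrite -[X in _ --> X](mulr0 (2 / m)); apply: cvgMr; exact: cvg_harmonic.
- by move=> y; exact: clausen_cvg.
- exact: cont_lnqnorm.
Qed.

Lemma sin_period_nat x (n : nat) : sin (x + n%:R * (2 * pi)) = sin x.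
Proof.
have -> : n%:R * (2 * pi) = (pi *+ 2) *+ n :> R by rewrite -[RHS]mulr_natl -[pi *+ 2]mulr_natl.
by rewrite (periodicn (@sinD2pi R)).
Qed.

Lemma cos_period_nat x (n : nat) : cos (x + n%:R * (2 * pi)) = cos x.
Proof.
have -> : n%:R * (2 * pi) = (pi *+ 2) *+ n :> R by rewrite -[RHS]mulr_natl -[pi *+ 2]mulr_natl.
by rewrite (periodicn (@cosD2pi R)).
Qed.

Lemma clausen2pi_nat a t (n : nat) : clausen a (t + n%:R * (2 * pi)) = clausen a t.
Proof.
rewrite /clausen; congr (limn (series _)); apply/funext => k; rewrite /clterm.
by rewrite mulrDr mulrA -natrM sin_period_nat.
Qed.

Lemma clausen2pi a t : clausen a (t + 2 * pi) = clausen a t.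
Proof. by have := clausen2pi_nat a t 1; rewrite mul1r. Qed.

Lemma clausenN a t : 0 <= a <= 1 -> clausen a (- t) = - clausen a t.
Proof.
move=> a01; apply: cvg_lim => //.
rewrite (_ : series (clterm a (- t)) = fun n => - series (clterm a t) n).
  by apply: cvgN; exact: clausen_cvg.
apply/funext => n; rewrite !seriesEord/= -sumrN; apply: eq_bigr => k _.
by rewrite /clterm mulrN sinN mulrN mulNr.
Qed.

Lemma clausen_pi a : 0 <= a <= 1 -> clausen a pi = 0.
Proof.
move=> a01; have := clausen2pi a (- pi).
by rewrite clausenN// (_ : - pi + 2 * pi = pi :> R); [lra|ring].
Qed.

Lemma clausen_dup t : clausen 1 (2 * t) = 2 * (clausen 1 t - clausen 1 (pi - t)).
Proof.
have h1 : 0 <= (1 : R) <= 1 by rewrite ler01 lexx.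
have E n : series (clterm 1 (2 * t)) n =
    2 * (series (clterm 1 t) (2 * n)%N - series (clterm 1 (pi - t)) (2 * n)%N).
  elim: n => [|n ih]; first by rewrite !seriesEord/= !big_ord0; ring.
  rewrite mulnS !add2n !seriesSr ih /clterm !expr1n !mul1r.
  have -> : (2 * n).+2%:R * (pi - t) = - ((2 * n).+2%:R * t) + n.+1%:R * (2 * pi).
    by rewrite -natr1 -[(2 * n).+1%:R]natr1 -[n.+1%:R]natr1 natrM; ring.
  have -> : (2 * n).+1%:R * (pi - t) = pi - ((2 * n).+1%:R * t) + n%:R * (2 * pi).
    by rewrite -[(2 * n).+1%:R]natr1 natrM; ring.
  rewrite !sin_period_nat sinN sinB sinpi cospi.
  have -> : n.+1%:R * (2 * t) = (2 * n).+2%:R * t.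
    by rewrite mulrCA mulrA -natrM mulnS.
  have -> : (2 * n).+2%:R = 2 * n.+1%:R :> R by rewrite -natrM mulnS.
  by field; rewrite -natrM !nat1r !pnatr_eq0.
apply: cvg_lim => //.
rewrite (_ : series _ = fun n => 2 * (series (clterm 1 t) (2 * n)%N -
  series (clterm 1 (pi - t)) (2 * n)%N)); last exact/funext/E.
have sub x : (fun n => series (clterm 1 x) (2 * n)%N) @ \oo --> clausen 1 x.
  by apply: (cvg_subseq (p := muln 2) (clausen_cvg h1)) => n; rewrite leq_pmull.
by apply: cvgMr; apply: cvgB; apply: sub.
Qed.

End Clausen.

(** * Integrals of logarithms *)

Section HasIntegral.
Variable R : realType.
Local Notation mu := (@lebesgue_measure R).
Implicit Types (f h : R -> \bar R) (F g : R -> R) (a b c x y I J : R).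

Definition hasint a b f I :=
  mu.-integrable `[a, b] f /\ (\int[mu]_(x in `[a, b]) f x = I%:E)%E.

Lemma hasint_eq a b f h I : (forall x, a <= x <= b -> f x = h x) ->
  hasint a b f I -> hasint a b h I.
Proof.
move=> fh [fi fI]; split.
  by apply: eq_integrable fi => // x; rewrite inE/= in_itv/=; exact: fh.
by rewrite -fI; apply: eq_integral => x; rewrite inE/= in_itv/= => /fh.
Qed.

Lemma hasintD a b f h I J : hasint a b f I -> hasint a b h J ->
  hasint a b (fun x => f x + h x)%E (I + J).
Proof.
move=> [fi fI] [hi hJ]; split; first exact: integrableD.
by rewrite integralD// fI hJ.
Qed.

Lemma hasintZ a b f I c : hasint a b f I -> hasint a b (fun x => c%:E * f x)%E (c * I).
Proof.
move=> [fi fI]; split; first exact: integrableZl.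
by rewrite integralZl// fI.
Qed.

Lemma hasint_cst a b c : a <= b -> hasint a b (fun=> c%:E) (c * (b - a)).
Proof.
move=> ab; have E : mu `[a, b]%classic = (b - a)%:E.
  by rewrite lebesgue_measure_itv/= lte_fin; case: ltgtP ab => // ->; rewrite subrr.
split.
  apply: (@continuous_compact_integrable _ (fun=> c)); first exact: segment_compact.
  by apply: continuous_subspaceT => x; exact: cvg_cst.
by rewrite integral_cst//= E EFinM.
Qed.

Lemma hasint_sum (T : Type) (s : seq T) a b (f : T -> R -> \bar R) (I : T -> R) :
  a <= b -> (forall i, hasint a b (f i) (I i)) ->
  hasint a b (fun x => \sum_(i <- s) f i x)%E (\sum_(i <- s) I i).
Proof.
move=> ab H; elim: s => [|i s ih].
  rewrite big_nil; have := hasint_cst 0 ab; rewrite mul0r.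
  by apply: hasint_eq => x _; rewrite big_nil.
rewrite big_cons; apply: hasint_eq (hasintD (H i) ih) => x _.
by rewrite big_cons.
Qed.

Lemma hasint_cat a c b f I J : a <= c -> c <= b ->
  hasint a c f I -> hasint c b f J -> hasint a b f (I + J).
Proof.
move=> ac cb [fi fI] [hi hJ].
have E : `[a, b]%classic = `[a, c]%classic `|` `]c, b]%classic.
  by rewrite -itv_bndbnd_setU// bnd_simp.
have mf2 : measurable_fun `[c, b] f by exact: measurable_int hi.
have mcb : measurable_fun `]c, b] f.
  by apply: measurable_funS mf2 => //; apply: subset_itvr; rewrite bnd_simp.
have mf : measurable_fun `[a, b] f.
  by rewrite E; apply/measurable_funU => //; split => //; exact: measurable_int fi.
have dis : [disjoint `[a, c] & `]c, b]].
  apply/eqP; rewrite -subset0 => x [] /=; rewrite !in_itv/= => /andP[_ xc] /andP[cx _].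
  by have := lt_le_trans cx xc; rewrite ltxx.
have K : (\int[mu]_(x in `[c, b]) f x = \int[mu]_(x in `]c, b]) f x)%E.
  by rewrite integral_itv_obnd_cbnd.
split.
  apply/integrableP; split => //.
  rewrite E integral_setU//=; last by rewrite -E; exact: measurableT_comp.
  case/integrableP : fi => _ h1; apply: lte_add_pinfty => //.
  case/integrableP : hi => _; apply: le_lt_trans.
  apply: ge0_subset_integral => //=; first exact: measurableT_comp.
  by apply: subset_itvr; rewrite bnd_simp.
by rewrite E integral_setU// -?E// fI -K hJ.
Qed.

Lemma hasint_ftc_oo a b f F g c : a < b ->
  (forall x, a < x < b -> [/\ f x = (g x)%:E, dv F x (g x),
     {for x, continuous g} & g x <= c]) ->
  {for a, continuous F} -> {for b, continuous F} -> hasint a b f (F b - F a).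
Proof.
move=> ab H ca cb.
have mg : measurable_fun `]a, b[ g.
  apply: open_continuous_measurable_fun; first exact: interval_open.
  by move=> x; rewrite inE/= in_itv/= => /H[].
have mf : measurable_fun `]a, b[ f.
  apply: (eq_measurable_fun (EFin \o g)); last exact/measurable_EFinP.
  by move=> x; rewrite inE/= in_itv/= => /H[->].
pose h x := c - g x.
have mh : measurable_fun `]a, b[ (EFin \o h).
  by apply/measurable_EFinP; apply: measurable_funB.
pose d (n : nat) := (b - a) / n.+3%:R.
have d0 n : 0 < d n by rewrite divr_gt0 ?subr_gt0// ltr0n.
have d2 n : a + d n < b - d n.
  have : d n * n.+3%:R = b - a by rewrite /d mulfVK ?pnatr_eq0.
  have : 3 <= n.+3%:R :> R by rewrite ler_nat.
  have := d0 n; nra.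
have ddec m n : (m <= n)%N -> d n <= d m.
  move=> mn; rewrite /d ler_pM2l ?subr_gt0// lef_pV2 ?posrE ?ltr0n// ler_nat.
  by rewrite !ltnS.
have dlim : d @ \oo --> (0 : R).
  rewrite -[X in _ --> X](mulr0 (b - a)); apply: cvgMr.
  apply: (cvg_subseq (p := fun n => n.+2) (@cvg_harmonic R)) => n.
  by rewrite -addn2 leq_addr.
pose A n := `[a + d n, b - d n]%classic.
have UA : \bigcup_n A n = `]a, b[%classic.
  apply/seteqP; split => x /=.
    move=> [n _]; rewrite /A/= !in_itv/=; have := d0 n; lra.
  rewrite in_itv/= => /andP[ax xb].
  have m0 : 0 < Num.min (x - a) (b - x) by rewrite lt_min !subr_gt0 ax.
  have /cvgrPdist_le/(_ _ m0)[n _ /(_ n (leqnn n))/=] := dlim.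
  rewrite sub0r normrN ger0_norm ?(ltW (d0 n))// le_min => /andP[? ?].
  by exists n => //; rewrite /A/= in_itv/=; lra.
have An n x : A n x -> a < x < b.
  by move=> Anx; have : (\bigcup_n A n) x; [exists n|rewrite UA/= in_itv].
pose H1 x := c * x - F x.
have iA n : (\int[mu]_(x in A n) (h x)%:E = (H1 (b - d n) - H1 (a + d n))%:E)%E.
  have dH x : a < x < b -> dv H1 x (h x).
    by move=> /H[_ hF _ _]; apply: dv_eq (dvB (dvZ c (dv_id x)) hF) _; rewrite mulr1.
  rewrite /A (@continuous_FTC2 _ h H1 _ _ (d2 n)) ?EFinB//.
  - apply: continuous_in_subspaceT => x; rewrite inE => /An/H[_ _ gx _].
    by apply: continuousB => //; exact: cvg_cst.
  - have dd := d2 n; have dp := d0 n; split.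
    + move=> x; rewrite in_itv/= => xx.
      by have [] : dv H1 x (h x) by apply: dH; lra.
    + apply: cvg_at_right_filter; apply: dv_cont (dH _ _); lra.
    + apply: cvg_at_left_filter; apply: dv_cont (dH _ _); lra.
  - move=> x; rewrite in_itv/= => xx; rewrite derive1E.
    have dp := d0 n.
    by have [] : dv H1 x (h x) by apply: dH; lra.
have L1 : (\int[mu]_(x in A n) (h x)%:E @[n --> \oo] --> \int[mu]_(x in `]a, b[) (h x)%:E)%E.
  rewrite -UA; apply: ge0_nondecreasing_set_cvg_integral.
  - apply/nondecreasing_seqP => n; apply/subsetPset => x.
    by rewrite /A/= !in_itv/=; have := ddec n n.+1 (leqnSn n); lra.
  - by move=> i; exact: measurable_itv.
  - move=> i; apply: measurable_funS mh => //.
    by move=> x /An; rewrite /= in_itv.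
  - by move=> i x /An/H[_ _ _]; rewrite lee_fin subr_ge0.
have cH1 x : {for x, continuous F} -> {for x, continuous H1}.
  move=> cF; apply: continuousB => //; exact: dv_cont (dvZ c (dv_id x)).
have L2 : (\int[mu]_(x in A n) (h x)%:E @[n --> \oo] --> (H1 b - H1 a)%:E)%E.
  under eq_fun do rewrite iA.
  apply: cvg_EFin; first exact: nearW.
  apply: cvgB.
    apply: continuous_cvg; first exact: cH1.
    by rewrite -[X in _ --> X](subr0 b); apply: cvgB => //; exact: cvg_cst.
  apply: continuous_cvg; first exact: cH1.
  by rewrite -[X in _ --> X](addr0 a); apply: cvgD => //; exact: cvg_cst.
have ih : (\int[mu]_(x in `]a, b[) (h x)%:E = (H1 b - H1 a)%:E)%E.
  exact: (cvg_unique _ L1 L2).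
have mh' : measurable_fun `[a, b] (EFin \o h).
  exact/emeasurable_fun_itv_obnd_cbndP/emeasurable_fun_itv_bndo_bndcP.
have ih' : hasint a b (EFin \o h) (H1 b - H1 a).
  have E : (\int[mu]_(x in `[a, b]) (h x)%:E = (H1 b - H1 a)%:E)%E.
    by rewrite (@integral_itv_bndoo _ _ _ (EFin \o h)).
  split => //; apply/integrableP; split => //.
  rewrite (@integral_itv_bndoo _ _ _ (fun x => `|(EFin \o h) x|)%E); last exact: measurableT_comp.
  rewrite [X in (X < _)%E](_ : _ = (H1 b - H1 a)%:E) ?ltry// -ih.
  apply: eq_integral => x; rewrite inE/= in_itv/= => /H[_ _ _ gc].
  by rewrite /= ger0_norm// subr_ge0.
have [gi gI] : hasint a b (EFin \o g) (F b - F a).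
  have := hasintD (hasint_cst c (ltW ab)) (hasintZ (-1) ih').
  rewrite (_ : c * (b - a) + _ = F b - F a); last by rewrite /H1; ring.
  by apply: hasint_eq => x _; rewrite /= -EFinM -EFinD /h; congr EFin; ring.
have mf' : measurable_fun `[a, b] f.
  exact/emeasurable_fun_itv_obnd_cbndP/emeasurable_fun_itv_bndo_bndcP.
have fgE x : x \in `]a, b[%classic -> f x = (g x)%:E.
  by rewrite inE/= in_itv/= => /H[].
split.
  apply/integrableP; split => //.
  rewrite (@integral_itv_bndoo _ _ _ (fun x => `|f x|)%E); last exact: measurableT_comp.
  rewrite [X in (X < _)%E](_ : _ = \int[mu]_(x in `]a, b[) `|(g x)%:E|)%E; last first.
    by apply: eq_integral => x /fgE ->.
  case/integrableP : gi => mg' ; rewrite (@integral_itv_bndoo _ _ _ (fun x => `|(EFin \o g) x|)%E)//.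
  by apply: measurableT_comp => //; exact/measurable_EFinP.
rewrite -gI integral_itv_bndoo// (@integral_itv_bndoo _ _ _ (EFin \o g)); last exact/measurable_EFinP.
by apply: eq_integral => x /fgE.
Qed.

Lemma hasint_ftc (s : seq R) a b f F g c : a <= b ->
  (forall x, a < x < b -> x \notin s -> [/\ f x = (g x)%:E, dv F x (g x),
     {for x, continuous g} & g x <= c]) ->
  continuous F -> hasint a b f (F b - F a).
Proof.
move=> ab H cF; elim: s a b ab H => [|y s ih] a b.
  rewrite le_eqVlt => /predU1P[-> _|ab H].
    rewrite subrr /hasint set_itv1; split.
      apply/integrableP; split; first exact: measurable_fun_set1.
      by rewrite integral_set1.
    by rewrite integral_set1.
  apply: (@hasint_ftc_oo _ _ _ F g c) => //.
  - by move=> x xab; exact: (H x xab isT).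
  - exact: cF.
  - exact: cF.
move=> ab H.
have [/andP[ay yb]|yab] := boolP (a < y < b).
  rewrite (_ : F b - F a = (F y - F a) + (F b - F y)); last by ring.
  apply: (@hasint_cat _ y); rewrite ?ltW//; apply: ih; rewrite ?ltW//.
    move=> x /andP[ax xy] xs; apply: H; first by rewrite ax (lt_trans xy).
    by rewrite inE negb_or xs lt_eqF.
  move=> x /andP[ax xy] xs; apply: H; first by rewrite xy (lt_trans ay).
  by rewrite inE negb_or xs gt_eqF.
apply: ih => // x xab xs; apply: H => //; rewrite inE negb_or xs andbT.
by apply: contra yab => /eqP <-.
Qed.

End HasIntegral.

Section Complex.
Variable R : realType.
Implicit Types (a b t x y : R) (z w A B : R[i]).
Local Notation nc := (@Normc.normc R).

Lemma ncM z w : nc (z * w) = nc z * nc w. Proof. exact: Normc.normcM. Qed.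

Lemma nc1 : nc 1 = 1. Proof. exact: Normc.normc1. Qed.

Lemma ncV z : nc z^-1 = (nc z)^-1.
Proof. exact: Normc.normcV. Qed.

Lemma ncX z n : nc (z ^+ n) = nc z ^+ n.
Proof. by elim: n => [|n ih]; rewrite ?expr0 ?nc1// !exprS ncM ih. Qed.

Lemma nc_ge0 z : 0 <= nc z.
Proof. by case: z => x y; exact: sqrtr_ge0. Qed.

Lemma nc_sqr z : nc z ^+ 2 = complex.Re z ^+ 2 + complex.Im z ^+ 2.
Proof. by case: z => x y; rewrite sqr_sqrtr// addr_ge0 ?sqr_ge0. Qed.

Lemma nc_eq0 z : (nc z == 0) = (z == 0).
Proof.
apply/eqP/eqP => [/Normc.eq0_normc//|->]; exact: Normc.normc0.
Qed.

Lemma nc_gt0 z : (0 < nc z) = (z != 0).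
Proof. by rewrite lt_neqAle nc_ge0 andbT eq_sym nc_eq0. Qed.

Lemma ncN z : nc (- z) = nc z. Proof. exact: normcN. Qed.

Lemma ncD z w : nc (z + w) <= nc z + nc w.
Proof. exact: le_normcD. Qed.

Lemma nc_real x : nc x%:C = `|x|.
Proof. by rewrite /= expr0n addr0 sqrtr_sqr. Qed.

Lemma nc_Re z : `|complex.Re z| <= nc z.
Proof.
rewrite -(ger0_norm (nc_ge0 z)) -ler_sqr ?nnegrE ?normr_ge0//.
by rewrite !real_normK ?num_real// nc_sqr lerDl sqr_ge0.
Qed.

Lemma nc_Im z : `|complex.Im z| <= nc z.
Proof.
rewrite -(ger0_norm (nc_ge0 z)) -ler_sqr ?nnegrE ?normr_ge0//.
by rewrite !real_normK ?num_real// nc_sqr lerDr sqr_ge0.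
Qed.

Lemma expiD x y : expi (x + y) = expi x * expi y.
Proof. by rewrite /expi cosD sinD; apply/eqP; rewrite eq_complex/= eqxx addrC eqxx. Qed.

Lemma expi0 : expi 0 = 1 :> R[i].
Proof. by rewrite /expi cos0 sin0. Qed.

Lemma nc_expi x : nc (expi x) = 1.
Proof. by rewrite /= cos2Dsin2 sqrtr1. Qed.

Lemma expi_neq0 x : expi x != 0.
Proof. by rewrite -nc_gt0 nc_expi. Qed.

Lemma expiN x : expi (- x) = (expi x)^-1.
Proof.
apply: (mulfI (expi_neq0 x)); rewrite -expiD subrr expi0 mulfV//; exact: expi_neq0.
Qed.

Lemma expiX x n : expi x ^+ n = expi (n%:R * x).
Proof.
elim: n => [|n ih]; first by rewrite mul0r expi0.
by rewrite exprS ih -expiD -[n.+1%:R]natr1; congr expi; ring.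
Qed.

Lemma expiXz x (k : int) : expi x ^ k = expi (k%:~R * x).
Proof.
case: k => n; first by rewrite -exprnP expiX.
by rewrite -[LHS]/((expi x ^+ n.+1)^-1) expiX -expiN NegzE mulrNz mulNr.
Qed.

Lemma polar z : exists t, z = (nc z)%:C * expi t.
Proof.
have [z0|z0] := eqVneq z 0.
  by exists 0; rewrite z0 (Normc.normc0 R) mul0r.
have n0 : 0 < nc z by rewrite nc_gt0.
have E x : nc z * (x / nc z) = x by rewrite mulrC divfK ?gt_eqF.
have rb : -1 <= complex.Re z / nc z <= 1.
  rewrite -ler_norml normrM normfV (gtr0_norm n0) ler_pdivrMr// mul1r; exact: nc_Re.
have c : cos (acos (complex.Re z / nc z)) = complex.Re z / nc z by rewrite acosK.
have s : sin (acos (complex.Re z / nc z)) = `|complex.Im z| / nc z.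
  rewrite sin_acos// -[X in 1 - X]/(( _ / _) ^+ 2) expr_div_n.
  have -> : 1 - complex.Re z ^+ 2 / nc z ^+ 2 = (`|complex.Im z| / nc z) ^+ 2.
    rewrite expr_div_n real_normK ?num_real//.
    rewrite -[1](@divff _ (nc z ^+ 2)) ?expf_neq0 ?gt_eqF// -mulrBl nc_sqr.
    by rewrite addrAC subrr add0r.
  by rewrite sqrtr_sqr ger0_norm// divr_ge0// nc_ge0.
have [y0|y0] := leP 0 (complex.Im z).
  exists (acos (complex.Re z / nc z)); rewrite /expi c s ger0_norm//.
  apply/eqP; rewrite eq_complex/= !mul0r subr0 addr0.
  by rewrite !E !eqxx.
exists (- acos (complex.Re z / nc z)); rewrite /expi cosN sinN c s ltr0_norm//.
apply/eqP; rewrite eq_complex/= !mul0r subr0 addr0.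
by rewrite mulrN !E opprK !eqxx.
Qed.

Lemma nc_1Mexpi a t : nc (1 + a%:C * expi t) ^+ 2 = qnorm a (t + pi).
Proof. by rewrite nc_sqr qnormE cosDpi sinDpi /=; ring. Qed.

Lemma cos_eq1_nat y : 0 <= y -> cos y = 1 -> exists k : nat, y = k%:R * (2 * pi).
Proof.
move=> y0 cy; have pi0 := pi_gt0 R.
pose k := Num.truncn (y / (2 * pi)); exists k.
have q0 : 0 <= y / (2 * pi) by rewrite divr_ge0// mulr_ge0// ltW.
have /andP[k1 k2] := truncn_itv q0.
pose y' := y - k%:R * (2 * pi).
have c' : cos y' = 1 by rewrite -(cos_period_nat y' k) /y' subrK.
have y'0 : 0 <= y' by move: k1; rewrite ler_pdivlMr ?subr_ge0// mulr_gt0.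
have y'1 : y' < 2 * pi.
  by move: k2; rewrite ltr_pdivrMr ?mulr_gt0// -/k -natr1 /y'; lra.
suff : y' = 0 by rewrite /y'; lra.
have h0 : (0 : R) \in `[0, pi] by rewrite in_itv/= lexx ltW.
have [y'pi|y'pi] := leP y' pi.
  have h1 : y' \in `[0, pi] by rewrite in_itv/= y'0.
  by apply: (cos_inj h1 h0); rewrite c' cos0.
have h1 : 2 * pi - y' \in `[0, pi] by rewrite in_itv/=; lra.
have : 2 * pi - y' = 0; last by lra.
apply: (cos_inj h1 h0); have -> : 2 * pi - y' = - y' + 1%:R * (2 * pi) by ring.
by rewrite cos_period_nat cosN c' cos0.
Qed.

Lemma hasint_jensen_qnorm n a t M : (0 < n)%N -> 0 <= a <= 1 -> 0 < M ->
  hasint (- pi) pi (fun x => lne (M * Num.sqrt (qnorm a (n%:R * x + t)))%:E)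
   (2 * pi * ln M).
Proof.
move=> n0 a01 M0; have pi0 := pi_gt0 R.
wlog tge : t / n%:R * pi <= t.
  move=> H; pose k := Num.truncn ((n%:R * pi - t) / (2 * pi)).
  have tk : n%:R * pi <= t + k.+1%:R * (2 * pi).
    have : (n%:R * pi - t) / (2 * pi) < k.+1%:R by exact: truncnS_gt.
    by rewrite ltr_pdivrMr ?mulr_gt0//; lra.
  apply: hasint_eq (H _ tk) => x _.
  by rewrite addrA /qnorm cos_period_nat.
pose K := Num.truncn ((n%:R * pi + t) / (2 * pi)).
pose s := [seq (k%:R * (2 * pi) - t) / n%:R | k <- iota 0 K.+1].
pose g x := ln M + ln (qnorm a (n%:R * x + t)) / 2.
pose F x := ln M * x - clausen a (n%:R * x + t) / n%:R.
have nr0 : 0 < n%:R :> R by rewrite ltr0n.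
have -> : 2 * pi * ln M = F pi - F (- pi).
  rewrite /F (_ : n%:R * pi + t = n%:R * - pi + t + n%:R * (2 * pi)); last by ring.
  by rewrite clausen2pi_nat; ring.
have daff x : dv (fun x => n%:R * x + t) x n%:R.
  by apply: dv_eq (dvD (dvZ _ (dv_id _)) (dv_cst _ _)) _; rewrite mulr1 addr0.
apply: (@hasint_ftc _ s _ _ _ F g (ln M + ln 4 / 2)); first lra; last first.
  move=> x; apply: continuousB; first exact: dv_cont (dvZ _ (dv_id _)).
  apply: continuousM; last exact: cvg_cst.
  apply: (@continuous_comp _ _ _ (fun x => n%:R * x + t)); first exact: dv_cont (daff _).
  exact: clausen_cont.
move=> x /andP[x1 x2] xs.
have q0 : 0 < qnorm a (n%:R * x + t).
  rewrite lt_neqAle qnorm_ge0 andbT; apply: contra xs => /eqP q0.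
  have y0 : 0 <= n%:R * x + t by nra.
  have /andP[a0 a1] := a01.
  have a_1 : a = 1.
    have := qnorm_ge_sqr (n%:R * x + t) a0; rewrite -q0 => h.
    have := sqr_ge0 (1 - a) => h2.
    have : (1 - a) ^+ 2 == 0 by rewrite eq_le h h2.
    by rewrite sqrf_eq0 subr_eq0 => /eqP.
  have c1 : cos (n%:R * x + t) = 1 by move: q0; rewrite /qnorm a_1 expr1n; lra.
  have [k kE] := cos_eq1_nat y0 c1.
  apply/mapP; exists k; last by rewrite -kE addrK mulrC mulKf ?gt_eqF.
  rewrite mem_iota add0n ltnS /=; rewrite truncn_ge_nat.
    by rewrite ler_pdivlMr ?mulr_gt0// -kE; nra.
  by rewrite divr_ge0//; nra.
split.
- rewrite lne_EFin ?mulr_gt0 ?sqrtr_gt0// lnM ?posrE ?sqrtr_gt0//.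
  congr (_ + _)%:E; rewrite -{2}(sqr_sqrtr (ltW q0)) lnXn ?sqrtr_gt0//.
  by rewrite -mulr_natr; field.
- apply: dv_eq.
    apply: dvB; first exact: dvZ (dv_id _).
    apply: (@dv_near _ (fun x => n%:R^-1 * clausen a (n%:R * x + t))).
      by apply: filterE => z; rewrite mulrC.
    by apply: dvZ; apply: (dv_comp (f := clausen a) (g := fun x => n%:R * x + t) _ (daff x));
      exact: clausen_dv.
  by rewrite /g; field; rewrite gt_eqF.
- have -> : g = fun x => ln M - (fun y => - (ln (qnorm a y) / 2)) (n%:R * x + t).
    by apply/funext => y /=; rewrite opprK.
  apply: continuousB; first exact: cvg_cst.
  apply: (@continuous_comp _ _ _ (fun x => n%:R * x + t) (fun y => - (ln (qnorm a y) / 2))).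
    exact: dv_cont (daff x).
  exact: cont_lnqnorm.
- rewrite lerD2l ler_pM2r ?invr_gt0// ler_ln ?posrE//.
  have := cos_geN1 (n%:R * x + t); have := cos_le1 (n%:R * x + t).
  rewrite /qnorm; nra.
Qed.

Lemma hasint_jensen n A B : (0 < n)%N -> (A != 0) || (B != 0) ->
  hasint (- pi) pi (fun x => lne (nc (A * expi (n%:R * x) + B))%:E)
   (2 * pi * ln (Num.max (nc A) (nc B))).
Proof.
move=> n0 AB.
have [u Au] := polar A; have [v Bv] := polar B.
have [BA|AB'] := leP (nc B) (nc A).
  have A0 : 0 < nc A.
    rewrite nc_gt0; case/orP : AB => // B0.
    by rewrite -nc_gt0 (lt_le_trans _ BA)// nc_gt0.
  have a01 : 0 <= nc B / nc A <= 1.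
    by rewrite divr_ge0 ?nc_ge0//= ler_pdivrMr// mul1r.
  apply: hasint_eq (hasint_jensen_qnorm (u - v + pi) n0 a01 A0) => x _.
  congr (lne _%:E).
  have -> : A * expi (n%:R * x) + B = (nc A)%:C * expi (n%:R * x + u) *
      (1 + (nc B / nc A)%:C * expi (- (n%:R * x + u - v))).
    have E1 : (nc A)%:C * (nc B / nc A)%:C = (nc B)%:C.
      by rewrite -rmorphM/= mulrCA divff ?mulr1 ?gt_eqF.
    have E2 : expi (n%:R * x + u) * expi (- (n%:R * x + u - v)) = expi v.
      by rewrite -expiD; congr expi; ring.
    have E3 : (nc A)%:C * expi (n%:R * x + u) *
      (1 + (nc B / nc A)%:C * expi (- (n%:R * x + u - v))) =
      (nc A)%:C * expi (n%:R * x + u) + ((nc A)%:C * (nc B / nc A)%:C) *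
        (expi (n%:R * x + u) * expi (- (n%:R * x + u - v))) by ring.
    by rewrite E3 E1 E2 {1}Au {1}Bv expiD; ring.
  rewrite !ncM nc_real nc_expi mulr1 gtr0_norm//; congr (_ * _).
  apply/(@pexpIrn _ 2); rewrite ?nnegrE ?sqrtr_ge0 ?nc_ge0// nc_1Mexpi.
  rewrite sqr_sqrtr ?qnorm_ge0// /qnorm !cosDpi cosN.
  by rewrite (_ : n%:R * x + (u - v + pi) = n%:R * x + u - v + pi) ?cosDpi//; ring.
have B0 : 0 < nc B by apply: le_lt_trans AB'; exact: nc_ge0.
have a01 : 0 <= nc A / nc B <= 1.
  by rewrite divr_ge0 ?nc_ge0//= ler_pdivrMr// mul1r ltW.
apply: hasint_eq (hasint_jensen_qnorm (u - v + pi) n0 a01 B0) => x _.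
congr (lne _%:E).
have -> : A * expi (n%:R * x) + B = (nc B)%:C * expi v *
    (1 + (nc A / nc B)%:C * expi (n%:R * x + u - v)).
  have E1 : (nc B)%:C * (nc A / nc B)%:C = (nc A)%:C.
    by rewrite -rmorphM/= mulrCA divff ?mulr1 ?gt_eqF.
  have E2 : expi v * expi (n%:R * x + u - v) = expi u * expi (n%:R * x).
    by rewrite -!expiD; congr expi; ring.
  have E3 : (nc B)%:C * expi v * (1 + (nc A / nc B)%:C * expi (n%:R * x + u - v)) =
    (nc B)%:C * expi v + ((nc B)%:C * (nc A / nc B)%:C) * (expi v * expi (n%:R * x + u - v)).
    by ring.
  by rewrite E3 E1 E2 {1}Au {1}Bv; ring.
rewrite !ncM nc_real nc_expi mulr1 gtr0_norm//; congr (_ * _).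
apply/(@pexpIrn _ 2); rewrite ?nnegrE ?sqrtr_ge0 ?nc_ge0// nc_1Mexpi.
rewrite sqr_sqrtr ?qnorm_ge0//; congr qnorm; ring.
Qed.

End Complex.

Section Periodic.
Variable R : realType.
Local Notation mu := (@lebesgue_measure R).
Implicit Types (f g F H : R -> R) (a b c t x y I L : R).
Local Notation nc := (@Normc.normc R).

Lemma hasint_primitive g H a b : a <= b ->
  (forall x, a <= x <= b -> dv H x (g x)) ->
  (forall x, a <= x <= b -> {for x, continuous g}) ->
  hasint a b (EFin \o g) (H b - H a).
Proof.
rewrite le_eqVlt => /predU1P[-> _ _|ab dH cg].
  rewrite subrr /hasint set_itv1; split; last by rewrite integral_set1.
  apply/integrableP; split; first exact: measurable_fun_set1.
  by rewrite integral_set1.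
have cgw : {within `[a, b], continuous g}.
  by apply: continuous_in_subspaceT => x; rewrite inE/= in_itv/=; exact: cg.
split.
  by apply: (@continuous_compact_integrable _ g) => //; exact: segment_compact.
have ab' x : a < x < b -> a <= x <= b by move=> /andP[? ?]; rewrite !ltW.
rewrite (@continuous_FTC2 _ g H _ _ ab)// ?EFinB//.
  split.
  - by move=> x; rewrite in_itv/= => /ab'/dH[].
  - by apply: cvg_at_right_filter; apply: dv_cont (dH _ _); rewrite lexx ltW.
  - by apply: cvg_at_left_filter; apply: dv_cont (dH _ _); rewrite lexx ltW.
by move=> x; rewrite in_itv/= derive1E => /ab'/dH[].
Qed.

Lemma ex_primitive g L : continuous g ->
  exists H, forall x, - L < x < L -> dv H x (g x).
Proof.
move=> cg; exists (fun x => (\int[mu]_(t in [set` `[- L, x]]) (g t))%R).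
move=> x /andP[Lx xL].
have [|d1 d2] := @continuous_FTC1_closed _ g (- L) x L xL _ Lx (cg x).
  apply: (@continuous_compact_integrable _ g); first exact: segment_compact.
  exact: continuous_subspaceT.
by split; [exact: d1|rewrite -derive1E].
Qed.

Lemma hasint_periodic g I t : continuous g ->
  (forall x, g (x + 2 * pi) = g x) ->
  (forall H, (forall x, 0 <= x <= 2 * pi -> dv H x (g x)) -> H (2 * pi) - H 0 = I) ->
  hasint (- pi) pi (fun x => (g (x + t))%:E) I.
Proof.
move=> cg pg HI; have pi0 := pi_gt0 R.
pose L := 10 * pi + `|t|.
have [H dH] := @ex_primitive g L cg.
have Lt := ler_norm t; have LNt := ler_norm (- t); rewrite normrN in LNt.
have dL x : x - t \in `[(- pi), pi] -> dv H x (g x).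
  by rewrite in_itv/= => xx; apply: dH; rewrite /L; lra.
pose D x := H (x + 2 * pi) - H x.
have dD x : - (6 * pi + `|t|) <= x <= 6 * pi + `|t| -> dv D x 0.
  move=> xx; rewrite -(subrr (g x)); apply: dvB; last by apply: dH; rewrite /L; lra.
  rewrite -{1}pg -[g _]mulr1.
  apply: (dv_comp (f := H) (g := fun x => x + 2 * pi)).
    by apply: dH; rewrite /L; lra.
  by apply: dv_eq (dvD (dv_id _) (dv_cst _ _)) _; rewrite addr0.
have DI : D (- pi + t) = I.
  rewrite -(HI H); last by move=> x xx; apply: dH; rewrite /L; lra.
  rewrite -{1}(add0r (2 * pi)) -/(D 0).
  have [t0|t0] := leP (- pi + t) 0.
    by rewrite -(@dv0_cst _ D _ _ t0)// => x xx; apply: dD; lra.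
  by rewrite (@dv0_cst _ D _ _ (ltW t0))// => x xx; apply: dD; lra.
have -> : I = H (pi + t) - H (- pi + t).
  by rewrite -DI /D; congr (H _ - _); ring.
have pp : - pi <= pi :> R by lra.
apply: (@hasint_primitive (fun x => g (x + t)) (fun x => H (x + t)) _ _ pp).
  move=> x xx; rewrite -[g _]mulr1.
  apply: (dv_comp (f := H) (g := fun x => x + t)).
    by apply: dL; rewrite addrK in_itv.
  by apply: dv_eq (dvD (dv_id _) (dv_cst _ _)) _; rewrite addr0.
move=> x _; apply: (@continuous_comp _ _ _ (fun x => x + t) g); last exact: cg.
exact: dv_cont (dvD (dv_id _) (dv_cst _ _)).
Qed.

Lemma qnorm1E x : qnorm 1 x = 2 * (1 - cos x).
Proof. by rewrite /qnorm expr1n; ring. Qed.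

Lemma pi3_cos : cos (pi / 3 : R) = 1 / 2.
Proof.
have pi0 := pi_gt0 R.
have c0 : 0 < cos (pi / 3 : R) by apply: cos_gt0_pihalf; lra.
have : cos (pi / 3 + (pi / 3 + pi / 3) : R) = -1.
  by rewrite -cospi; congr cos; field.
rewrite cosD cosD sinD; have := cos2Dsin2 (pi / 3 : R).
set c := cos _; set s := sin _ => cs h.
have : (c + 1) * (2 * c - 1) ^+ 2 == 0.
  have -> : (c + 1) * (2 * c - 1) ^+ 2 = (c * (c * c - s * s) - s * (s * c + c * s) + 1)
    + 3 * c * (c ^+ 2 + s ^+ 2 - 1) by ring.
  by rewrite h cs; apply/eqP; ring.
have c1 : c + 1 != 0 by rewrite gt_eqF// ltr_wpDl// ltW.
rewrite mulf_eq0 (negbTE c1)/= sqrf_eq0 => /eqP; lra.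
Qed.

Lemma cos_le_half x : pi / 3 <= x <= 2 * pi - pi / 3 -> cos x <= 1 / 2.
Proof.
have pi0 := pi_gt0 R; move=> /andP[x1 x2].
have h3 : (pi / 3 : R) \in `[0, pi] by rewrite in_itv/=; lra.
have [xpi|xpi] := leP x pi.
  have hx : x \in `[0, pi] by rewrite in_itv/=; lra.
  by rewrite -pi3_cos leNgt ltr_cos// -leNgt.
have hx : 2 * pi - x \in `[0, pi] by rewrite in_itv/=; lra.
have -> : cos x = cos (2 * pi - x).
  rewrite (_ : 2 * pi - x = - x + 1%:R * (2 * pi)); last by ring.
  by rewrite cos_period_nat cosN.
by rewrite -pi3_cos leNgt ltr_cos// -leNgt; lra.
Qed.

Lemma cos_ge_half x : 0 <= x <= pi / 3 -> 1 / 2 <= cos x.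
Proof.
have pi0 := pi_gt0 R; move=> xx.
have h3 : (pi / 3 : R) \in `[0, pi] by rewrite in_itv/=; lra.
have hx : x \in `[0, pi] by rewrite in_itv/=; lra.
by rewrite -pi3_cos leNgt ltr_cos// -leNgt; lra.
Qed.

Definition lnplus1 x : R := ln (Num.max 1 (Num.sqrt (qnorm 1 x))).

Lemma lnplus1_cont : continuous lnplus1.
Proof.
move=> x; apply: (@continuous_comp _ _ _ (fun x => Num.max 1 (Num.sqrt (qnorm 1 x))) (@ln R)).
  apply: (@continuous_comp _ _ _ (fun x => Num.sqrt (qnorm 1 x)) (Num.max 1)).
    apply: (@continuous_comp _ _ _ (qnorm 1) Num.sqrt); last exact: sqrt_continuous.
    apply: dv_cont; apply: dvD (dv_cst _ _).
    by apply: dvB (dv_cst _ _) _; apply: dvZ; exact: dv_cos (dv_id _).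
  by apply: continuous_max; [exact: cvg_cst|exact: cvg_id].
by apply: continuous_ln; rewrite lt_max ltr01.
Qed.

Lemma lnplus1_int (H : R -> R) : (forall x, 0 <= x <= 2 * pi -> dv H x (lnplus1 x)) ->
  H (2 * pi) - H 0 = 2 * clausen 1 (pi / 3).
Proof.
move=> dH; have pi0 := pi_gt0 R.
have h01 : 0 <= (1 : R) <= 1 by rewrite ler01 lexx.
have low x : 1 / 2 <= cos x -> lnplus1 x = 0.
  move=> cx; have s1 : Num.sqrt (qnorm 1 x) <= 1.
    by rewrite -[leRHS]sqrtr1 ler_sqrt// qnorm1E; lra.
  by rewrite /lnplus1 (elimT max_idPl s1) ln1.
have high x : cos x <= 1 / 2 -> lnplus1 x = ln (qnorm 1 x) / 2.
  move=> cx; have q1 : 1 <= qnorm 1 x by rewrite qnorm1E; lra.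
  have s1 : 1 <= Num.sqrt (qnorm 1 x) by rewrite -[leLHS]sqrtr1 ler_sqrt// (le_trans ler01).
  rewrite /lnplus1 (elimT max_idPr s1) -[in RHS](sqr_sqrtr (le_trans ler01 q1)).
  by rewrite lnXn ?(lt_le_trans ltr01)// -mulr_natr; field.
have E1 : H (pi / 3) = H 0.
  apply: dv0_cst; first lra.
  by move=> x xx; rewrite -(low x); [apply: dH; lra|apply: cos_ge_half; lra].
have E2 : H (2 * pi) = H (2 * pi - pi / 3).
  apply: dv0_cst; first lra.
  move=> x xx; rewrite -(low x); first by apply: dH; lra.
  have -> : cos x = cos (2 * pi - x).
    rewrite (_ : 2 * pi - x = - x + 1%:R * (2 * pi)); last by ring.
    by rewrite cos_period_nat cosN.
  by apply: cos_ge_half; lra.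
have E3 : H (2 * pi - pi / 3) + clausen 1 (2 * pi - pi / 3) = H (pi / 3) + clausen 1 (pi / 3).
  apply: (@dv0_cst _ (fun x => H x + clausen 1 x)); first lra.
  move=> x xx; have cx := cos_le_half xx.
  rewrite -(subrr (lnplus1 x)); apply: dvD; first by apply: dH; lra.
  by rewrite high//; apply: clausen_dv => //; rewrite qnorm1E; lra.
move: E3; rewrite addrC (_ : 2 * pi - pi / 3 = - (pi / 3) + 2 * pi); last by ring.
rewrite clausen2pi clausenN// E2 (_ : 2 * pi - pi / 3 = - (pi / 3) + 2 * pi); last by ring.
lra.
Qed.

Lemma hasint_lnplus1 t :
  hasint (- pi) pi (fun x => (ln (Num.max 1 (nc (1 + expi (x + t)))))%:E)
    (2 * clausen 1 (pi / 3)).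
Proof.
apply: hasint_eq (@hasint_periodic lnplus1 _ (t + pi) lnplus1_cont _ lnplus1_int).
  move=> x _; congr (ln (Num.max 1 _))%:E.
  apply/(@pexpIrn _ 2); rewrite ?nnegrE ?sqrtr_ge0 ?nc_ge0//.
  by rewrite sqr_sqrtr ?qnorm_ge0// addrA -nc_1Mexpi mul1r.
by move=> x; rewrite /lnplus1 !qnorm1E; have := cos_period_nat x 1; rewrite mul1r => ->.
Qed.

End Periodic.

(** * Evaluation of Laurent polynomials *)

Section Eval.
Variables (A : comNzRingType) (F : fieldType) (phi : {rmorphism A -> F}) (z w : F).
Hypotheses (z0 : z != 0) (w0 : w != 0).
Implicit Types (g : laurent A) (k : int * int).

Let zw k : F := z ^ k.1 * w ^ k.2.

Definition leval g : F := \sum_(k <- msupp g) phi (mcoeff k g) * zw k.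

Lemma levalw (d : {fset int * int}) g : (msupp g `<=` d)%fset ->
  leval g = \sum_(k <- d) phi (mcoeff k g) * zw k.
Proof.
move=> le_d; rewrite /leval (big_fset_incl _ le_d) //= => k _ /mcoeff_outdom ->.
by rewrite rmorph0 mul0r.
Qed.

Lemma levalD g1 g2 : leval (g1 + g2) = leval g1 + leval g2.
Proof.
rewrite (levalw (fsubsetUl (msupp g1) (msupp g2))).
rewrite (levalw (fsubsetUr (msupp g1) (msupp g2))).
rewrite (levalw (msuppD_le g1 g2)) -big_split/=; apply: eq_bigr => k _.
by rewrite mcoeffD rmorphD mulrDl.
Qed.

Lemma leval0 : leval 0 = 0.
Proof. by rewrite /leval msupp0 big_seq_fset0. Qed.

Lemma levalU c k : leval (lmonom c k) = phi c * zw k.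
Proof. by rewrite (levalw (msuppU_le (x := c))) big_seq_fset1 mcoeffUU. Qed.

Lemma leval_sum (I : Type) (s : seq I) (f : I -> laurent A) :
  leval (\sum_(i <- s) f i) = \sum_(i <- s) leval (f i).
Proof. exact: (big_morph _ levalD leval0). Qed.

Lemma levalM g1 g2 : leval (g1 * g2) = leval g1 * leval g2.
Proof.
rewrite -[g1 * g2]/(lmul g1 g2) unlock; etransitivity; first exact: leval_sum.
rewrite /leval mulr_suml; apply: eq_bigr => k1 _.
etransitivity; first exact: leval_sum.
rewrite mulr_sumr; apply: eq_bigr => k2 _.
by rewrite levalU rmorphM /zw /= !expfzDr//; ring.
Qed.

Lemma leval1 : leval 1 = 1.
Proof. by rewrite -[1]/(lmonom 1 0) levalU rmorph1 /zw !expr0z !mulr1. Qed.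

Lemma levalX g n : leval (g ^+ n) = leval g ^+ n.
Proof. by elim: n => [|n ih]; rewrite ?expr0 ?leval1// !exprS levalM ih. Qed.

Lemma leval_lX a b : leval (lX a b) = z ^ a * w ^ b.
Proof. by rewrite levalU rmorph1 mul1r. Qed.
End Eval.

Lemma laurent_evalE (F : fieldType) (z w : F) (P : laurent F) :
  laurent_eval P z w = leval idfun z w P.
Proof. by apply: eq_bigr => k _; rewrite mulrA. Qed.

Lemma laurent_evalC (F : fieldType) (z w : F) (P : laurent int) :
  laurent_eval (laurentC F P) z w = leval intr z w P.
Proof.
have le : (msupp (laurentC F P) `<=` msupp P)%fset.
  apply/fsubsetP => k; rewrite -mcoeff_neq0 mcoeffE; case: ifP => //.
  by rewrite eqxx.
rewrite laurent_evalE (levalw _ _ _ le); apply: eq_big_seq => k kP.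
by rewrite mcoeffE kP.
Qed.

Section Cluster.
Local Notation L := (laurent int).
Implicit Types g : L.

Lemma lXX a b n : lX a b ^+ n = lX (a * n%:Z) (b * n%:Z) :> L.
Proof.
elim: n => [|n ih]; first by rewrite !mulr0.
by rewrite exprS ih lXD -[n.+1]addn1 PoszD !mulrDr !mulr1 ![_ + a]addrC ![_ + b]addrC.
Qed.

Lemma mcoeff_lX a b g k : mcoeff (k + (a, b)) (lX a b * g) = mcoeff k g.
Proof.
rewrite -[_ * g]/(lmul _ g) lmulUg raddf_sum/=.
under eq_bigr do rewrite mul1r mcoeffU [(a, b) + _]addrC (inj_eq (addIr _)).
have [ks|ks] := boolP (k \in msupp g).
  rewrite (big_fsetD1 k)//= eqxx big1_fset ?addr0// => k'.
  by rewrite !inE => /andP[/negPf kk _] _; rewrite kk.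
rewrite big1_fset ?(mcoeff_outdom ks)// => k' k's _.
by case: eqP => // kk; move: ks; rewrite -kk k's.
Qed.

Lemma lX2_reg r g : (0 < r)%N -> (lX 0 1 ^+ r + 1) * g = 0 -> g = 0.
Proof.
move=> r0 H; have E k : mcoeff k g = - mcoeff (k + (0, r%:Z)) g.
  have : mcoeff (k + (0, r%:Z)) ((lX 0 1 ^+ r + 1) * g) = 0 by rewrite H mcoeff0.
  rewrite mulrDl mul1r mcoeffD lXX mul0r mul1r mcoeff_lX => /eqP.
  by rewrite addr_eq0 => /eqP.
have En n k : mcoeff k g != 0 -> mcoeff (k + (0, r%:Z) *+ n) g != 0.
  elim: n k => [|n ih] k; first by rewrite addr0.
  by rewrite mulrS addrA => k0; apply: ih; move: k0; rewrite E oppr_eq0.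
apply/malgP => k; rewrite mcoeff0; apply/eqP; apply: contraT => k0.
pose M := (\max_(j <- msupp g) `|j.2|)%N.
pose n := (M + `|k.2|).+1%N.
pose k' := k + (0, r%:Z) *+ n.
have kin : k' \in msupp g by rewrite -mcoeff_neq0; exact: En.
have le : (`|k'.2| <= M)%N by rewrite /M (big_fsetD1 _ kin)/= leq_maxl.
have snd_mul m : ((0%R, r%:Z) *+ m : int * int).2 = (r * m)%N%:Z.
  by elim: m => [|m ih]; rewrite ?muln0// mulrS /= ih mulnS PoszD.
have k'2 : k'.2 = k.2 + (r * n)%N%:Z by rewrite -snd_mul.
suff : (M < `|k'.2|)%N by rewrite ltnNge le.
have : (n <= r * n)%N by rewrite leq_pmull.
rewrite k'2 /n; lia.
Qed.

Lemma cluster3 r x : cluster_seq r x -> x 3%N = (lX 0 1 ^+ r + 1) * lX (-1) 0.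
Proof.
case=> x1 x2 /(_ 1%N isT) /(congr1 (fun g => g * lX (-1) 0)).
by rewrite x1 x2 -mulrA lXD addr0 addrN mulr1.
Qed.

Lemma cluster4 r x : cluster_seq r x ->
  x 4%N = ((lX 0 1 ^+ r + 1) ^+ r + lX 1 0 ^+ r) * lX (- r%:Z) (-1).
Proof.
move=> xs; have x3 := cluster3 xs; case: xs => x1 x2 xs.
have /(congr1 (fun g => g * lX 0 (-1))) := xs 2%N isT.
rewrite x2 -mulrA lXD addr0 addrN mulr1 => ->.
have E1 : lX (-1) 0 ^+ r * lX 0 (-1) = lX (- r%:Z) (-1) :> L.
  by rewrite lXX lXD mulN1r mul0r addr0 add0r.
have E2 : lX 1 0 ^+ r * lX (- r%:Z) (-1) = lX 0 (-1) :> L.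
  by rewrite lXX lXD mul1r mul0r add0r addrN.
by rewrite x3 exprMn mulrDl mul1r -mulrA E1 mulrDl E2.
Qed.

Lemma cluster5 r x : (0 < r)%N -> cluster_seq r x ->
  x 5%N = lX 0 (- r%:Z) *
        (\sum_(1 <= j < r.+1) x 3%N ^+ (j * r - 1) *+ 'C(r, j) + lX 1 0).
Proof.
move=> r0 xs; have x3 := cluster3 xs; case: xs => x1 x2 xs.
apply/eqP; rewrite -subr_eq0; apply/eqP.
apply: (@lX2_reg r) => //.
suff H : x 3%N * (x 5%N - lX 0 (- r%:Z) *
        (\sum_(1 <= j < r.+1) x 3%N ^+ (j * r - 1) *+ 'C(r, j) + lX 1 0)) = 0.
  have -> : lX 0 1 ^+ r + 1 = x 3%N * lX 1 0 by rewrite x3 -mulrA lXD addr0 addNr mulr1.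
  by rewrite mulrAC H mul0r.
rewrite -/(cluster_q r (x 3%N)) mulrBr [_ * x 5%N]mulrC xs//.
rewrite mulrCA mulrDr cluster_qE//.
have h2 := xs 2%N isT; have h1 := xs 1%N isT.
have E : lX 0 (- r%:Z) * lX 0 1 ^+ r = 1 :> laurent int.
  by rewrite lXX lXD mul0r mul1r add0r addNr.
rewrite -h2 -x1 h1 x2.
have -> : (x 4%N * lX 0 1) ^+ r - 1 + (lX 0 1 ^+ r + 1) = (x 4%N ^+ r + 1) * lX 0 1 ^+ r.
  by rewrite exprMn; ring.
by rewrite mulrCA E mulr1 subrr.
Qed.
End Cluster.

(** * The Mahler measure of x4 *)

Section Mahler.
Variable R : realType.
Local Notation mu := (@lebesgue_measure R).
Implicit Types (t x y : R) (z w A B : R[i]).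
Local Notation nc := (@Normc.normc R).

Lemma mahler_hasint (P : laurent R[i]) (h : R -> R) I :
  (forall t, hasint (- pi) pi
     (fun u => lne (nc (laurent_eval P (expi t) (expi u)))%:E) (h t)) ->
  hasint (- pi) pi (EFin \o h) I -> mahler P = ((2 * pi) ^- 2 * I)%:E.
Proof.
move=> Ph [_ hI]; rewrite /mahler EFinM -hI; congr (_ * _)%E.
by apply: eq_integral => t _; case: (Ph t).
Qed.

Lemma lne_mul x y : 0 <= x -> 0 <= y -> lne (x * y)%:E = (lne x%:E + lne y%:E)%E.
Proof.
rewrite !le_eqVlt => /predU1P[<- _|x0].
  by rewrite mul0r le0_lneNy// addNye.
move=> /predU1P[<-|y0]; first by rewrite mulr0 [lne 0]le0_lneNy// addeNy.
by rewrite !lne_EFin ?mulr_gt0// lnM ?posrE.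
Qed.

Lemma lne_prod (I : Type) (s : seq I) (f : I -> R) : (forall i, 0 <= f i) ->
  lne (\prod_(i <- s) f i)%:E = (\sum_(i <- s) lne (f i)%:E)%E.
Proof.
move=> f0; elim: s => [|i s ih]; first by rewrite !big_nil lne1.
by rewrite !big_cons lne_mul ?f0 ?prodr_ge0// ih.
Qed.

Lemma nc_prod (I : Type) (s : seq I) (f : I -> R[i]) :
  nc (\prod_(i <- s) f i) = \prod_(i <- s) nc (f i).
Proof. exact: (big_morph _ (@ncM R) (@nc1 R)). Qed.

Lemma expi_pi : expi pi = -1 :> R[i].
Proof. by rewrite /expi cospi sinpi; apply/eqP; rewrite eq_complex/= oppr0 !eqxx. Qed.

Lemma expi_eq1 t : 0 <= t < 2 * pi -> expi t = 1 -> t = 0.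
Proof.
move=> /andP[t0 t2] /(congr1 (@complex.Re R))/= c1.
have [k kE] := cos_eq1_nat t0 c1; move: t2; rewrite kE.
have pi0 := pi_gt0 R; case: k {kE} => [|k]; first by rewrite mul0r.
by rewrite gtr_pMl ?mulr_gt0// ltNge ler1n.
Qed.

Definition zeta r (j : nat) : R[i] := expi ((2 * j + 1)%:R * pi / r%:R).

Lemma prod_zeta r z : (0 < r)%N -> \prod_(j < r) (z - zeta r j) = z ^+ r + 1.
Proof.
move=> r0; have r0' : r%:R != 0 :> R by rewrite pnatr_eq0 -lt0n.
have pi0 := pi_gt0 R; have rp : 0 < r%:R :> R by rewrite ltr0n.
pose p : {poly R[i]} := 'X^r + 1%:P; pose s := [seq zeta r j | j <- iota 0 r].
have sp : size p = r.+1 by exact: size_XnaddC.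
have rp' : all (root p) s.
  apply/allP => _ /mapP[j _ ->]; rewrite rootE /p hornerD hornerC hornerXn /zeta expiX.
  have -> : r%:R * ((2 * j + 1)%:R * pi / r%:R) = pi + j%:R * (2 * pi) :> R.
    by rewrite natrD natrM; field.
  rewrite expiD expi_pi /expi -[j%:R * _]add0r cos_period_nat sin_period_nat cos0 sin0.
  by rewrite mulr1 addNr.
have us : uniq s.
  rewrite map_inj_in_uniq ?iota_uniq// => i j.
  rewrite !mem_iota !add0n => /= ir jr.
  wlog ij : i j ir jr / (j <= i)%N.
    by move=> W; case: (leqP j i) => [|/ltnW] ? ?; [apply: W|apply/esym/W].
  move=> E; apply/eqP; rewrite eqn_leq ij andbT -subn_eq0.
  have : expi ((i - j)%:R * (2 * pi) / r%:R) = 1 :> R[i].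
    rewrite natrB//; have -> : (i%:R - j%:R) * (2 * pi) / r%:R =
      (2 * i + 1)%:R * pi / r%:R + - ((2 * j + 1)%:R * pi / r%:R) :> R.
      by rewrite [(2 * i + 1)%N]addn1 [(2 * j + 1)%N]addn1 -!natr1 !natrM; field.
    by rewrite expiD expiN -/(zeta r i) -/(zeta r j) E mulfV// expi_neq0.
  move/expi_eq1; rewrite divr_ge0 ?mulr_ge0// ?ltW// /= => /(_ _)/wrap[].
    rewrite ltr_pdivrMr// mulrC ltr_pM2l ?mulr_gt0// ltr_nat.
    exact: leq_ltn_trans (leq_subr _ _) ir.
  have p2 : 2 * pi != 0 :> R by rewrite gt_eqF// mulr_gt0.
  by move=> /eqP; rewrite mulf_eq0 invr_eq0 (negPf r0') orbF mulf_eq0 (negPf p2) orbF pnatr_eq0.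
have ss : size s = r by rewrite size_map size_iota.
have := @all_roots_prod_XsubC _ p s; rewrite sp ss => /(_ erefl rp').
rewrite uniq_rootsE => /(_ us) /(congr1 (fun p => p.[z])).
rewrite {1}/p hornerD hornerC hornerXn => ->.
have -> : lead_coef p = 1 by apply/monicP; exact: monicXnaddC.
rewrite scale1r horner_prod big_map (_ : iota 0 r = index_iota 0 r) ?big_mkord; last first.
  by rewrite /index_iota subn0.
by apply: eq_bigr => j _; rewrite !hornerE.
Qed.

Lemma prod_zetaM r A B : (0 < r)%N -> B != 0 ->
  \prod_(j < r) (A - zeta r j * B) = A ^+ r + B ^+ r.
Proof.
move=> r0 B0; rewrite -[A in RHS](divfK B0) exprMn -{2}[B ^+ r]mul1r -mulrDl.
rewrite -prod_zeta// -[X in _ * B ^+ X]card_ord -prodr_const -big_split/=.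
by apply: eq_bigr => j _; rewrite mulrBl divfK.
Qed.

Lemma torus_mean x : (2 * pi) ^- 2 * (2 * pi * (2 * x)) = x / pi.
Proof.
have : (pi : R) != 0 by rewrite gt_eqF// pi_gt0.
by move: (pi : R) => p p0; field.
Qed.

Lemma mahler_smyth :
  mahler (lX 1 0 + lX 0 1 + 1 : laurent R[i]) = (clausen 1 (pi / 3) / pi)%:E.
Proof.
have pi0 := pi_gt0 R.
rewrite (@mahler_hasint _ (fun t => 2 * pi * ln (Num.max 1 (nc (1 + expi t))))
  (2 * pi * (2 * clausen 1 (pi / 3)))).
- by rewrite torus_mean.
- move=> t; have := @hasint_jensen R 1 1 (1 + expi t) isT.
  rewrite oner_neq0 nc1 => /(_ isT); apply: hasint_eq => x _.
  rewrite laurent_evalE !levalD !leval_lX !mul1r !expr1z !expr0z.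
  by congr (lne (nc _)%:E); ring.
- apply: hasint_eq (hasintZ (2 * pi) (hasint_lnplus1 0)) => x _.
  by rewrite /= addr0 -EFinM.
Qed.

Lemma mahler_x4 r (x : nat -> laurent int) : (0 < r)%N -> cluster_seq r x ->
  mahler (laurentC R[i] (x 4%N)) = (r%:R * (clausen 1 (pi / 3) / pi))%:E.
Proof.
move=> r0 xs; have pi0 := pi_gt0 R.
pose th (j : nat) : R := (2 * j + 1)%:R * pi / r%:R + pi.
pose h t := \sum_(j < r) (2 * pi * ln (Num.max 1 (nc (1 + expi (t + th j))))).
have z1 t j : 1 - zeta r j * expi t = 1 + expi (t + th j).
  by rewrite /th /zeta addrA (expiD _ pi) (expiD t) expi_pi; ring.
rewrite (@mahler_hasint _ h (\sum_(j < r) (2 * pi * (2 * clausen 1 (pi / 3))))).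
- by rewrite sumr_const card_ord -[_ *+ r]mulr_natl (mulrCA _ r%:R) torus_mean.
- move=> t; apply: (@hasint_eq _ _ _ (fun u => \sum_(j < r)
      lne (nc (1 * expi (r%:R * u) + (1 - zeta r j * expi t)))%:E)%E).
    move=> u _; rewrite -(lne_prod _ (fun j => nc_ge0 _)) -nc_prod.
    congr (lne _%:E); rewrite laurent_evalC (cluster4 xs).
    rewrite !(levalM, levalD, levalX, leval_lX) ?leval1 ?expi_neq0//.
    rewrite !expr1z !expr0z !(mul1r, mulr1).
    under eq_bigr do rewrite addrA -expiX.
    rewrite prod_zetaM// ?expi_neq0// !ncM !expiXz !nc_expi !mulr1.
    by [].
  apply: hasint_sum; first lra.
  move=> j; have := @hasint_jensen R r 1 (1 - zeta r j * expi t) r0.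
  by rewrite oner_neq0 nc1 z1; exact.
- apply: (@hasint_eq _ _ _ (fun t => \sum_(j < r)
    ((2 * pi)%:E * (ln (Num.max 1 (nc (1 + expi (t + th j)))))%:E))%E).
    by move=> t _; rewrite /h /= -sumEFin; apply: eq_bigr => j _; rewrite EFinM.
  apply: hasint_sum; first lra.
  by move=> j; apply: hasintZ; exact: hasint_lnplus1.
Qed.

End Mahler.

(** * The points t_j *)

Section Chord.
Variable R : realType.
Implicit Types (t u x y p q a b : R).
Local Notation nc := (@Normc.normc R).

Definition chord u : R := 2 * `|sin (u / 2)|.

Lemma qnorm_chord u : qnorm 1 u = chord u ^+ 2.
Proof.
rewrite qnorm1E /chord exprMn real_normK ?num_real//.
have {1}-> : u = u / 2 *+ 2 by rewrite -mulr_natr divfK.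
by rewrite cos_mulr2n -mulr_natr cos2sin2; ring.
Qed.

Lemma chord_ge0 u : 0 <= chord u. Proof. by rewrite mulr_ge0. Qed.

Lemma chord_le2 u : chord u <= 2.
Proof. by have := sin_max (u / 2); rewrite /chord; lra. Qed.

Lemma nc_1Bexpi u : nc (1 - expi u) = chord u.
Proof.
apply/(@pexpIrn _ 2); rewrite ?nnegrE ?chord_ge0 ?nc_ge0// -qnorm_chord.
by rewrite nc_sqr qnormE /=; ring.
Qed.

Lemma chord2pi u : chord (u + 2 * pi) = chord u.
Proof.
rewrite /chord (_ : (u + 2 * pi) / 2 = u / 2 + pi); last by field.
by rewrite sinDpi normrN.
Qed.

Lemma chord2pi_nat u (k : nat) : chord (u + k%:R * (2 * pi)) = chord u.
Proof.
elim: k => [|k ih]; first by rewrite mul0r addr0.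
by rewrite -ih -(chord2pi (u + k%:R * _)) -natr1; congr chord; ring.
Qed.

Lemma chordN u : chord (- u) = chord u.
Proof. by rewrite /chord mulNr sinN normrN. Qed.

Lemma chord0 : chord 0 = 0.
Proof. by rewrite /chord mul0r sin0 normr0 mulr0. Qed.

Lemma chord_sin u : 0 <= u <= 2 * pi -> chord u = 2 * sin (u / 2).
Proof. by move=> uu; rewrite /chord ger0_norm// sin_ge0_pi//; lra. Qed.

Lemma chord_gt0 u : 0 < u < 2 * pi -> 0 < chord u.
Proof.
move=> uu; rewrite chord_sin; last by lra.
by rewrite mulr_gt0// sin_gt0_pi//; lra.
Qed.

Lemma chord_cont : continuous chord.
Proof.
move=> u; apply: (@continuousM _ _ (fun=> 2) (fun x : R => `|sin (x / 2)|)).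
  exact: cvg_cst.
apply: cvg_norm; apply: (@continuous_comp _ _ _ (fun x => x / 2) sin).
  by apply: continuousM; [exact: cvg_id|exact: cvg_cst].
exact: continuous_sin.
Qed.

Lemma sin_nat_le x n : `|sin (n%:R * x)| <= n%:R * `|sin x|.
Proof.
elim: n => [|n ih]; first by rewrite !mul0r sin0 normr0.
rewrite -natr1 !mulrDl !mul1r sinD; apply: le_trans (ler_normD _ _) _.
rewrite !normrM; have := cos_max x; have := cos_max (n%:R * x).
have := normr_ge0 (sin (n%:R * x)); have := normr_ge0 (sin x).
have := normr_ge0 (cos x); have := normr_ge0 (cos (n%:R * x)).
nra.
Qed.

Lemma chord_nat_le u n : chord (n%:R * u) <= n%:R * chord u.
Proof. by rewrite /chord -mulrA [leRHS]mulrCA ler_pM2l//; exact: sin_nat_le. Qed.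

Lemma chord_le u : 0 <= u -> chord u <= u.
Proof.
move=> u0; have := cos_lip (pi / 2 - u / 2) (pi / 2).
rewrite (_ : pi / 2 - u / 2 - pi / 2 = - (u / 2)); last by ring.
rewrite cosB cos_pihalf sin_pihalf mul0r add0r mul1r subr0 normrN (ger0_norm (_ : 0 <= u / 2)).
  by rewrite /chord; lra.
by lra.
Qed.

Lemma concave_sign (f df : R -> R) p q a b :
  (forall x, p < x < q -> dv f x (df x)) ->
  (forall x y, p < x -> x < y -> y < q -> df y < df x) ->
  p < a -> a < b -> b < q -> f a = 0 -> f b = 0 ->
  [/\ forall x, a < x < b -> 0 < f x,
      forall x, p < x < a -> f x < 0 &
      forall x, b < x < q -> f x < 0].
Proof.
move=> hf dec pa ab bq fa fb.
have mvt u v : p < u -> u < v -> v < q -> exists2 c, u < c < v & f v - f u = df c * (v - u).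
  move=> pu uv vq; apply: dv_mvt_oo => //.
  - by move=> x xx; apply: hf; lra.
  - by apply: dv_cont (hf u _); lra.
  - by apply: dv_cont (hf v _); lra.
have [c0 c0ab] := mvt a b pa ab bq; rewrite fa fb subrr => /esym/eqP.
rewrite mulf_eq0 [_ - _ == 0]gt_eqF ?subr_gt0// orbF => /eqP dc0.
split => x xx; rewrite ltNge; apply/negP => fx.
- have [||| c1 c1x E1] := mvt a x; [lra..|].
  have [||| c2 c2x E2] := mvt x b; [lra..|].
  have := dec c1 c2; move=> /(_ _ _ _)/wrap[|||dd]; [lra..|].
  rewrite fa subr0 in E1; rewrite fb sub0r in E2.
  have d1 : df c1 <= 0 by rewrite -(@pmulr_lle0 _ (x - a)) -?E1//; lra.
  have d2 : 0 <= df c2 by rewrite -(@pmulr_lge0 _ (b - x)) -?E2 ?oppr_ge0//; lra.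
  lra.
- have [||| c1 c1x E1] := mvt x a; [lra..|].
  have := dec c1 c0; move=> /(_ _ _ _)/wrap[|||dd]; [lra..|].
  rewrite fa sub0r in E1.
  have d1 : df c1 <= 0 by rewrite -(@pmulr_lle0 _ (a - x)) -?E1 ?oppr_le0//; lra.
  lra.
- have [||| c1 c1x E1] := mvt b x; [lra..|].
  have := dec c0 c1; move=> /(_ _ _ _)/wrap[|||dd]; [lra..|].
  rewrite fb subr0 in E1.
  have d1 : 0 <= df c1 by rewrite -(@pmulr_lge0 _ (x - b)) -?E1//; lra.
  lra.
Qed.

End Chord.

Section Arches.
Variables (R : realType) (r : nat).
Hypothesis r2 : (2 <= r)%N.
Implicit Types (t u x y : R).

Let r0 : 0 < r%:R :> R. Proof. by rewrite ltr0n (leq_trans _ r2). Qed.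
Let r2R : 2 <= r%:R :> R. Proof. by rewrite ler_nat. Qed.
Let pi0 : 0 < pi :> R. Proof. exact: pi_gt0. Qed.

Definition arch_end (k : nat) : R := 2 * pi * k%:R / r%:R.
Definition arch_mid (k : nat) : R := arch_end k + pi / r%:R.

Definition arch_log t : R := r%:R * (ln (qnorm 1 (r%:R * t)) / 2) - ln (qnorm 1 t) / 2.
Definition arch_log' t : R := r%:R ^+ 2 / 2 * (sin (r%:R * t) / (1 - cos (r%:R * t)))
  - 2^-1 * (sin t / (1 - cos t)).

Lemma arch_endS k : arch_end k.+1 = arch_end k + 2 * (pi / r%:R).
Proof. by rewrite /arch_end -natr1; ring. Qed.

Let pir : 0 < pi / r%:R :> R. Proof. by rewrite divr_gt0. Qed.

Lemma arch_end_ge0 k : 0 <= arch_end k.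
Proof. by rewrite /arch_end divr_ge0 ?mulr_ge0 ?(ltW pi0) ?(ltW r0). Qed.

Lemma arch_end_le k l : (k <= l)%N -> arch_end k <= arch_end l.
Proof.
move=> kl; rewrite /arch_end ler_pM2r ?invr_gt0// ler_pM2l ?mulr_gt0//.
by rewrite ler_nat.
Qed.

Lemma arch_end_r : arch_end r = 2 * pi.
Proof. by rewrite /arch_end mulfK ?gt_eqF. Qed.

Lemma arch_end_le2pi k : (k < r)%N -> arch_end k.+1 <= 2 * pi.
Proof. by move=> kr; rewrite -arch_end_r; exact: arch_end_le. Qed.

Lemma chord_arch k x : arch_end k < x < arch_end k.+1 -> 0 < chord (r%:R * x).
Proof.
move=> /andP[x1 x2]; pose y := r%:R * x - k%:R * (2 * pi).
have -> : r%:R * x = y + k%:R * (2 * pi) by rewrite /y subrK.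
rewrite chord2pi_nat; apply: chord_gt0.
move: x1 x2; rewrite /arch_end ltr_pdivrMr// ltr_pdivlMr// -natr1 /y; lra.
Qed.

Lemma chord_arch_end k : chord (r%:R * arch_end k) = 0.
Proof.
have -> : r%:R * arch_end k = 0 + k%:R * (2 * pi).
  by rewrite /arch_end mulrCA divff ?gt_eqF// add0r mulr1 mulrC.
by rewrite chord2pi_nat chord0.
Qed.

Lemma chord_arch_mid k : chord (r%:R * arch_mid k) = 2.
Proof.
have -> : r%:R * arch_mid k = pi + k%:R * (2 * pi).
  rewrite /arch_mid mulrDr /arch_end ![r%:R * (_ / _)]mulrC !divfK ?gt_eqF//.
  by ring.
by rewrite chord2pi_nat /chord sin_pihalf normr1 mulr1.
Qed.

Definition inarch k x := (k < r)%N /\ arch_end k < x < arch_end k.+1.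

Lemma inarch_itv k x : inarch k x -> 0 < x < 2 * pi.
Proof.
move=> [kr]; have := arch_end_ge0 k; have := arch_end_le2pi kr; lra.
Qed.

Lemma inarch_qnorm k x : inarch k x -> 0 < qnorm 1 (r%:R * x) /\ 0 < qnorm 1 x.
Proof.
move=> kx; rewrite !qnorm_chord; split; rewrite exprn_gt0//.
  by case: kx => _; exact: chord_arch.
exact/chord_gt0/inarch_itv/kx.
Qed.

Lemma inarch_cos k x : inarch k x -> 0 < 1 - cos (r%:R * x) /\ 0 < 1 - cos x.
Proof. by move=> /inarch_qnorm; rewrite !qnorm1E; lra. Qed.

Lemma arch_logE k x : inarch k x ->
  arch_log x = ln (chord (r%:R * x) ^+ r / chord x).
Proof.
move=> kx; have c1 : 0 < chord x by exact/chord_gt0/inarch_itv/kx.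
have c2 : 0 < chord (r%:R * x) by case: kx => _; exact: chord_arch.
rewrite /arch_log !qnorm_chord ln_div ?posrE ?exprn_gt0//.
rewrite (lnXn 2 c2) (lnXn r c2) (lnXn 2 c1).
move: (ln (chord (r%:R * x))) (ln (chord x)) => A B.
by rewrite -[A *+ 2]mulr_natl -[B *+ 2]mulr_natl -[A *+ r]mulr_natl; field.
Qed.

Lemma dv_lnqnorm u : 0 < 1 - cos u ->
  dv (fun x => ln (qnorm 1 x) / 2) u (2^-1 * (sin u / (1 - cos u))).
Proof.
move=> cu; have q0 : 0 < qnorm 1 u by rewrite qnorm1E; lra.
apply: (@dv_near _ (fun x => 2^-1 * ln (qnorm 1 x))).
  by apply: filterE => z; rewrite mulrC.
have dq : dv (qnorm 1) u (2 * sin u).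
  apply: (@dv_near _ (fun x => 2 * (1 - cos x))).
    by apply: filterE => z; rewrite qnorm1E.
  by apply: dv_eq (dvZ _ (dvB (dv_cst _ _) (dv_cos (dv_id _)))) _; ring.
apply: dv_eq (dvZ _ (dv_ln q0 dq)) _.
by rewrite qnorm1E; field; rewrite gt_eqF.
Qed.

Lemma dv_scale (f : R -> R) x l : dv f (r%:R * x) l ->
  dv (fun x => f (r%:R * x)) x (l * r%:R).
Proof.
move=> hf; apply: (dv_comp (g := fun x => r%:R * x)) hf _.
by apply: dv_eq (dvZ _ (dv_id _)) _; rewrite mulr1.
Qed.

Lemma dv_arch_log k x : inarch k x -> dv arch_log x (arch_log' x).
Proof.
move=> /inarch_cos[c1 c2]; apply: dv_eq.
  by apply: dvB (dv_lnqnorm c2); apply: dvZ; exact: dv_scale (dv_lnqnorm c1).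
by rewrite /arch_log'; ring.
Qed.

Lemma dv_cot u : 0 < 1 - cos u ->
  dv (fun x => sin x / (1 - cos x)) u (- (1 - cos u)^-1).
Proof.
move=> cu; apply: dv_eq.
  apply: dvM; first exact: dv_sin (dv_id _).
  apply: dvV; first by rewrite gt_eqF.
  exact: dvB (dv_cst _ _) (dv_cos (dv_id _)).
have s2 := sin2cos2 u.
have -> : cos u * 1 * (1 - cos u)^-1 + sin u * (- (0 - - sin u * 1) / (1 - cos u) ^+ 2)
  = cos u / (1 - cos u) - sin u ^+ 2 / (1 - cos u) ^+ 2 by field; rewrite gt_eqF.
by rewrite s2; field; rewrite gt_eqF.
Qed.

Lemma arch_log'_decr k x y : inarch k x -> inarch k y -> x < y ->
  arch_log' y < arch_log' x.
Proof.
move=> kx ky xy.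
have kz z : x <= z <= y -> inarch k z.
  by case: kx ky => kr kx [_ ky] zz; split => //; lra.
have D z : x <= z <= y -> dv arch_log' z
    (r%:R ^+ 2 / 2 * (- (1 - cos (r%:R * z))^-1 * r%:R) - 2^-1 * - (1 - cos z)^-1).
  move=> /kz/inarch_cos[c1 c2].
  apply: dvB; last by apply: dvZ; exact: dv_cot.
  by apply: dvZ; exact: dv_scale (dv_cot c1).
have [c cxy E] := dv_mvt (ltW xy) D.
rewrite -subr_lt0 E pmulr_llt0 ?subr_gt0//.
have kc := kz _ cxy; have [c1 c2] := inarch_cos kc.
have le : 1 - cos (r%:R * c) <= r%:R ^+ 2 * (1 - cos c).
  have : qnorm 1 (r%:R * c) <= r%:R ^+ 2 * qnorm 1 c.
    rewrite !qnorm_chord -exprMn lerXn2r ?nnegrE ?chord_ge0 ?mulr_ge0 ?chord_ge0 ?(ltW r0)//.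
    exact: chord_nat_le.
  by rewrite !qnorm1E mulrCA ler_pM2l.
have -> : r%:R ^+ 2 / 2 * (- (1 - cos (r%:R * c))^-1 * r%:R) - 2^-1 * - (1 - cos c)^-1 =
  2^-1 * ((1 - cos (r%:R * c)) - r%:R ^+ 3 * (1 - cos c)) / ((1 - cos (r%:R * c)) * (1 - cos c)).
  by field; rewrite !gt_eqF.
rewrite pmulr_llt0 ?invr_gt0 ?mulr_gt0// pmulr_rlt0 ?invr_gt0// subr_lt0.
apply: le_lt_trans le _; rewrite ltr_pM2r// ltr_eXn2l//.
by apply: lt_le_trans r2R; rewrite ltr1n.
Qed.

Definition arch_gap x : R := chord (r%:R * x) ^+ r - chord x.

Lemma arch_gap_mid k : (k < r)%N -> 0 < arch_gap (arch_mid k).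
Proof.
move=> kr; rewrite /arch_gap chord_arch_mid subr_gt0.
apply: le_lt_trans (chord_le2 _) _; rewrite -[ltLHS]expr1.
by rewrite ltr_eXn2l// ltr1n.
Qed.

Lemma arch_gap_cont : continuous arch_gap.
Proof.
move=> x; apply: (@continuousB _ _ _ (fun x => chord (r%:R * x) ^+ r) (@chord R)); last exact: chord_cont.
apply: (@continuous_comp _ _ _ (fun x => chord (r%:R * x)) (fun x => x ^+ r)).
  apply: (@continuous_comp _ _ _ (fun x => r%:R * x) (@chord R)).
    exact: dv_cont (dvZ _ (dv_id _)).
  exact: chord_cont.
exact: exprn_continuous.
Qed.

Lemma chord_exp x : chord x ^+ r = chord x ^+ r.-1 * chord x.
Proof. by rewrite -exprSr prednK// (leq_trans _ r2). Qed.

Lemma ratio_small x : r%:R ^+ r * chord x ^+ r.-1 <= 1 ->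
  chord (r%:R * x) ^+ r / chord x <= 1.
Proof.
move=> le; have [c0|c0] := eqVneq (chord x) 0; first by rewrite c0 invr0 mulr0.
have c1 : 0 < chord x by rewrite lt_neqAle eq_sym c0 chord_ge0.
rewrite ler_pdivrMr// mul1r.
apply: (@le_trans _ _ ((r%:R * chord x) ^+ r)).
  rewrite lerXn2r ?nnegrE ?chord_ge0 ?mulr_ge0 ?chord_ge0 ?(ltW r0)//; exact: chord_nat_le.
rewrite exprMn chord_exp mulrA.
by rewrite ler_piMl// ltW.
Qed.

Lemma arch_zero_ex k : (k < r)%N ->
  exists x, [/\ arch_end k < x, x < arch_mid k & arch_gap x = 0].
Proof.
move=> kr.
have [y [y1 y2 y3]] : exists y, [/\ arch_end k <= y, y < arch_mid k & arch_gap y < 0].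
  case: k kr => [|k] kr; last first.
    exists (arch_end k.+1); split => //; first by rewrite /arch_mid ltrDl.
    rewrite /arch_gap chord_arch_end expr0n -leqn0 leqNgt (leq_trans _ r2)// sub0r oppr_lt0.
    apply: chord_gt0; have := arch_end_le2pi kr; have := arch_end_ge0 k.
    by rewrite !arch_endS; have := pir; lra.
  pose y : R := Num.min (pi / r%:R / 2) (r%:R ^+ r * 2)^-1.
  have rr : 0 < r%:R ^+ r :> R by rewrite exprn_gt0.
  have rr1 : 1 <= r%:R ^+ r :> R.
    by apply: exprn_ege1; apply: le_trans r2R; rewrite ler1n.
  have y0 : 0 < y by rewrite lt_min !divr_gt0// invr_gt0 mulr_gt0.
  have yp : y <= pi / r%:R / 2 by rewrite ge_min lexx.
  have yr : r%:R ^+ r * y <= 1 / 2.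
    apply: (@le_trans _ _ (r%:R ^+ r * (r%:R ^+ r * 2)^-1)).
      by rewrite ler_pM2l// ge_min lexx orbT.
    by rewrite invfM mulrA divff ?gt_eqF// mul1r.
  have p2 : pi / r%:R <= pi / 2 :> R by rewrite ler_pM2l// lef_pV2 ?posrE.
  exists y; split; first by rewrite /arch_end mulr0 mul0r ltW.
    by rewrite /arch_mid /arch_end mulr0 mul0r add0r; lra.
  have cy : 0 < chord y by apply: chord_gt0; lra.
  have cy1 : chord y <= y by apply: chord_le; exact: ltW.
  rewrite /arch_gap subr_lt0; apply: (@le_lt_trans _ _ ((r%:R * chord y) ^+ r)).
    rewrite lerXn2r ?nnegrE ?chord_ge0 ?mulr_ge0 ?chord_ge0 ?(ltW r0)//; exact: chord_nat_le.
  rewrite exprMn chord_exp mulrA.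
  rewrite gtr_pMl//; apply: (@le_lt_trans _ _ (r%:R ^+ r * y)); last by lra.
  rewrite ler_pM2l//; apply: (le_trans _ cy1).
  rewrite -[leRHS]expr1 ler_wiXn2l// ?chord_ge0//; last by rewrite -ltnS prednK// (leq_trans _ r2).
  by apply: le_trans cy1 _; nra.
have mid := arch_gap_mid kr.
have [||x xx E] := @IVT _ arch_gap y (arch_mid k) 0 (ltW y2).
- exact: continuous_subspaceT arch_gap_cont.
- by rewrite ge_min le_max (ltW y3) (ltW mid) orbT.
move: xx; rewrite in_itv/= => /andP[yx xm].
exists x; split => //.
  rewrite (le_lt_trans y1)// lt_neqAle yx andbT; apply/eqP => yx'.
  by move: y3; rewrite yx' E ltxx.
rewrite lt_neqAle xm andbT; apply/eqP => yx'.
by move: mid; rewrite -yx' E ltxx.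
Qed.

End Arches.

Section Zeros.
Variables (R : realType) (r : nat).
Hypothesis r2 : (2 <= r)%N.
Implicit Types (t u x y : R) (k : nat).

Let r0 : 0 < r%:R :> R. Proof. by rewrite ltr0n (leq_trans _ r2). Qed.
Let pi0 : 0 < pi :> R. Proof. exact: pi_gt0. Qed.
Let pir : 0 < pi / r%:R :> R. Proof. by rewrite divr_gt0. Qed.

Local Notation aend := (@arch_end R r).
Local Notation amid := (@arch_mid R r).
Local Notation agap := (@arch_gap R r).
Local Notation alog := (@arch_log R r).
Local Notation ain := (@inarch R r).

Definition arch_left k : R :=
  xget 0 [set x | aend k < x /\ x < amid k /\ agap x = 0].

Lemma arch_leftP k : (k < r)%N ->
  [/\ aend k < arch_left k, arch_left k < amid k & agap (arch_left k) = 0].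
Proof.
move=> kr; rewrite /arch_left; case: xgetP => [x _ [? []]//|].
by have [x [h1 h2 h3]] := @arch_zero_ex R r r2 k kr => /(_ x); case.
Qed.

(* The reflection t |-> 2 pi - t exchanges the arches k and r - 1 - k. *)
Definition arch_right k : R := 2 * pi - arch_left (r.-1 - k)%N.

Lemma arch_end_rev k : (k <= r)%N -> aend (r - k) = 2 * pi - aend k.
Proof.
move=> kr; rewrite /arch_end natrB// mulrBr mulrBl mulfK// gt_eqF//.
Qed.

Lemma arch_gap_rev x : agap (2 * pi - x) = agap x.
Proof.
rewrite /arch_gap; congr (_ ^+ _ - _).
  have -> : r%:R * (2 * pi - x) = - (r%:R * x) + r%:R * (2 * pi) by ring.
  by rewrite chord2pi_nat chordN.
by rewrite addrC chord2pi chordN.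
Qed.

Lemma arch_rightP k : (k < r)%N ->
  [/\ amid k < arch_right k, arch_right k < aend k.+1 & agap (arch_right k) = 0].
Proof.
move=> kr; have kr' : (r.-1 - k < r)%N by lia.
have [h1 h2 h3] := arch_leftP kr'; rewrite /arch_right arch_gap_rev.
have E : aend (r.-1 - k) = 2 * pi - aend k.+1.
  by rewrite -arch_end_rev//; congr aend; lia.
move: h1 h2; rewrite /arch_mid E; have := @arch_endS R r k => -> h1 h2.
split => //; have := pir; lra.
Qed.

Lemma arch_gap_log k x : ain k x -> (agap x == 0) = (alog x == 0).
Proof.
move=> kx; have c1 : 0 < chord x by exact/chord_gt0/(inarch_itv r2)/kx.
have c2 : 0 < chord (r%:R * x) by case: kx => _; exact: (chord_arch r2).
have q : 0 < chord (r%:R * x) ^+ r / chord x by rewrite divr_gt0// exprn_gt0.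
rewrite (arch_logE r2 kx) ln_eq0// /arch_gap subr_eq0.
by apply/eqP/eqP => [->|/divr1_eq//]; rewrite divff ?gt_eqF.
Qed.

Lemma arch_sign k : (k < r)%N ->
  [/\ forall x, arch_left k < x < arch_right k -> 0 < alog x,
      forall x, aend k < x < arch_left k -> alog x < 0 &
      forall x, arch_right k < x < aend k.+1 -> alog x < 0].
Proof.
move=> kr; have [a1 a2 a3] := arch_leftP kr; have [b1 b2 b3] := arch_rightP kr.
have ka : ain k (arch_left k) by split => //; have := @arch_endS R r k; rewrite /arch_mid in a2;
  have := pir; lra.
have kb : ain k (arch_right k) by split => //; rewrite /arch_mid in b1; have := pir; lra.
apply: (@concave_sign _ alog (@arch_log' R r)) => //.
- by move=> x xx; apply: (dv_arch_log r2 (k := k)).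
- by move=> x y ex xy ye; apply: (arch_log'_decr r2 (k := k)) => //; split => //; lra.
- exact: lt_trans a2 b1.
- by apply/eqP; rewrite -(arch_gap_log ka) a3.
- by apply/eqP; rewrite -(arch_gap_log kb) b3.
Qed.

Lemma arch_of x : 0 <= x < 2 * pi -> exists2 k, (k < r)%N & aend k <= x < aend k.+1.
Proof.
move=> /andP[x0 x2]; pose k := Num.truncn (x * r%:R / (2 * pi)).
have q0 : 0 <= x * r%:R / (2 * pi) by rewrite divr_ge0 ?mulr_ge0 ?(ltW r0) ?(ltW pi0).
have /andP[k1 k2] := truncn_itv q0.
have p2 : 0 < 2 * pi :> R by rewrite mulr_gt0.
exists k.
  rewrite -(@ltr_nat R); apply: le_lt_trans k1 _.
  by rewrite ltr_pdivrMr// mulrC ltr_pM2l.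
move: k1 k2; rewrite ler_pdivlMr// ltr_pdivrMr// -/k => k1 k2.
rewrite /arch_end ler_pdivrMr// ltr_pdivlMr//; apply/andP; split; lra.
Qed.

Lemma arch_zero x : 0 < x < 2 * pi -> agap x = 0 ->
  exists2 k, (k < r)%N & x = arch_left k \/ x = arch_right k.
Proof.
move=> /andP[x0 x2] gx; have [|k kr /andP[k1 k2]] := @arch_of x; first by rewrite ltW.
exists k => //; have kx : ain k x.
  split => //; rewrite k2 andbT lt_neqAle k1 andbT; apply/eqP => ex.
  move: gx; rewrite -ex /arch_gap chord_arch_end// expr0n -leqn0 leqNgt (leq_trans _ r2)// sub0r.
  by move/eqP; rewrite oppr_eq0 gt_eqF// ex chord_gt0// x0.
have lx : alog x = 0 by apply/eqP; rewrite -(arch_gap_log kx) gx.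
have [s1 s2 s3] := arch_sign kr.
have [xa|xa|->] := ltgtP x (arch_left k); last by left.
  have /s2 : aend k < x < arch_left k by case: kx => _ /andP[-> _].
  by rewrite lx ltxx.
have [xb|xb|->] := ltgtP x (arch_right k); last by right.
  by have := s1 x; rewrite xa xb lx ltxx => /(_ isT).
have /s3 : arch_right k < x < aend k.+1 by rewrite xb; case: kx => _ /andP[].
by rewrite lx ltxx.
Qed.

(* Numbered from 1: the zeros in the arch k have the indices 2k + 1 and 2k + 2. *)
Definition zero_seq (j : nat) : R :=
  if odd j then arch_left j./2 else arch_right j./2.-1.

Lemma zero_seq_odd k : zero_seq (2 * k).+1 = arch_left k.
Proof. by rewrite /zero_seq mul2n /= odd_double /= uphalf_double. Qed.

Lemma zero_seq_even k : zero_seq (2 * k).+2 = arch_right k.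
Proof. by rewrite /zero_seq mul2n /= odd_double /= doubleK. Qed.

Lemma zero_seq_lt j : (1 <= j)%N -> (j.+1 <= 2 * r)%N -> zero_seq j < zero_seq j.+1.
Proof.
move=> j1 j2; have jE := odd_double_half j; case oj: (odd j) jE => /= jE.
  rewrite -jE add1n -mul2n zero_seq_odd zero_seq_even.
  have kr : (j./2 < r)%N by lia.
  by have [_ h _] := arch_leftP kr; have [h' _ _] := arch_rightP kr; exact: lt_trans h h'.
case: (j./2) jE => [|k] jE; first by move: j1; rewrite -jE.
have -> : j = (2 * k).+2 by rewrite -jE; lia.
rewrite zero_seq_even (_ : (2 * k).+3 = (2 * k.+1).+1); last by lia.
rewrite zero_seq_odd.
have kr : (k.+1 < r)%N by lia.
have [h _ _] := arch_leftP kr; have [_ h' _] := arch_rightP (ltnW kr).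
exact: lt_trans h' h.
Qed.

Lemma zero_seq_mono i j : (1 <= i)%N -> (i < j)%N -> (j <= 2 * r)%N -> zero_seq i < zero_seq j.
Proof.
move=> i1; elim: j => // j ih; rewrite ltnS leq_eqVlt => /predU1P[<-|ij] jr.
  exact: zero_seq_lt.
by apply: lt_trans (ih ij (ltnW jr)) (zero_seq_lt _ jr); lia.
Qed.

Lemma zero_seq_rev j : (1 <= j <= 2 * r)%N -> zero_seq (2 * r + 1 - j) = 2 * pi - zero_seq j.
Proof.
move=> /andP[j1 j2]; have jE := odd_double_half j; case oj: (odd j) jE => /= jE.
  have -> : j = (2 * j./2).+1 by lia.
  rewrite zero_seq_odd (_ : (2 * r + 1 - (2 * j./2).+1)%N = (2 * (r.-1 - j./2)).+2); last by lia.
  by rewrite zero_seq_even /arch_right (_ : (r.-1 - (r.-1 - j./2))%N = j./2)//; lia.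
have -> : j = (2 * (j./2).-1).+2 by lia.
rewrite zero_seq_even (_ : (2 * r + 1 - (2 * (j./2).-1).+2)%N = (2 * (r.-1 - j./2.-1)).+1); last by lia.
by rewrite zero_seq_odd /arch_right; ring.
Qed.

Lemma zero_seq_itv j : (1 <= j <= 2 * r)%N -> 0 < zero_seq j < 2 * pi /\ agap (zero_seq j) = 0.
Proof.
move=> /andP[j1 j2]; have jE := odd_double_half j; case oj: (odd j) jE => /= jE.
  have -> : j = (2 * j./2).+1 by lia.
  have kr : (j./2 < r)%N by lia.
  rewrite zero_seq_odd; have [a1 a2 a3] := arch_leftP kr; split => //.
  apply: (inarch_itv r2 (k := j./2)); split => //.
  by have := @arch_endS R r j./2; rewrite /arch_mid in a2; have := pir; lra.
have -> : j = (2 * (j./2).-1).+2 by lia.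
have kr : ((j./2).-1 < r)%N by lia.
rewrite zero_seq_even; have [a1 a2 a3] := arch_rightP kr; split => //.
apply: (inarch_itv r2 (k := (j./2).-1)); split => //.
by rewrite /arch_mid in a1; have := pir; lra.
Qed.

Lemma zero_seq_pi j : (1 <= j <= r)%N -> 0 < zero_seq j < pi.
Proof.
move=> /andP[j1 jr].
have [|/andP[h1 _] _] := @zero_seq_itv j; first by lia.
rewrite h1 /=; have rr : zero_seq r < pi.
  have h := @zero_seq_lt r (ltnW r2) ltac:(lia).
  have := @zero_seq_rev r ltac:(lia).
  by rewrite (_ : (2 * r + 1 - r)%N = r.+1); [lra|lia].
have [->//|jr'] := eqVneq j r.
by apply: lt_trans rr; apply: zero_seq_mono; lia.
Qed.

Lemma zero_seqP x : 0 < x < pi -> agap x = 0 -> exists2 j, (1 <= j <= r)%N & zero_seq j = x.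
Proof.
move=> /andP[x0 xpi] gx.
have [|k kr H] := @arch_zero x _ gx; first by rewrite x0 /=; lra.
have [j jj E] : exists2 j, (1 <= j <= 2 * r)%N & zero_seq j = x.
  case: H => ->; first by exists (2 * k).+1; rewrite ?zero_seq_odd//; lia.
  by exists (2 * k).+2; rewrite ?zero_seq_even//; lia.
exists j => //; case/andP: jj => -> j2 /=; rewrite leqNgt; apply/negP => rj.
have h1 : zero_seq r < pi by have := @zero_seq_pi r; rewrite leqnn (ltnW r2) => /(_ isT)/andP[].
have := @zero_seq_rev r ltac:(lia).
rewrite (_ : (2 * r + 1 - r)%N = r.+1); last by lia.
have : zero_seq r.+1 <= zero_seq j.
  have [->//|rj'] := eqVneq j r.+1; apply/ltW/zero_seq_mono; lia.
by rewrite E; lra.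
Qed.

Lemma arch_gap_eq x : 0 < x < 2 * pi ->
  (agap x = 0) <-> (2 ^+ (r - 1) * `|sin (r%:R * x / 2)| ^+ r = sin (x / 2)).
Proof.
move=> xx; have xx' : 0 <= x <= 2 * pi by lra.
rewrite /arch_gap (chord_sin xx') /chord exprMn.
have -> : 2 ^+ r = 2 * 2 ^+ (r - 1) :> R by rewrite -exprS; congr (_ ^+ _); lia.
rewrite -[2 * 2 ^+ (r - 1) * _]mulrA -mulrBr; split => [/eqP|->]; last by rewrite subrr mulr0.
by rewrite mulf_eq0 pnatr_eq0 /= subr_eq0 => /eqP.
Qed.

Definition zero_sum (P : R -> R) := \sum_(1 <= j < r.+1) (-1) ^+ (j + 1) * P (zero_seq j).

Lemma zero_sum_arches (P : R -> R) : (forall x, P (2 * pi - x) = - P x) ->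
  \sum_(k < r) (P (arch_left k) - P (arch_right k)) = 2 * zero_sum P.
Proof.
move=> PN; pose F j := (-1) ^+ (j + 1) * P (zero_seq j).
have E n : \sum_(1 <= j < (2 * n).+1) F j = \sum_(k < n) (P (arch_left k) - P (arch_right k)).
  elim: n => [|n ih]; first by rewrite big_geq// big_ord0.
  rewrite (_ : (2 * n.+1).+1 = (2 * n).+3); last by lia.
  rewrite big_nat_recr//= big_nat_recr//= ih big_ord_recr/= /F zero_seq_odd zero_seq_even.
  rewrite !addn1 !exprS mulnC exprM sqrr_sign; ring.
rewrite -E (@big_cat_nat _ _ _ r.+1)//=; last by lia.
rewrite mulr_natl mulr2n; congr (_ + _).
rewrite big_nat_rev/= -{1}[r.+1]add1n big_addn.
rewrite (_ : ((2 * r).+1 - r = r.+1)%N); last by lia.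
apply: eq_big_nat => j jj; rewrite /F.
rewrite (_ : (r.+1 + (2 * r).+1 - (j + r).+1 = 2 * r + 1 - j)%N); last by lia.
rewrite zero_seq_rev; last by lia.
rewrite PN mulrN -mulNr; congr (_ * _).
have -> : (2 * r + 1 - j + 1 = 2 * (r - j) + j.+2)%N by lia.
rewrite exprD mulnC exprM sqrr_sign mul1r addn1 !exprS; ring.
Qed.

End Zeros.

Section LogRatio.
Variables (R : realType) (r : nat).
Hypothesis r2 : (2 <= r)%N.
Implicit Types (t u x y : R) (k : nat).

Let r0 : 0 < r%:R :> R. Proof. by rewrite ltr0n (leq_trans _ r2). Qed.
Let pi0 : 0 < pi :> R. Proof. exact: pi_gt0. Qed.

Local Notation aend := (@arch_end R r).
Local Notation agap := (@arch_gap R r).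
Local Notation alog := (@arch_log R r).
Local Notation aleft := (@arch_left R r).
Local Notation aright := (@arch_right R r).
Local Notation ain := (@inarch R r).

(* log max(chord (r u)^r, chord u) = log (chord u) + [lnratio u], where the second
   term is continuous. *)
Definition ratio u : R := chord (r%:R * u) ^+ r / chord u.
Definition lnratio u : R := ln (Num.max 1 (ratio u)).
Definition clausen_diff u : R := clausen 1 (r%:R * u) - clausen 1 u.

Lemma lnratio0 u : ratio u <= 1 -> lnratio u = 0.
Proof. by move=> le; rewrite /lnratio (elimT max_idPl le) ln1. Qed.

Lemma lnratioE k x : ain k x ->
  lnratio x = if 0 <= alog x then alog x else 0.
Proof.
move=> kx; have c1 : 0 < chord x by exact/chord_gt0/(inarch_itv r2)/kx.
have c2 : 0 < chord (r%:R * x) by case: kx => _; exact: (chord_arch r2).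
have q : 0 < ratio x by rewrite divr_gt0// exprn_gt0.
rewrite (arch_logE r2 kx) -/(ratio x); case: ifPn => h; last first.
  apply: lnratio0; rewrite leNgt; apply: contra h => h; exact/ltW/ln_gt0.
rewrite /lnratio (elimT max_idPr)// leNgt; apply/negP => h'.
have : ln (ratio x) < 0 by apply: ln_lt0; rewrite q.
by rewrite ltNge h.
Qed.

Lemma lnratio_2pi u : lnratio (u + 2 * pi) = lnratio u.
Proof.
by rewrite /lnratio /ratio mulrDr chord2pi_nat chord2pi.
Qed.

Lemma lnratio_cont : continuous lnratio.
Proof.
move=> u; have [c0|c0] := eqVneq (chord u) 0; last first.
  apply: (@continuous_comp _ _ _ (fun x => Num.max 1 (ratio x)) (@ln R)); last first.
    by apply: continuous_ln; rewrite lt_max ltr01.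
  apply: (@continuous_comp _ _ _ ratio (Num.max 1)); last first.
    by apply: continuous_max; [exact: cvg_cst|exact: cvg_id].
  apply: (@continuousM _ _ (fun x => chord (r%:R * x) ^+ r) (fun x => (chord x)^-1)).
    apply: (@continuous_comp _ _ _ (fun x => chord (r%:R * x)) (fun x => x ^+ r));
      last exact: exprn_continuous.
    apply: (@continuous_comp _ _ _ (fun x => r%:R * x) (@chord R)); last exact: chord_cont.
    exact: dv_cont (dvZ _ (dv_id _)).
  by apply: continuousV => //; exact: chord_cont.
have cg : {for u, continuous (fun x => r%:R ^+ r * chord x ^+ r.-1)}.
  apply: (@continuousM _ _ (fun=> r%:R ^+ r) (fun x => chord x ^+ r.-1)); first exact: cvg_cst.
  apply: (@continuous_comp _ _ _ (@chord R) (fun x => x ^+ r.-1)); last exact: exprn_continuous.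
  exact: chord_cont.
have := cvgr_lt _ cg 1; rewrite c0 expr0n gtn_eqF ?mulr0; last by lia.
move=> /(_ _ ltr01) nz.
have z0 : lnratio u = 0 by apply: lnratio0; rewrite /ratio c0 invr0 mulr0.
have zn : \forall x \near u, 0 = lnratio x.
  by move: nz; apply: filterS => x /ltW xx; rewrite lnratio0//; exact: (ratio_small r2).
rewrite /prop_for /continuous_at z0.
by apply: cvg_trans (near_eq_cvg zn) _; exact: cvg_cst.
Qed.

Lemma clausen_diffN u : clausen_diff (2 * pi - u) = - clausen_diff u.
Proof.
have h01 : 0 <= (1 : R) <= 1 by rewrite ler01 lexx.
rewrite /clausen_diff [2 * pi - u]addrC clausen2pi clausenN//.
have -> : r%:R * (- u + 2 * pi) = - (r%:R * u) + r%:R * (2 * pi) by ring.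
by rewrite clausen2pi_nat clausenN//; ring.
Qed.

Lemma dv_clausen_diff k x : ain k x -> dv clausen_diff x (- alog x).
Proof.
move=> kx; have h01 : 0 <= (1 : R) <= 1 by rewrite ler01 lexx.
have [q1 q2] := inarch_qnorm r2 kx.
apply: dv_eq (dvB (dv_scale (clausen_dv h01 q1)) (clausen_dv h01 q2)) _.
by rewrite /arch_log; ring.
Qed.

Lemma lnratio_int (H : R -> R) : (forall x, 0 <= x <= 2 * pi -> dv H x (lnratio x)) ->
  H (2 * pi) - H 0 = 2 * zero_sum r clausen_diff.
Proof.
move=> dH; rewrite -(zero_sum_arches r2 clausen_diffN).
transitivity (\sum_(0 <= k < r) (H (aend k.+1) - H (aend k))).
  rewrite telescope_sumr// arch_end_r// /arch_end mulr0 mul0r//.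
rewrite big_mkord; apply: eq_bigr => [[k kr]] _ /=.
have [a1 a2 a3] := @arch_leftP R r r2 k kr; have [b1 b2 b3] := @arch_rightP R r r2 k kr.
have [s1 s2 s3] := @arch_sign R r r2 k kr.
have e0 := @arch_end_ge0 R r r2 k; have e1 := @arch_end_le2pi R r r2 k kr.
have ab : aleft k < aright k := lt_trans a2 b1.
have inl : ain k (aleft k) by split => //; rewrite a1 (lt_trans ab).
have inr : ain k (aright k) by split => //; rewrite b2 (lt_trans a1).
have lgl : alog (aleft k) = 0 by apply/eqP; rewrite -(arch_gap_log r2 inl) a3.
have lgr : alog (aright k) = 0 by apply/eqP; rewrite -(arch_gap_log r2 inr) b3.
have zend j : lnratio (aend j) = 0.
  apply: lnratio0; rewrite /ratio chord_arch_end// expr0n gtn_eqF ?mul0r//; lia.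
have zz x : ain k x -> alog x <= 0 -> lnratio x = 0.
  by move=> kx le; rewrite (lnratioE kx); case: ifP => // ge; apply/le_anti; rewrite le.
have E1 : H (aleft k) = H (aend k).
  apply: dv0_cst; first exact: ltW.
  move=> x /andP[x1 x2]; rewrite -(_ : lnratio x = 0); first by apply: dH; lra.
  move: x1; rewrite le_eqVlt => /predU1P[<-//|x1].
  have kx : ain k x by split => //; rewrite x1; lra.
  apply: (zz _ kx); move: x2; rewrite le_eqVlt => /predU1P[->|x2]; first by rewrite lgl.
  by apply/ltW/s2; rewrite x1.
have E3 : H (aend k.+1) = H (aright k).
  apply: dv0_cst; first exact: ltW.
  move=> x /andP[x1 x2]; rewrite -(_ : lnratio x = 0); first by apply: dH; lra.
  move: x2; rewrite le_eqVlt => /predU1P[->//|x2].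
  have kx : ain k x by split => //; rewrite x2; lra.
  apply: (zz _ kx); move: x1; rewrite le_eqVlt => /predU1P[<-|x1]; first by rewrite lgr.
  by apply/ltW/s3; rewrite x1.
have E2 : H (aright k) + clausen_diff (aright k) =
          H (aleft k) + clausen_diff (aleft k).
  apply: (@dv0_cst _ (fun x => H x + clausen_diff x)); first exact: ltW.
  move=> x /andP[x1 x2].
  have kx : ain k x by split => //; lra.
  have ge : 0 <= alog x.
    move: x1; rewrite le_eqVlt => /predU1P[<-|x1]; first by rewrite lgl.
    move: x2; rewrite le_eqVlt => /predU1P[->|x2]; first by rewrite lgr.
    by apply/ltW/s1; rewrite x1.
  rewrite -(subrr (alog x)); apply: dvD (dv_clausen_diff kx).
  have := lnratioE kx; rewrite ge => <-; apply: dH; lra.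
by rewrite E3 -E1; lra.
Qed.

Lemma hasint_lnratio t :
  hasint (- pi) pi (fun x => (lnratio (x + t))%:E) (2 * zero_sum r clausen_diff).
Proof. exact: hasint_periodic lnratio_cont lnratio_2pi lnratio_int. Qed.

Lemma chebP_root x : 0 < x < pi ->
  root (chebP R r) (cos x) <-> agap x = 0.
Proof.
move=> xx; have c1 : 0 < 1 - cos x
  by rewrite -(pmulr_rgt0 _ (ltr0Sn R 1)) -qnorm1E qnorm_chord exprn_gt0// chord_gt0//; lra.
have h : 0 < 2 ^ (1 - r%:Z) :> R by rewrite exprz_gt0.
have d0 : 2 ^ (1 - r%:Z) * (1 - cos x) != 0 by rewrite mulf_neq0 ?gt_eqF.
have := @chebP_exact R r (leq_trans (isT : (0 < 2)%N) r2).
move: (chebP R r) => P /(congr1 (fun p => p.[cos x])).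
rewrite !(hornerM, hornerD, hornerN, hornerC, hornerX, horner_exp) chebyshev_cos.
have p2 : 2 ^ (1 - r%:Z) * 2 ^+ r = 2 :> R.
  by rewrite exprnP -expfzDr// subrK expr1z.
have E : (1 - cos (r%:R * x)) ^+ r = (chord (r%:R * x) ^+ r) ^+ 2 / 2 ^+ r.
  apply: (canRL (mulfK _)); first by rewrite expf_neq0.
  by rewrite exprAC -qnorm_chord qnorm1E -exprMn mulrC.
have E2 : 1 - cos x = chord x ^+ 2 / 2.
  by rewrite -qnorm_chord qnorm1E; field.
move=> M; rewrite rootE; split.
  move=> /eqP c0; move: M; rewrite c0 add0r mul1r E E2 => M.
  have : chord x ^+ 2 = (chord (r%:R * x) ^+ r) ^+ 2.
    have r0' : 2 ^+ r != 0 :> R by rewrite expf_neq0.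
    have := congr1 (fun z => z * 2 ^+ r) M; rewrite divfK// => <-.
    have -> : 2 ^ (1 - r%:Z) * (chord x ^+ 2 / 2) * 2 ^+ r =
      (2 ^ (1 - r%:Z) * 2 ^+ r) * chord x ^+ 2 / 2 by ring.
    by rewrite p2; field.
  move=> /eqP; rewrite eqrXn2 ?chord_ge0 ?exprn_ge0 ?chord_ge0// => /eqP e.
  by rewrite /arch_gap e subrr.
rewrite /arch_gap => /eqP; rewrite subr_eq0 => /eqP e.
have : (P.[cos x] + 1) * (2 ^ (1 - r%:Z) * (1 - cos x)) = 2 ^ (1 - r%:Z) * (1 - cos x).
  rewrite M E e E2; have r0' : 2 ^+ r != 0 :> R by rewrite expf_neq0.
  apply: (canLR (mulfK r0')).
  have -> : 2 ^ (1 - r%:Z) * (chord x ^+ 2 / 2) * 2 ^+ r =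
      (2 ^ (1 - r%:Z) * 2 ^+ r) * chord x ^+ 2 / 2 by ring.
  by rewrite p2; field.
rewrite -[RHS]mul1r => /(mulIf d0)/eqP.
by rewrite -[X in _ == X]add0r (inj_eq (addIr _)).
Qed.

End LogRatio.

(** * The Mahler measure of x5 *)

Section Swap.
Variable R : realType.
Local Notation mu := (@lebesgue_measure R).
Implicit Types (t u x y : R) (s : seq R).

Lemma ae_notin s (P : R -> Prop) : (forall x, x \notin s -> P x) -> {ae mu, forall x, P x}.
Proof.
move=> H; have cs : countable [set` s] by apply: finite_set_countable; exact: finite_seq.
exists [set` s]; split.
- by apply: countable_measurable => // t; exact: measurable_set1.
- exact: countable_lebesgue_measure0.
- by move=> x /= nP; apply: contrapT => /negP/H.
Qed.

(* Tonelli's theorem for c - f, which is nonnegative; outside of [s] the inner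
   integrals are finite. *)
Lemma integral_swap (D : set R) (f : R -> R -> \bar R) (b c : R) s (m : R -> R) (M : R -> \bar R) I :
  D = `[- b, b]%classic -> 0 <= b ->
  measurable_fun setT (fun p : R * R => f p.1 p.2) ->
  (forall x y, (f x y <= c%:E)%E) ->
  (forall y, D y -> y \notin s -> hasint (- b) b (f ^~ y) (m y) /\ M y = (m y)%:E) ->
  hasint (- b) b M I ->
  (\int[mu]_(x in D) \int[mu]_(y in D) f x y = I%:E)%E.
Proof.
move=> DE b0 mf fc fm [iM IM]; rewrite DE in fm *; set D' := `[- b, b]%classic in fm iM IM *.
have mD : measurable D' by exact: measurable_itv.
pose g := (fun p : R * R => f p.1 p.2) \_ (D' `*` D').
have gE x y : g (x, y) = if (x \in D') && (y \in D') then f x y else 0%E.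
  by rewrite /g patchE in_setX.
have mg : measurable_fun setT g.
  have mDD : measurable (D' `*` D') by exact: measurableX.
  apply/(measurable_restrictT _ mDD).
  exact: (measurable_funS measurableT (@subsetT _ _) mf).
have Gx (h : \bar R -> \bar R) x : h 0%E = 0%E ->
    (\int[mu]_y h (g (x, y)) = ((fun x => \int[mu]_(y in D') h (f x y)) \_ D') x)%E.
  move=> h0; rewrite patchE; case: ifPn => xD.
    rewrite /= [RHS]integral_mkcond; apply: eq_integral => y _.
    by rewrite gE xD patchE /=; case: ifP.
  by rewrite integral0_eq// => y _; rewrite gE (negPf xD).
have Gy (h : \bar R -> \bar R) y : h 0%E = 0%E ->
    (\int[mu]_x h (g (x, y)) = ((fun y => \int[mu]_(x in D') h (f x y)) \_ D') y)%E.
  move=> h0; rewrite patchE; case: ifPn => yD.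
    rewrite /= [RHS]integral_mkcond; apply: eq_integral => x _.
    by rewrite gE yD andbT patchE /=; case: ifP.
  by rewrite integral0_eq// => x _; rewrite gE (negPf yD) andbF.
have mGh (h : \bar R -> \bar R) : h 0%E = 0%E ->
    measurable_fun setT (fun y => \int[mu]_x h (g (x, y)))%E ->
    measurable_fun D' (fun y => \int[mu]_(x in D') h (f x y))%E.
  move=> h0 mh; apply/(measurable_restrictT _ mD).
  by apply: eq_measurable_fun mh => y _; rewrite Gy.
have bb : - b <= b by lra.
pose c' := Num.max c 0.
have c'0 : 0 <= c' by rewrite le_max lexx orbT.
have cc' : c <= c' by rewrite le_max lexx.
pose N y := ((2 * c' * (b - - b))%:E + (-1)%:E * M y)%E.
have iN : hasint (- b) b N (2 * c' * (b - - b) * (b - - b) + -1 * I).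
  exact: hasintD (hasint_cst _ bb) (hasintZ (-1) (conj iM IM)).
have mK : measurable_fun D' (fun y => \int[mu]_(x in D') `|f x y|)%E.
  apply: (mGh abse); first by rewrite abse0.
  apply: (@measurable_fun_fubini_tonelli_G _ _ _ _ _ mu (abse \o g)).
    exact: measurableT_comp.
  by move=> p; exact: abse_ge0.
have ig : (mu \x mu)%E.-integrable setT g.
  apply/integrable21ltyP => //.
  under eq_integral do rewrite (Gy abse) ?abse0//.
  rewrite -integral_mkcond.
  apply: (@le_lt_trans _ _ (\int[mu]_(y in D') `|N y|)%E); last first.
    by case: iN => /integrableP[].
  apply: ae_ge0_le_integral => //.
  - by move=> y _; exact: integral_ge0.
  - by apply: measurableT_comp => //; case: iN => /measurable_int.
  apply: (@ae_notin s) => y ys yD; have [[if1 If1] My] := fm y yD ys.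
  apply: le_trans (lee_abs _); rewrite /N My.
  have [iv Iv] := hasintD (hasint_cst (2 * c') bb) (hasintZ (-1) (conj if1 If1)).
  rewrite -EFinM -EFinD -Iv; apply: ge0_le_integral => //.
  - by apply: measurableT_comp => //; exact: measurable_int if1.
  - exact: measurable_int iv.
  move=> x _; have := fc x y; case: (f x y) => [z||] //=.
    rewrite !lee_fin => zc; have [z0|z0] := leP 0 z.
      by rewrite ger0_norm//; lra.
    by rewrite ltr0_norm//; lra.
  by move=> _; rewrite mulN1e /= addey.
rewrite integral_mkcond.
under eq_integral do rewrite -(Gx id)//.
rewrite Fubini//; under eq_integral do rewrite (Gy id)//.
rewrite -integral_mkcond -IM.
apply: ae_eq_integral => //.
- apply: (mGh id) => //; exact: measurable_fubini_G ig.
- exact: measurable_int iM.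
by apply: (@ae_notin s) => y ys yD; have [[_ If1] ->] := fm y yD ys.
Qed.
End Swap.

Section Measurability.
Variable R : realType.
Implicit Types (t u x y : R) (P : laurent R[i]).
Local Notation nc := (@Normc.normc R).

Lemma measurable_lne_fin : measurable_fun setT (fun x : R => lne x%:E).
Proof.
apply: (eq_measurable_fun (fun x : R => if x <= 0 then -oo%E else (ln x)%:E)) => //.
apply: measurable_fun_if => //.
- by apply: measurable_fun_ler => //; exact: measurable_cst.
- by apply: measurable_funTS; apply/measurable_EFinP; exact: measurable_ln.
Qed.

Lemma laurent_eval_polar P x y :
  laurent_eval P (expi x) (expi y) =
  \sum_(k <- msupp P) mcoeff k P * expi (k.1%:~R * x + k.2%:~R * y).
Proof. by apply: eq_bigr => k _; rewrite !expiXz expiD mulrA. Qed.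

Lemma Re_sum (I : Type) (s : seq I) (f : I -> R[i]) :
  complex.Re (\sum_(i <- s) f i) = \sum_(i <- s) complex.Re (f i).
Proof. by apply: big_morph => // -[? ?] [? ?]. Qed.

Lemma Im_sum (I : Type) (s : seq I) (f : I -> R[i]) :
  complex.Im (\sum_(i <- s) f i) = \sum_(i <- s) complex.Im (f i).
Proof. by apply: big_morph => // -[? ?] [? ?]. Qed.

Lemma measurable_laurent_eval P :
  measurable_fun setT (fun p : R * R => lne (nc (laurent_eval P (expi p.1) (expi p.2)))%:E).
Proof.
apply: (measurableT_comp measurable_lne_fin).
pose th (k : int * int) (p : R * R) : R := k.1%:~R * p.1 + k.2%:~R * p.2.
have mth k : measurable_fun setT (th k).
  by apply: measurable_funD; apply: measurable_funM => //; exact: measurable_cst.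
have mc k : measurable_fun setT (fun p => cos (th k p)).
  by apply: (measurableT_comp _ (mth k)); apply: continuous_measurable_fun; exact: continuous_cos.
have ms k : measurable_fun setT (fun p => sin (th k p)).
  by apply: (measurableT_comp _ (mth k)); apply: continuous_measurable_fun; exact: continuous_sin.
pose c k := mcoeff k P.
apply: (eq_measurable_fun (fun p => Num.sqrt (
  (\sum_(k <- msupp P) (complex.Re (c k) * cos (th k p) - complex.Im (c k) * sin (th k p))) ^+ 2 +
  (\sum_(k <- msupp P) (complex.Re (c k) * sin (th k p) + complex.Im (c k) * cos (th k p))) ^+ 2))).
  move=> p _; rewrite laurent_eval_polar -[RHS](ger0_norm (nc_ge0 _)) -sqrtr_sqr nc_sqr.
  rewrite Re_sum Im_sum; congr (Num.sqrt (_ ^+ 2 + _ ^+ 2)); apply: eq_bigr => k _.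
    by rewrite /c /th; case: (mcoeff k P).
  by rewrite /c /th; case: (mcoeff k P) => a b /=; rewrite addrC.
have msq : measurable_fun setT (@Num.sqrt R).
  by apply: continuous_measurable_fun; exact: sqrt_continuous.
apply: (measurableT_comp msq).
apply: measurable_funD; apply: measurable_funX; apply: measurable_sum => k.
  by apply: measurable_funB; apply: measurable_funM => //; exact: measurable_cst.
by apply: measurable_funD; apply: measurable_funM => //; exact: measurable_cst.
Qed.

Lemma laurent_eval_bounded P : exists c, forall x y,
  (lne (nc (laurent_eval P (expi x) (expi y)))%:E <= c%:E)%E.
Proof.
pose B := \sum_(k <- msupp P) nc (mcoeff k P).
have B0 : 0 <= B by apply: sumr_ge0 => k _; exact: nc_ge0.
exists (ln (B + 1)) => x y.
have le : nc (laurent_eval P (expi x) (expi y)) <= B.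
  rewrite laurent_eval_polar /B.
  elim/big_ind2 : _ => //.
  - by rewrite le_eqVlt nc_eq0 eqxx.
  - by move=> z1 b1 z2 b2 h1 h2; apply: le_trans (ncD _ _) _; exact: lerD.
  - by move=> k _; rewrite ncM nc_expi mulr1.
have [n0|n0] := eqVneq (nc (laurent_eval P (expi x) (expi y))) 0.
  by rewrite n0 le0_lneNy// leNye.
have n1 : 0 < nc (laurent_eval P (expi x) (expi y)) by rewrite lt_neqAle eq_sym n0 nc_ge0.
by rewrite lne_EFin// lee_fin ler_ln ?posrE//; lra.
Qed.
End Measurability.

Section X5.
Variables (R : realType) (r : nat) (x : nat -> laurent int).
Hypotheses (r2 : (2 <= r)%N) (xs : cluster_seq r x).
Implicit Types (t u : R).
Local Notation nc := (@Normc.normc R).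
Local Notation mu := (@lebesgue_measure R).

Let r1 : (0 < r)%N. Proof. exact: ltnW. Qed.
Let rR : 0 < r%:R :> R. Proof. by rewrite ltr0n. Qed.
Let pi0 : 0 < pi :> R. Proof. exact: pi_gt0. Qed.

Let th (j : nat) : R := (2 * j + 1)%:R * pi / r%:R.

Lemma eval_x5 (z w : R[i]) : z != 0 -> w != 0 -> w ^+ r + 1 != 0 ->
  laurent_eval (laurentC R[i] (x 5%N)) z w =
    w ^ (- r%:Z) * ((((w ^+ r + 1) / z) ^+ r + 1) ^+ r + w ^+ r) * z / (w ^+ r + 1).
Proof.
move=> z0 w0 W0; rewrite laurent_evalC (cluster5 r1 xs).
set S := \sum_(1 <= j < r.+1) _.
have x3 := cluster3 xs.
have e3 : leval intr z w (x 3%N) = (w ^+ r + 1) / z.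
  rewrite x3 !(levalM, levalD, levalX, leval_lX)// ?leval1//.
  by rewrite !expr0z !expr1z ?mul1r !mulr1 exprN1.
have y0 : (w ^+ r + 1) / z != 0 by rewrite mulf_neq0// invr_eq0.
have ES : (w ^+ r + 1) / z * leval intr z w S + 1 = (((w ^+ r + 1) / z) ^+ r + 1) ^+ r.
  have : x 3%N * S + 1 = (x 3%N ^+ r + 1) ^+ r by rewrite -/(cluster_q r _) cluster_qE// subrK.
  move/(congr1 (leval intr z w)); rewrite levalD levalM// e3 levalX// levalD levalX// e3.
  by rewrite leval1.
rewrite levalM// levalD !leval_lX expr0z mul1r expr1z expr0z mulr1.
by rewrite -ES; field; rewrite W0 z0.
Qed.

Let thE j : r%:R * th j = pi + j%:R * (2 * pi).
Proof. by rewrite /th mulrC divfK ?gt_eqF// natrD natrM; ring. Qed.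

Lemma chord_x5 u j : nc (expi u ^+ r + 1) = chord (r%:R * (u + th j)).
Proof.
rewrite expiX mulrDr thE addrA chord2pi_nat -nc_1Bexpi expiD expi_pi.
by congr (nc _); ring.
Qed.

Lemma lne_eval_x5 t u : expi u ^+ r + 1 != 0 :> R[i] ->
  lne (nc (laurent_eval (laurentC R[i] (x 5%N)) (expi t) (expi u)))%:E =
  (\sum_(j < r) lne (nc ((1 - zeta R r j * expi u) * expi (r%:R * t) + (expi u ^+ r + 1) ^+ r))%:E
   + (- ln (nc (expi u ^+ r + 1)))%:E)%E.
Proof.
move=> W0; have z0 := @expi_neq0 R t; have w0 := @expi_neq0 R u.
rewrite eval_x5// !ncM ncV expiXz !nc_expi mul1r mulr1.
rewrite lne_mul ?invr_ge0 ?nc_ge0// EFinN -lne_EFin ?nc_gt0// -lneV ?nc_gt0//.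
congr (_ + _)%E; rewrite -prod_zetaM// nc_prod.
rewrite -(lne_prod _ (fun j => nc_ge0 _)); congr (lne _%:E); apply: eq_bigr => j _.
rewrite -[RHS]mulr1 -[X in _ = _ * X](nc_expi (- (r%:R * t))) -ncM; congr (nc _).
have E (a b e : R[i]) : e != 0 -> (a * e + b) * e^-1 = b / e + a by move=> e0; field.
by rewrite expiN E ?expi_neq0// expr_div_n (expiX t); ring.
Qed.

Lemma mahler_x5 : mahler (laurentC R[i] (x 5%N)) =
  (r%:R / pi * zero_sum r (clausen_diff (R := R) r))%:E.
Proof.
set P := laurentC R[i] (x 5%N); set Z := zero_sum _ _.
pose W u : R[i] := expi u ^+ r + 1.
pose m u := \sum_(j < r) (2 * pi * ln (Num.max (nc (1 - zeta R r j * expi u)) (nc (W u ^+ r))))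
   + (- ln (nc (W u))) * (pi - - pi).
pose M u : \bar R := ((2 * pi)%:E * (\sum_(j < r) (lne (chord (u + th j))%:E + (lnratio r (u + th j))%:E)
   + (-1)%:E * lne (nc (W u))%:E))%E.
pose s : seq R := [seq (k%:R * (2 * pi) - (pi + r%:R * (2 * pi))) / r%:R | k <- iota 0 (2 * r).+1].
have [c Hc] := laurent_eval_bounded P.
have pi0' := pi0; have rR' := rR.
have pp : - pi <= pi :> R by lra.
suff E : (\int[mu]_(t in `[(- pi)%R, pi]) \int[mu]_(u in `[(- pi)%R, pi])
     lne (nc (laurent_eval P (expi t) (expi u)))%:E =
   (2 * pi * (\sum_(j < r) (0 + 2 * Z) + -1 * 0))%:E)%E.
  rewrite /mahler E -EFinM mulr0 addr0 add0r sumr_const card_ord -[_ *+ r]mulr_natl.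
  by rewrite (mulrCA _ 2) torus_mean mulrAC.
apply: (@integral_swap _ _ _ pi c s m M) => //.
- exact: ltW.
- exact: measurable_laurent_eval.
- move=> u; rewrite /= in_itv/= => uu us.
  have W0 : W u != 0.
    apply: contra us => /eqP W0; pose y := r%:R * u + (pi + r%:R * (2 * pi)).
    have y0 : 0 <= y by rewrite /y; have := ltW rR; nra.
    have c1 : cos y = 1.
      rewrite /y addrA cos_period_nat cosDpi; move: W0; rewrite /W expiX => /(congr1 (@complex.Re R))/=.
      lra.
    have [k kE] := cos_eq1_nat y0 c1; apply/mapP; exists k; last first.
      by rewrite -kE /y addrK mulrC mulKf ?gt_eqF.
    rewrite mem_iota add0n ltnS /= -(ler_nat R) natrM.
    have : k%:R * (2 * pi) <= 2 * r%:R * (2 * pi) :> R.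
      have r1R : 1 <= r%:R :> R by rewrite ler1n.
      have h1 : r%:R * u <= r%:R * pi by rewrite ler_pM2l//; case/andP: uu.
      have h2 : pi <= r%:R * pi :> R by rewrite ler_peMl// ltW.
      by move: kE; rewrite /y => kE'; lra.
    by rewrite ler_pM2r// mulr_gt0.
  split.
    apply: hasint_eq (fun t _ => esym (lne_eval_x5 t W0)) _.
    apply: hasintD; last exact: hasint_cst.
    apply: hasint_sum => // j; apply: hasint_jensen => //.
    by rewrite orbC expf_neq0.
  have cp j : 0 < chord (r%:R * (u + th j)) by rewrite -chord_x5 nc_gt0.
  have cp' j : 0 < chord (u + th j).
    have := chord_nat_le (u + th j) r => /(lt_le_trans (cp j)).
    by rewrite pmulr_rgt0.
  rewrite /M lne_EFin ?nc_gt0//.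
  have E j : (lne (chord (u + th j))%:E + (lnratio r (u + th j))%:E =
     (ln (Num.max (nc (1 - zeta R r j * expi u)) (nc (W u ^+ r))))%:E)%E.
    rewrite lne_EFin// -EFinD; congr EFin.
    rewrite /lnratio -lnM ?posrE// ?lt_max ?ltr01//.
    rewrite maxr_pMr ?(ltW (cp' j))// mulr1 /ratio mulrC divfK ?gt_eqF//.
    by rewrite ncX (chord_x5 u j) -expiD addrC -/(th j) nc_1Bexpi.
  under eq_bigr do rewrite E.
  rewrite sumEFin -EFinM /m mulrDr mulr_sumr; congr (_ + _)%:E; ring.
- have jz A B n : (0 < n)%N -> nc A = 1 -> nc B = 1 ->
      hasint (- pi) pi (fun u => lne (nc (A * expi (n%:R * u) + B))%:E) 0.
    move=> n0 A1 B1; have := @hasint_jensen R n A B n0.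
    rewrite A1 B1 maxxx ln1 mulr0; apply.
    by rewrite -nc_gt0 A1 ltr01.
  apply: hasintZ; apply: hasintD; last first.
    apply: hasintZ; apply: hasint_eq (jz 1 1 r r1 (nc1 R) (nc1 R)) => u _.
    by rewrite mul1r -expiX.
  apply: hasint_sum => // j; apply: hasintD; last exact: hasint_lnratio.
  apply: hasint_eq (jz (- expi (th j)) 1 1%N isT _ (nc1 R)) => [u _|].
    by rewrite mul1r -nc_1Bexpi expiD; congr (lne (nc _)%:E); ring.
  by rewrite ncN nc_expi.
Qed.
End X5.

(** * The L-function *)

Section ComplexLimits.
Variable R : realType.
Implicit Types (t x y : R) (z w l : R[i]) (u v : nat -> R[i]).
Local Notation nc := (@Normc.normc R).
Local Notation Re := (@complex.Re R).
Local Notation Im := (@complex.Im R).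

Lemma nc_le_ReIm z : nc z <= `|Re z| + `|Im z|.
Proof.
rewrite -ler_sqr ?nnegrE ?nc_ge0 ?addr_ge0//.
rewrite nc_sqr -[Re z ^+ 2]real_normK ?num_real// -[Im z ^+ 2]real_normK ?num_real//.
have := normr_ge0 (Re z); have := normr_ge0 (Im z).
move: `|_| `|_| => a b b0 a0; nra.
Qed.

Lemma normC_nc z : `|z| = (nc z)%:C :> R[i].
Proof. by case: z. Qed.

Lemma ReD z w : Re (z + w) = Re z + Re w. Proof. by case: z; case: w. Qed.
Lemma ImD z w : Im (z + w) = Im z + Im w. Proof. by case: z; case: w. Qed.
Lemma ReN z : Re (- z) = - Re z. Proof. by case: z. Qed.
Lemma ImN z : Im (- z) = - Im z. Proof. by case: z. Qed.
Lemma ReM z w : Re (z * w) = Re z * Re w - Im z * Im w.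
Proof. by case: z; case: w. Qed.
Lemma ImM z w : Im (z * w) = Re z * Im w + Im z * Re w.
Proof. by case: z; case: w. Qed.

Definition ccvg u l := (Re \o u) @ \oo --> Re l /\ (Im \o u) @ \oo --> Im l.

Lemma ccvg_cvg u l : ccvg u l -> (u : nat -> R[i]^o) @ \oo --> (l : R[i]^o).
Proof.
move=> [ur ui]; apply/cvgrPdist_lt => -[e e'].
rewrite ltcE /= => /andP[/eqP -> e0].
have e2 : 0 < e / 2 by lra.
have /cvgrPdist_lt/(_ _ e2) hr := ur; have /cvgrPdist_lt/(_ _ e2) hi := ui.
near_simpl; apply: filterS2 hr hi => n hr' hi'.
rewrite normC_nc -[_ +i* 0]/(e%:C) ltcR.
apply: le_lt_trans (nc_le_ReIm _) _; rewrite (splitr e).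
rewrite ReD ReN ImD ImN; exact: ltrD.
Qed.

Lemma complexP z w : Re z = Re w -> Im z = Im w -> z = w.
Proof. by case: z; case: w => a b c d /= -> ->. Qed.

Lemma ccvg_unique u l l' : ccvg u l -> ccvg u l' -> l = l'.
Proof.
move=> [h1 h2] [h1' h2']; apply: complexP; exact: cvg_unique h1 h1' || exact: cvg_unique h2 h2'.
Qed.

Lemma ccvgD u v l l' : ccvg u l -> ccvg v l' -> ccvg (fun n => u n + v n) (l + l').
Proof.
move=> [h1 h2] [h1' h2']; split.
  by rewrite ReD (_ : _ \o _ = fun n => Re (u n) + Re (v n)); [exact: cvgD|apply/funext => n /=; rewrite ReD].
by rewrite ImD (_ : _ \o _ = fun n => Im (u n) + Im (v n)); [exact: cvgD|apply/funext => n /=; rewrite ImD].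
Qed.

Lemma ccvg_cst l : ccvg (fun=> l) l.
Proof. by split; exact: cvg_cst. Qed.

Lemma ccvgZ z u l : ccvg u l -> ccvg (fun n => z * u n) (z * l).
Proof.
move=> [h1 h2]; split.
  rewrite ReM (_ : _ \o _ = fun n => Re z * Re (u n) - Im z * Im (u n)).
    by apply: cvgB; apply: cvgMr.
  by apply/funext => n /=; rewrite ReM.
rewrite ImM (_ : _ \o _ = fun n => Re z * Im (u n) + Im z * Re (u n)).
  by apply: cvgD; apply: cvgMr.
by apply/funext => n /=; rewrite ImM.
Qed.

Lemma ccvg_eq u v l : (forall n, u n = v n) -> ccvg u l -> ccvg v l.
Proof. by move=> /funext ->. Qed.

Lemma ccvg_nc0 u : (nc \o u) @ \oo --> (0 : R) -> ccvg u 0.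
Proof.
move=> h; split; apply/norm_cvg0P => /=.
- apply: (squeeze_cvgr _ (cvg_cst (0 : R)) h); apply: nearW => n /=.
  by rewrite normr_ge0 nc_Re.
- apply: (squeeze_cvgr _ (cvg_cst (0 : R)) h); apply: nearW => n /=.
  by rewrite normr_ge0 nc_Im.
Qed.

Lemma ccvg_series u (e : nat -> R) : (forall n, nc (u n) <= e n - e n.+1) ->
  e @ \oo --> (0 : R) ->
  exists2 l, ccvg (fun n => \sum_(k < n) u k) l & nc l <= 2 * e 0%N.
Proof.
move=> ue e0.
have [a sa ba] := @cvg_dom_telescope _ (Re \o u) e
  (fun n => le_trans (nc_Re _) (ue n)) e0.
have [b sb bb] := @cvg_dom_telescope _ (Im \o u) e
  (fun n => le_trans (nc_Im _) (ue n)) e0.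
exists (a +i* b).
  split => /=.
    apply: cvg_trans sa; apply: near_eq_cvg; apply: nearW => n.
    by rewrite seriesEord /=; elim/big_ind2 : _ => // -[? ?] ? [? ?] ? /= <- <-.
  apply: cvg_trans sb; apply: near_eq_cvg; apply: nearW => n.
  by rewrite seriesEord /=; elim/big_ind2 : _ => // -[? ?] ? [? ?] ? /= <- <-.
apply: le_trans (nc_le_ReIm _) _ => /=.
have := ba 0%N; have := bb 0%N; rewrite !seriesEord/= !big_ord0 !sub0r !normrN; lra.
Qed.

Lemma bloch_wigner_expi t : bloch_wigner (expi t) = clausen 1 t.
Proof.
have h01 : 0 <= (1 : R) <= 1 by rewrite ler01 lexx.
rewrite /bloch_wigner nc_expi ln1 mul0r addr0 /Li2.
pose u n : R[i] := expi t ^+ n.+1 / n.+1%:R ^+ 2.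
have uE n : u n = (cos (n.+1%:R * t) / n.+1%:R ^+ 2) +i* clterm 1 t n.
  rewrite /u expiX /clterm expr1n mul1r.
  have -> : (n.+1%:R ^+ 2)^-1 = ((n.+1%:R ^+ 2)^-1 : R)%:C.
    by rewrite fmorphV rmorphXn rmorph_nat.
  by apply: complexP => /=; ring.
have [|l ul _] := @ccvg_series u (fun k => 2 / k.+1%:R) _ (@cvg_2Vn R).
  move=> n; rewrite /u ncM ncV ncX ncX nc_expi expr1n mul1r.
  have -> : nc n.+1%:R = n.+1%:R by rewrite -[n.+1%:R](rmorph_nat (real_complex R)) nc_real ger0_norm.
  have k0 : 0 < n.+1%:R :> R by rewrite ltr0n.
  have -> : 2 / n.+1%:R - 2 / n.+2%:R = 2 / (n.+1%:R * (n.+1%:R + 1)) :> R.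
    by rewrite -[n.+2%:R]natr1; field; rewrite !gt_eqF// addr_gt0.
  have : 1 <= n.+1%:R :> R by rewrite ler1n.
  move: (n.+1%:R : R) k0 => z z0 z1.
  rewrite ler_pdivlMr ?mulr_gt0 ?addr_gt0// mulrC ler_pdivrMr ?exprn_gt0//.
  nra.
have -> : limn (series (u : nat -> R[i]^o)) = l.
  apply: cvg_lim => //; rewrite seriesEord; exact: ccvg_cvg ul.
case: ul => _ h; suff h2 : (Im \o (fun n => \sum_(k < n) u k)) @ \oo --> clausen 1 t.
  exact: (cvg_unique _ h h2).
apply: cvg_trans (clausen_cvg h01); apply: near_eq_cvg; apply: nearW => n.
rewrite seriesEord /=; under [X in _ = _ X]eq_bigr do rewrite uE.
by elim/big_ind2 : _ => // -[? ?] ? [? ?] ? /= <- <-.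
Qed.

End ComplexLimits.

Section ComplexPowers.
Variable R : realType.
Implicit Types (t x y B K : R) (z w l s h c : R[i]) (f g : R -> R[i]).
Local Notation nc := (@Normc.normc R).
Local Notation Re := (@complex.Re R).
Local Notation Im := (@complex.Im R).

Definition cdv f x l := dv (fun y => Re (f y)) x (Re l) /\ dv (fun y => Im (f y)) x (Im l).

Lemma cdv_eq f x l l' : cdv f x l -> l = l' -> cdv f x l'.
Proof. by move=> h <-. Qed.

Lemma cdv_ext f g x l : (forall y, f y = g y) -> cdv f x l -> cdv g x l.
Proof. by move=> /funext ->. Qed.

Lemma cdv_cst c x : cdv (fun=> c) x 0.
Proof. by split; exact: dv_cst. Qed.

Lemma cdvD f g x l l' : cdv f x l -> cdv g x l' -> cdv (fun y => f y + g y) x (l + l').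
Proof.
move=> [h1 h2] [h1' h2']; split.
  rewrite ReD; apply: (@dv_near _ (fun y => Re (f y) + Re (g y))); last exact: dvD.
  by apply: filterE => y; rewrite ReD.
rewrite ImD; apply: (@dv_near _ (fun y => Im (f y) + Im (g y))); last exact: dvD.
by apply: filterE => y; rewrite ImD.
Qed.

Lemma cdvM f g x l l' : cdv f x l -> cdv g x l' ->
  cdv (fun y => f y * g y) x (l * g x + f x * l').
Proof.
move=> [h1 h2] [h1' h2']; split.
  apply: (@dv_near _ (fun y => Re (f y) * Re (g y) - Im (f y) * Im (g y))).
    by apply: filterE => y; rewrite ReM.
  by apply: dv_eq (dvB (dvM h1 h1') (dvM h2 h2')) _; rewrite ReD !ReM; ring.
apply: (@dv_near _ (fun y => Re (f y) * Im (g y) + Im (f y) * Re (g y))).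
  by apply: filterE => y; rewrite ImM.
by apply: dv_eq (dvD (dvM h1 h2') (dvM h2 h1')) _; rewrite ImD !ImM; ring.
Qed.

Lemma cdvZ c f x l : cdv f x l -> cdv (fun y => c * f y) x (c * l).
Proof. by move=> hf; apply: cdv_eq (cdvM (cdv_cst c x) hf) _; rewrite mul0r add0r. Qed.

Lemma cdvN f x l : cdv f x l -> cdv (fun y => - f y) x (- l).
Proof.
move=> hf; rewrite -mulN1r; apply: cdv_ext (cdvZ (-1) hf) => y.
by rewrite mulN1r.
Qed.

Lemma cdvB f g x l l' : cdv f x l -> cdv g x l' -> cdv (fun y => f y - g y) x (l - l').
Proof. by move=> hf hg; exact: cdvD hf (cdvN hg). Qed.

Lemma cdv_real (f : R -> R) x (l : R) : dv f x l -> cdv (fun y => (f y)%:C) x l%:C.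
Proof. by move=> hf; split; [exact: hf|exact: dv_cst]. Qed.

Lemma cdv_shift f x y l : cdv f (x + y) l -> cdv (fun u : R => f (u + y)) x l.
Proof.
move=> [h1 h2]; split.
  apply: dv_eq (dv_comp (f := fun u => Re (f u)) (g := fun u => u + y) h1 (dvD (dv_id _) (dv_cst _ _))) _.
  by rewrite addr0 mulr1.
apply: dv_eq (dv_comp (f := fun u => Im (f u)) (g := fun u => u + y) h2 (dvD (dv_id _) (dv_cst _ _))) _.
by rewrite addr0 mulr1.
Qed.

Lemma cdv_mvt f g x y B : x <= y -> (forall u, x <= u <= y -> cdv f u (g u)) ->
  (forall u, x <= u <= y -> nc (g u) <= B) -> nc (f y - f x) <= 2 * B * (y - x).
Proof.
move=> xy hf hB; apply: le_trans (nc_le_ReIm _) _.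
rewrite ReD ReN ImD ImN.
have [u ux ->] := dv_mvt xy (fun u ux => (hf u ux).1).
have [v vx ->] := dv_mvt xy (fun u ux => (hf u ux).2).
rewrite !normrM (ger0_norm (_ : 0 <= y - x)) ?subr_ge0// -mulrDl.
rewrite ler_wpM2r ?subr_ge0// mulr_natl mulr2n lerD//.
  exact: le_trans (nc_Re _) (hB _ ux).
exact: le_trans (nc_Im _) (hB _ vx).
Qed.

Lemma nc_cexp z : nc (cexp z) = expR (Re z).
Proof. by rewrite /cexp ncM nc_expi mulr1 nc_real ger0_norm// expR_ge0. Qed.

Lemma cexpD z w : cexp (z + w) = cexp z * cexp w.
Proof. by rewrite /cexp ReD ImD expRD expiD rmorphM/=; ring. Qed.

Lemma cexp0 : cexp 0 = 1 :> R[i].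
Proof. by rewrite /cexp /= expR0 expi0 mul1r. Qed.

Lemma cdv_cexp z (f : R -> R) x (l : R) : dv f x l ->
  cdv (fun y => cexp (z * (f y)%:C)) x (z * l%:C * cexp (z * (f x)%:C)).
Proof.
move=> hf; case: z => p q.
have zE y : cexp ((p +i* q) * (f y)%:C) =
    (expR (p * f y) * cos (q * f y)) +i* (expR (p * f y) * sin (q * f y)).
  rewrite /cexp /= !mulr0 subr0 add0r; apply: complexP => /=; ring.
rewrite zE; apply: cdv_ext (fun y => esym (zE y)) _.
split.
  by apply: dv_eq (dvM (dv_exp (dvZ p hf)) (dv_cos (dvZ q hf))) _ => /=; ring.
by apply: dv_eq (dvM (dv_exp (dvZ p hf)) (dv_sin (dvZ q hf))) _ => /=; ring.
Qed.

Lemma cexp_lin_le z : nc (cexp z - 1) <= 2 * nc z * expR (nc z).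
Proof.
have := @cdv_mvt (fun t => cexp (z * t%:C)) (fun t => z * cexp (z * t%:C)) 0 1
  (nc z * expR (nc z)) ler01.
rewrite mulr1 mulr0 cexp0 subr0 mulr1 mulrA; apply.
  by move=> u _; apply: cdv_eq (cdv_cexp z (dv_id u)) _; rewrite mulr1.
move=> u /andP[u0 u1]; rewrite ncM ler_wpM2l ?nc_ge0// nc_cexp ler_expR.
rewrite ReM /= mulr0 subr0; apply: le_trans (ler_norm _) _.
rewrite normrM (ger0_norm u0); apply: le_trans (nc_Re z).
by rewrite ler_piMr.
Qed.

Lemma cexp_quad_le z : nc (cexp z - 1 - z) <= 4 * nc z ^+ 2 * expR (nc z).
Proof.
have := @cdv_mvt (fun t => cexp (z * t%:C) - z * t%:C) (fun t => z * (cexp (z * t%:C) - 1)) 0 1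
  (2 * nc z ^+ 2 * expR (nc z)) ler01.
rewrite mulr1 mulr0 cexp0 !subr0 mulr1 addrAC.
rewrite (_ : 2 * (2 * nc z ^+ 2 * expR (nc z)) = 4 * nc z ^+ 2 * expR (nc z)); last by ring.
apply.
  move=> u _; apply: cdv_eq.
    apply: cdvB; first exact: cdv_cexp (dv_id _).
    exact: cdvZ (cdv_real (dv_id _)).
  by rewrite mulr1; ring.
move=> u /andP[u0 u1].
have le : nc (z * u%:C) <= nc z by rewrite ncM nc_real ger0_norm// ler_piMr// nc_ge0.
rewrite ncM.
apply: (@le_trans _ _ (nc z * (2 * nc z * expR (nc z)))); last by rewrite le_eqVlt; apply/orP; left;
  apply/eqP; ring.
rewrite ler_wpM2l ?nc_ge0//; apply: le_trans (cexp_lin_le _) _.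
by rewrite ler_pM ?mulr_ge0 ?nc_ge0 ?expR_ge0 ?ler_expR// ler_wpM2l.
Qed.

(* x^(-s) and the remainders of its Taylor expansions of order 0 and 1 in s.  Their
   derivatives in x are combinations of the same functions at s + 1, so each
   difference in x gains a factor 1/x. *)
Definition npow s x := cexp (- s * (ln x)%:C).
Definition dpow s h x := npow (s + h) x - npow s x.
Definition rpow s h x := dpow s h x + h * (ln x)%:C * npow s x.

Lemma npowS s x : 0 < x -> npow (s + 1) x = npow s x * (x^-1)%:C.
Proof.
move=> x0; rewrite /npow opprD mulrDl cexpD; congr (_ * _).
by rewrite /cexp mulN1r ReN ImN /= oppr0 expi0 mulr1 expRN lnK.
Qed.

Lemma cdv_npow s x : 0 < x -> cdv (npow s) x (- s * npow (s + 1) x).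
Proof.
move=> x0; apply: cdv_eq (cdv_cexp (- s) (is_derive1_ln x0)) _.
by rewrite npowS// -/(npow s x); ring.
Qed.

Lemma cdv_dpow s h x : 0 < x ->
  cdv (dpow s h) x (- (s + h) * dpow (s + 1) h x - h * npow (s + 1) x).
Proof.
move=> x0; apply: cdv_eq (cdvB (cdv_npow (s + h) x0) (cdv_npow s x0)) _.
by rewrite /dpow (_ : s + h + 1 = s + 1 + h); ring.
Qed.

Lemma cdv_rpow s h x : 0 < x ->
  cdv (rpow s h) x (- s * rpow (s + 1) h x - h * dpow (s + 1) h x).
Proof.
move=> x0; have dl := cdvZ h (cdv_real (is_derive1_ln x0)).
apply: cdv_eq (cdvD (cdv_dpow s h x0) (cdvM dl (cdv_npow s x0))) _.
rewrite /rpow npowS//; ring.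
Qed.

Lemma nc_npow s x : nc (npow s x) = expR (- (Re s * ln x)).
Proof. by rewrite nc_cexp ReM ReN /= mulr0 subr0 mulNr. Qed.

Lemma dpowE s h x : dpow s h x = npow s x * (cexp (- h * (ln x)%:C) - 1).
Proof. by rewrite /dpow {1}/npow opprD mulrDl cexpD -/(npow s x); ring. Qed.

Lemma rpowE s h x : rpow s h x =
  npow s x * (cexp (- h * (ln x)%:C) - 1 - (- h * (ln x)%:C)).
Proof. by rewrite /rpow dpowE; ring. Qed.

Lemma le_expR4 y : 0 <= y -> y <= 4 * expR (y / 4).
Proof. by move=> y0; have := expR_ge1Dx (y / 4); lra. Qed.

Lemma sqr_le_expR4 y : 0 <= y -> y ^+ 2 <= 64 * expR (y / 4).
Proof.
move=> y0; have h : y / 8 <= expR (y / 8) by have := expR_ge1Dx (y / 8); lra.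
have -> : expR (y / 4) = expR (y / 8) ^+ 2.
  by rewrite expr2 -expRD; congr expR; lra.
have : (y / 8) ^+ 2 <= expR (y / 8) ^+ 2 by rewrite lerXn2r ?nnegrE ?expR_ge0//; lra.
by lra.
Qed.

Lemma nc_dpow_le s h x : nc h <= 1 / 4 -> 1 <= x ->
  nc (dpow s h x) <= 8 * nc h * expR (- ((Re s - 1 / 2) * ln x)).
Proof.
move=> h4 x1; have l0 : 0 <= ln x by exact: ln_ge0.
rewrite dpowE ncM nc_npow.
have E : nc (- h * (ln x)%:C) = nc h * ln x by rewrite ncM ncN nc_real ger0_norm.
have := cexp_lin_le (- h * (ln x)%:C); rewrite E => le.
have le2 : expR (nc h * ln x) <= expR (ln x / 4).
  by rewrite ler_expR; have := ler_wpM2r l0 h4; lra.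
have le3 := le_expR4 l0.
have -> : expR (- ((Re s - 1 / 2) * ln x)) =
  expR (- (Re s * ln x)) * (expR (ln x / 4) * expR (ln x / 4)).
  by rewrite -!expRD; congr expR; lra.
rewrite mulrCA ler_wpM2l ?expR_ge0//; apply: le_trans le _.
have e0 := expR_ge0 (ln x / 4); have n0 := nc_ge0 h.
apply: (@le_trans _ _ (2 * (nc h * ln x) * expR (ln x / 4))).
  by rewrite ler_wpM2l ?mulr_ge0.
rewrite (_ : 8 * nc h * (expR (ln x / 4) * expR (ln x / 4)) =
  2 * (nc h * (4 * expR (ln x / 4))) * expR (ln x / 4)); last by ring.
by rewrite ler_wpM2r// ler_wpM2l// ler_wpM2l.
Qed.

Lemma nc_rpow_le s h x : nc h <= 1 / 4 -> 1 <= x ->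
  nc (rpow s h x) <= 256 * nc h ^+ 2 * expR (- ((Re s - 1 / 2) * ln x)).
Proof.
move=> h4 x1; have l0 : 0 <= ln x by exact: ln_ge0.
rewrite rpowE ncM nc_npow.
have E : nc (- h * (ln x)%:C) = nc h * ln x by rewrite ncM ncN nc_real ger0_norm.
have := cexp_quad_le (- h * (ln x)%:C); rewrite E => le.
have le2 : expR (nc h * ln x) <= expR (ln x / 4).
  by rewrite ler_expR; have := ler_wpM2r l0 h4; lra.
have le3 := sqr_le_expR4 l0.
have -> : expR (- ((Re s - 1 / 2) * ln x)) =
  expR (- (Re s * ln x)) * (expR (ln x / 4) * expR (ln x / 4)).
  by rewrite -!expRD; congr expR; lra.
rewrite mulrCA ler_wpM2l ?expR_ge0//; apply: le_trans le _.
have e0 := expR_ge0 (ln x / 4); have n0 := nc_ge0 h.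
apply: (@le_trans _ _ (4 * (nc h * ln x) ^+ 2 * expR (ln x / 4))).
  by rewrite ler_wpM2l ?mulr_ge0 ?exprn_ge0 ?mulr_ge0.
rewrite (_ : 256 * nc h ^+ 2 * (expR (ln x / 4) * expR (ln x / 4)) =
  4 * (nc h ^+ 2 * (64 * expR (ln x / 4))) * expR (ln x / 4)); last by ring.
by rewrite ler_wpM2r// ler_wpM2l// exprMn ler_wpM2l// exprn_ge0.
Qed.

Lemma nc_npow_le s x : 1 <= x -> nc (npow s x) <= expR (- ((Re s - 1 / 2) * ln x)).
Proof.
by move=> x1; rewrite nc_npow ler_expR; have := ln_ge0 x1; lra.
Qed.

End ComplexPowers.

Section Differences.
Variable R : realType.
Implicit Types (t x y B K q : R) (z w l s h c : R[i]) (f g : R -> R[i]) (M : nat).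
Local Notation nc := (@Normc.normc R).
Local Notation Re := (@complex.Re R).
Local Notation Im := (@complex.Im R).

Definition fd f x := f (x + 1) - f x.
Definition fdn M f := iter M fd f.

Lemma fdnD M f g x : fdn M (fun y => f y + g y) x = fdn M f x + fdn M g x.
Proof.
elim: M x => [//|M ih] x; rewrite /fdn !iterS /fd -/(fdn M _) -/(fdn M _) -/(fdn M _) !ih.
by ring.
Qed.

Lemma fdnZ M c f x : fdn M (fun y => c * f y) x = c * fdn M f x.
Proof.
elim: M x => [//|M ih] x; rewrite /fdn !iterS /fd -/(fdn M _) -/(fdn M _) !ih.
by ring.
Qed.

Lemma cdv_fdn M f g : (forall x, 0 < x -> cdv f x (g x)) ->
  forall x, 0 < x -> cdv (fdn M f) x (fdn M g x).
Proof.
move=> hf; elim: M => [//|M ih] x x0; rewrite /fdn !iterS /fd -/(fdn M _) -/(fdn M _).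
by apply: cdvB (ih _ x0); apply: cdv_shift; apply: ih; lra.
Qed.

Definition decay q x : R := expR (- (q * ln x)).

Lemma decay_gt0 q x : 0 < decay q x. Proof. exact: expR_gt0. Qed.

Lemma decay_step q x y : 1 <= x -> x <= y <= x + 1 -> decay q y <= expR `|q| * decay q x.
Proof.
move=> x1 /andP[xy yx]; have x0 : 0 < x by lra.
have y0 : 0 < y by lra.
rewrite /decay -expRD ler_expR.
have l1 : 0 <= ln y - ln x by rewrite subr_ge0 ler_ln.
have l2 : ln y - ln x <= 1.
  rewrite -ln_div ?posrE//; apply: (@le_trans _ _ (y / x - 1)).
    have h : -1 < y / x - 1 by have := divr_gt0 y0 x0; lra.
    by have := le_ln1Dx h; rewrite addrC subrK.
  by rewrite lerBlDr ler_pdivrMr//; lra.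
have := ler_norm (- q); have := ler_norm q; rewrite normrN.
have := normr_ge0 q; nra.
Qed.

Lemma fd_bound f g q K x : 0 <= K -> (forall y, 0 < y -> cdv f y (g y)) ->
  (forall y, 1 <= y -> nc (g y) <= K * decay q y) -> 1 <= x ->
  nc (fd f x) <= 2 * expR `|q| * K * decay q x.
Proof.
move=> K0 hf hB x1; apply: le_trans (@cdv_mvt _ f g _ _ (expR `|q| * K * decay q x) _ _ _) _.
- by lra.
- by move=> u ux; apply: hf; lra.
- move=> u ux; apply: le_trans (hB u _) _; first lra.
  rewrite -mulrA mulrCA ler_wpM2l//; exact: decay_step.
- by rewrite le_eqVlt; apply/orP; left; apply/eqP; ring.
Qed.

Lemma fdn_bound M s : exists2 K, 0 <= K & forall h, nc h <= 1 / 4 -> forall x, 1 <= x ->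
  [/\ nc (fdn M (npow s) x) <= K * decay (Re s + M%:R - 1 / 2) x,
      nc (fdn M (dpow s h) x) <= K * nc h * decay (Re s + M%:R - 1 / 2) x &
      nc (fdn M (rpow s h) x) <= K * nc h ^+ 2 * decay (Re s + M%:R - 1 / 2) x].
Proof.
elim: M s => [|M ih] s.
  exists 256 => // h h4 x x1; rewrite addr0 /decay.
  have e0 := expR_ge0 (- ((Re s - 1 / 2) * ln x)); have h0 := nc_ge0 h.
  split.
  - by apply: le_trans (nc_npow_le _ x1) _; lra.
  - apply: le_trans (nc_dpow_le _ h4 x1) _.
    by rewrite ler_wpM2r// ler_wpM2r//; lra.
  - exact: nc_rpow_le.
have [K K0 HK] := ih (s + 1).
set q := Re s + M.+1%:R - 1 / 2.
have qE : Re (s + 1) + M%:R - 1 / 2 = q by rewrite ReD /q -natr1 /=; ring.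
rewrite qE in HK.
exists (2 * expR `|q| * ((nc s + 2) * K)).
  by rewrite !mulr_ge0 ?expR_ge0 ?addr_ge0 ?nc_ge0.
move=> h h4 x x1; have h0 := nc_ge0 h; have s0 := nc_ge0 s.
have sh : nc (- (s + h)) <= nc s + 1 by rewrite ncN; apply: le_trans (ncD _ _) _; lra.
split; rewrite /fdn iterS -/(fdn M _).
- apply: (@fd_bound _ (fdn M (fun y => - s * npow (s + 1) y))) => //.
  + by rewrite mulr_ge0 ?addr_ge0.
  + by apply: cdv_fdn => y; exact: cdv_npow.
  move=> y y1; rewrite fdnZ ncM ncN -mulrA ler_pM ?nc_ge0//; first lra.
  by have [] := HK h h4 y y1.
- rewrite (_ : 2 * expR `|q| * ((nc s + 2) * K) * nc h = 2 * expR `|q| * ((nc s + 2) * K * nc h));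
  last by ring.
  apply: (@fd_bound _ (fdn M (fun y => - (s + h) * dpow (s + 1) h y + - h * npow (s + 1) y))) => //.
  + by rewrite !mulr_ge0 ?addr_ge0.
  + by apply: cdv_fdn => y y0; apply: cdv_eq (cdv_dpow s h y0) _; ring.
  move=> y y1; have [b1 b2 _] := HK h h4 y y1.
  rewrite fdnD !fdnZ; apply: le_trans (ncD _ _) _; rewrite !ncM ncN [nc (- h)]ncN -ncN.
  have d0 := ltW (decay_gt0 q y).
  have e1 : nc (- (s + h)) * nc (fdn M (dpow (s + 1) h) y) <= (nc s + 1) * (K * nc h * decay q y).
    by rewrite ler_pM ?nc_ge0.
  have e2 : nc h * nc (fdn M (npow (s + 1)) y) <= nc h * (K * decay q y) by rewrite ler_wpM2l.
  by move: e1 e2; rewrite ncN; lra.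
- rewrite (_ : 2 * expR `|q| * ((nc s + 2) * K) * nc h ^+ 2 =
  2 * expR `|q| * ((nc s + 2) * K * nc h ^+ 2)); last by ring.
  apply: (@fd_bound _ (fdn M (fun y => - s * rpow (s + 1) h y + - h * dpow (s + 1) h y))) => //.
  + by rewrite !mulr_ge0 ?addr_ge0 ?exprn_ge0.
  + by apply: cdv_fdn => y y0; apply: cdv_eq (cdv_rpow s h y0) _; ring.
  move=> y y1; have [_ b2 b3] := HK h h4 y y1.
  rewrite fdnD !fdnZ; apply: le_trans (ncD _ _) _; rewrite !ncM !ncN.
  have d0 := ltW (decay_gt0 q y).
  have e1 : nc s * nc (fdn M (rpow (s + 1) h) y) <= nc s * (K * nc h ^+ 2 * decay q y).
    by rewrite ler_wpM2l.
  have e2 : nc h * nc (fdn M (dpow (s + 1) h) y) <= nc h * (K * nc h * decay q y) by rewrite ler_wpM2l.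
  have e3 : 0 <= K * nc h ^+ 2 * decay q y by rewrite !mulr_ge0 ?exprn_ge0.
  by move: e1 e2 e3; lra.
Qed.

Lemma decay2 q x : 2 <= q -> 1 <= x -> decay q x <= x ^- 2.
Proof.
move=> q2 x1; have x0 : 0 < x by lra.
have l0 := ln_ge0 x1.
rewrite -[leRHS](lnK (x := x ^- 2)); last by rewrite posrE invr_gt0 exprn_gt0.
rewrite ler_expR lnV ?posrE ?exprn_gt0// lnXn// -mulr_natl lerN2.
by rewrite ler_wpM2r.
Qed.

End Differences.

Section Summation.
Variable R : realType.
Implicit Types (t x y B K q : R) (z w l s h c : R[i]) (f g : R -> R[i]) (M n N : nat).
Local Notation nc := (@Normc.normc R).
Local Notation Re := (@complex.Re R).
Local Notation Im := (@complex.Im R).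

Definition chi3r n : R := match (n %% 3)%N with 1%N => 1 | 2%N => -1 | _ => 0 end.

(* Successive periodic antidifferences of the character, which has mean 0. *)
Fixpoint antichi M n : R :=
  if M is M'.+1 then (antichi M' n.+1 - antichi M' n) / 3 else chi3r n.

Lemma antichi_per M n : antichi M (n + 3) = antichi M n.
Proof.
elim: M n => [|M ih] n /=; first by rewrite /chi3r modnDr.
by rewrite -addSn !ih.
Qed.

Lemma antichi_sum M n : antichi M n + antichi M n.+1 + antichi M n.+2 = 0.
Proof.
elim: M n => [|M ih] n /=; last first.
  have := ih n; have := ih n.+1; rewrite -addn3 antichi_per; lra.
have h k : chi3r (n + k) = chi3r (n %% 3 + k) by rewrite /chi3r modnDml.
rewrite -[n.+2]addn2 -[n.+1]addn1 -[X in chi3r X]addn0 !h.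
have : (n %% 3 < 3)%N by rewrite ltn_mod.
by case: (n %% 3)%N => [|[|[|]]]//= _; rewrite /chi3r/=; ring.
Qed.

Lemma antichiE M n : antichi M n.+1 = antichi M.+1 n - antichi M.+1 n.+1.
Proof. by have := antichi_sum M n; rewrite /=; lra. Qed.

Lemma antichi_le1 M n : `|antichi M n| <= 1.
Proof.
elim: M n => [|M ih] n /=.
  rewrite /chi3r; case: (n %% 3)%N => [|[|[|k]]]; rewrite ?normr0 ?normrN ?normr1//.
have := ih n; have := ih n.+1; rewrite normrM normfV (ger0_norm (_ : 0 <= 3))//.
have := ler_normB (antichi M n.+1) (antichi M n); lra.
Qed.

Definition psum M f N : R[i] := \sum_(k < N) (antichi M k.+1)%:C * f k.+1%:R.

Lemma psum_step M f N : psum M f N =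
  (antichi M.+1 0)%:C * f 1 - (antichi M.+1 N)%:C * f N.+1%:R + psum M.+1 (fd f) N.
Proof.
elim: N => [|N ih]; first by rewrite /psum !big_ord0 subrr addr0.
rewrite /psum !big_ord_recr -/(psum M f N) -/(psum M.+1 (fd f) N) ih antichiE.
by rewrite rmorphB /= /fd -[N.+2%:R]natr1; ring.
Qed.

Definition bdry M f N : R[i] := \sum_(j < M) (antichi j.+1 N)%:C * fdn j f N.+1%:R.

Lemma psum_fdn M f N : psum 0 f N = bdry M f 0 - bdry M f N + psum M (fdn M f) N.
Proof.
elim: M => [|M ih]; first by rewrite /bdry !big_ord0 subrr add0r.
have S n : bdry M.+1 f n = bdry M f n + (antichi M.+1 n)%:C * fdn M f n.+1%:R.
  by rewrite /bdry big_ord_recr.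
rewrite ih psum_step [fdn M.+1 f]iterS -/(fdn M f) !S.
by move: (antichi M.+1 0)%:C (antichi M.+1 N)%:C => a b; ring.
Qed.

(* [M] summations by parts turn the terms chi(n) f(n) into
   [antichi M n * fdn M f n], whose series converges for large [M]. *)
Definition summable_at M f K := forall n, nc (fdn M f n.+1%:R) <= K / n.+1%:R ^+ 2.

Lemma ccvg_psum M f K : summable_at M f K ->
  exists2 l, ccvg (psum M (fdn M f)) l & nc l <= 4 * K.
Proof.
move=> fK; have K0 : 0 <= K by have := fK 0%N; rewrite expr1n divr1; exact/le_trans/nc_ge0.
have [||l ul lK] := @ccvg_series R (fun k => (antichi M k.+1)%:C * fdn M f k.+1%:R) (fun n => K * (2 / n.+1%:R)).
- move=> n; rewrite ncM nc_real.
  apply: (@le_trans _ _ (1 * (K / n.+1%:R ^+ 2))).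
    by rewrite ler_pM ?nc_ge0 ?antichi_le1.
  rewrite mul1r -mulrBr ler_wpM2l//.
  have k0 : 0 < n.+1%:R :> R by rewrite ltr0n.
  have -> : 2 / n.+1%:R - 2 / n.+2%:R = 2 / (n.+1%:R * (n.+1%:R + 1)) :> R.
    by rewrite -[n.+2%:R]natr1; field; rewrite !gt_eqF// addr_gt0.
  have : 1 <= n.+1%:R :> R by rewrite ler1n.
  move: (n.+1%:R : R) k0 => z z0 z1.
  rewrite ler_pdivlMr ?mulr_gt0 ?addr_gt0// mulrC ler_pdivrMr ?exprn_gt0//.
  nra.
- rewrite -[X in _ --> X](mulr0 K); apply: cvgMr; exact: cvg_2Vn.
by exists l => //; move: lK; rewrite divr1; lra.
Qed.

Definition regsum M f : R[i] := bdry M f 0 +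
  xget 0 [set l | ccvg (psum M (fdn M f)) l].

Lemma regsum_cvg M f K : summable_at M f K ->
  ccvg (fun N => psum 0 f N + bdry M f N) (regsum M f).
Proof.
move=> /ccvg_psum[l ul _]; rewrite /regsum.
case: xgetP => [l' _ /= ul'|/(_ l)/=]; last by [].
apply: ccvg_eq (ccvgD (ccvg_cst (bdry M f 0)) ul') => N /=.
by rewrite (psum_fdn M); ring.
Qed.

Lemma regsumE M f K l : summable_at M f K ->
  ccvg (fun N => psum 0 f N + bdry M f N) l -> regsum M f = l.
Proof. by move=> /regsum_cvg h1 h2; exact: ccvg_unique h1 h2. Qed.

End Summation.

Section LFunction.
Variable R : realType.
Implicit Types (t x y B K q : R) (z w l s h c : R[i]) (f g : R -> R[i]) (M n N j : nat).
Local Notation nc := (@Normc.normc R).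
Local Notation Re := (@complex.Re R).
Local Notation Im := (@complex.Im R).

Definition lnpow s x := (ln x)%:C * npow s x.

Lemma fdn_eq M f g x : (forall y, f y = g y) -> fdn M f x = fdn M g x.
Proof. by move=> /funext ->. Qed.

Lemma decay_mono q q' x : q <= q' -> 1 <= x -> decay q' x <= decay q x.
Proof.
move=> qq x1; rewrite ler_expR lerN2 ler_wpM2r//; exact: ln_ge0.
Qed.

Lemma decay_cvg0 q : 1 / 2 <= q -> (fun n => decay q n.+1%:R) @ \oo --> (0 : R).
Proof.
move=> q2; apply/cvgrPdist_le => e e0.
have e2 : 0 < e ^+ 2 by rewrite exprn_gt0.
have /cvgrPdist_le/(_ _ e2) := @cvg_harmonic R.
apply: filterS => n; rewrite !sub0r !normrN /harmonic /=.
have n0 : 0 < n.+1%:R :> R by rewrite ltr0n.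
rewrite ger0_norm ?invr_ge0// => le.
rewrite ger0_norm ?(ltW (decay_gt0 _ _))//.
apply: le_trans (decay_mono q2 _) _; first by rewrite ler1n.
rewrite -ler_sqr ?nnegrE ?(ltW (decay_gt0 _ _)) ?(ltW e0)//; apply: le_trans le.
rewrite /decay expr2 -expRD -[leRHS](lnK (x := n.+1%:R^-1)) ?posrE ?invr_gt0//.
by rewrite ler_expR lnV ?posrE//; lra.
Qed.

Lemma ccvg_fdn0 j f K q : (forall x, 1 <= x -> nc (fdn j f x) <= K * decay q x) ->
  1 / 2 <= q -> ccvg (fun n => fdn j f n.+1%:R) 0.
Proof.
move=> fK q2; apply: ccvg_nc0.
apply: (@squeeze_cvgr _ _ _ _ (fun=> 0) (fun n => K * decay q n.+1%:R)).
- by apply: nearW => n /=; rewrite nc_ge0 fK// ler1n.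
- exact: cvg_cst.
- by rewrite -[X in _ --> X](mulr0 K); apply: cvgMr; exact: decay_cvg0.
Qed.

Lemma ccvg_bounded0 (a : nat -> R) (u : nat -> R[i]) : (forall n, `|a n| <= 1) ->
  ccvg u 0 -> ccvg (fun n => (a n)%:C * u n) 0.
Proof.
move=> a1 [h1 h2]; split => /=.
- apply/norm_cvg0P; apply: (@squeeze_cvgr _ _ _ _ (fun=> 0) (fun n => `|Re (u n)|)).
  + apply: nearW => n /=; rewrite normr_ge0 ReM /= mul0r subr0 normrM.
    by rewrite ler_piMl.
  + exact: cvg_cst.
  + by apply/norm_cvg0P; exact: h1.
- apply/norm_cvg0P; apply: (@squeeze_cvgr _ _ _ _ (fun=> 0) (fun n => `|Im (u n)|)).
  + apply: nearW => n /=; rewrite normr_ge0 ImM /= mul0r addr0 normrM.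
    by rewrite ler_piMl.
  + exact: cvg_cst.
  + by apply/norm_cvg0P; exact: h2.
Qed.

Lemma bdryS M f N : bdry M.+1 f N = bdry M f N + (antichi R M.+1 N)%:C * fdn M f N.+1%:R.
Proof. by rewrite /bdry big_ord_recr. Qed.

Lemma bdry_cvg0 M f : (forall j, (j < M)%N -> ccvg (fun n => fdn j f n.+1%:R) 0) ->
  ccvg (bdry M f) 0.
Proof.
elim: M => [|M ih] H.
  by apply: ccvg_eq (ccvg_cst 0) => n; rewrite /bdry big_ord0.
rewrite -[0]addr0; apply: ccvg_eq (ccvgD (ih _) (ccvg_bounded0 (fun n => antichi_le1 R M.+1 n) (H M _))) => //.
- by move=> n; rewrite bdryS.
- by move=> j jM; apply: H; exact: ltnW.
Qed.

Lemma summable_cvg0 M f K : summable_at M f K -> ccvg (fun n => fdn M f n.+1%:R) 0.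
Proof.
move=> fK; apply: ccvg_nc0.
have K0 : 0 <= K by have := fK 0%N; rewrite expr1n divr1; exact/le_trans/nc_ge0.
apply: (@squeeze_cvgr _ _ _ _ (fun=> 0) (fun n => K * n.+1%:R^-1)).
- apply: nearW => n /=; rewrite nc_ge0; apply: le_trans (fK n) _.
  rewrite ler_wpM2l// lef_pV2 ?posrE ?exprn_gt0 ?ltr0n//.
  by rewrite -[leLHS]expr1 ler_weXn2l// ler1n.
- exact: cvg_cst.
- by rewrite -[X in _ --> X](mulr0 K); apply: cvgMr; exact: cvg_harmonic.
Qed.

Lemma regsumS M f K K' : summable_at M f K -> summable_at M.+1 f K' ->
  regsum M.+1 f = regsum M f.
Proof.
move=> h h'; apply: (regsumE h'); rewrite -[regsum M f]addr0.
apply: ccvg_eq (ccvgD (regsum_cvg h)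
  (ccvg_bounded0 (fun n => antichi_le1 R M.+1 n) (summable_cvg0 h))) => n /=.
by rewrite bdryS addrA.
Qed.

Lemma psumD M f g N : psum M (fun x => f x + g x) N = psum M f N + psum M g N.
Proof. by rewrite /psum -big_split /=; apply: eq_bigr => k _; rewrite mulrDr. Qed.

Lemma psumZ M c f N : psum M (fun x => c * f x) N = c * psum M f N.
Proof. by rewrite /psum mulr_sumr; apply: eq_bigr => k _; rewrite mulrCA. Qed.

Lemma bdryD M f g N : bdry M (fun x => f x + g x) N = bdry M f N + bdry M g N.
Proof. by rewrite /bdry -big_split /=; apply: eq_bigr => k _; rewrite fdnD mulrDr. Qed.

Lemma bdryZ M c f N : bdry M (fun x => c * f x) N = c * bdry M f N.
Proof. by rewrite /bdry mulr_sumr; apply: eq_bigr => k _; rewrite fdnZ mulrCA. Qed.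

Lemma summableD M f g K K' : summable_at M f K -> summable_at M g K' ->
  summable_at M (fun x => f x + g x) (K + K').
Proof. by move=> hf hg n; rewrite fdnD mulrDl; apply: le_trans (ncD _ _) _; exact: lerD. Qed.

Lemma summableZ M c f K : summable_at M f K -> summable_at M (fun x => c * f x) (nc c * K).
Proof. by move=> hf n; rewrite fdnZ ncM -mulrA ler_wpM2l ?nc_ge0. Qed.

Lemma regsumD M f g K K' : summable_at M f K -> summable_at M g K' ->
  regsum M (fun x => f x + g x) = regsum M f + regsum M g.
Proof.
move=> hf hg; apply: (regsumE (summableD hf hg)).
apply: ccvg_eq (ccvgD (regsum_cvg hf) (regsum_cvg hg)) => n /=.
by rewrite psumD bdryD; ring.
Qed.

Lemma regsumZ M c f K : summable_at M f K ->
  regsum M (fun x => c * f x) = c * regsum M f.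
Proof.
move=> hf; apply: (regsumE (summableZ c hf)).
apply: ccvg_eq (ccvgZ c (regsum_cvg hf)) => n /=.
by rewrite psumZ bdryZ; ring.
Qed.

Lemma nc_regsum M f K : summable_at M f K ->
  nc (regsum M f) <= \sum_(j < M) nc (fdn j f 1) + 4 * K.
Proof.
move=> fK; have [l ul lK] := ccvg_psum fK.
have -> : regsum M f = bdry M f 0 + l.
  apply: (regsumE fK); apply: ccvg_eq (ccvgD (ccvg_cst (bdry M f 0)) ul) => n /=.
  by rewrite (psum_fdn M); ring.
apply: le_trans (ncD _ _) _; rewrite lerD// /bdry.
elim/big_ind2 : _ => //.
- by rewrite le_eqVlt nc_eq0 eqxx.
- by move=> z1 b1 z2 b2 h1 h2; apply: le_trans (ncD _ _) _; exact: lerD.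
- by move=> j _; rewrite ncM nc_real ler_piMl ?nc_ge0 ?antichi_le1.
Qed.

Lemma summable_bounds M s : 5 / 2 <= Re s + M%:R ->
  exists2 K, 0 <= K & forall h, nc h <= 1 / 4 ->
  [/\ summable_at M (npow s) K, summable_at M (dpow s h) (K * nc h) &
      summable_at M (rpow s h) (K * nc h ^+ 2)].
Proof.
move=> sM; have [K K0 HK] := fdn_bound M s; exists K => // h h4.
have d n : decay (Re s + M%:R - 1 / 2) n.+1%:R <= n.+1%:R ^- 2.
  by apply: decay2; [lra|rewrite ler1n].
split=> n; have [|b1 b2 b3] := HK h h4 n.+1%:R; rewrite ?ler1n//.
- by apply: le_trans b1 _; rewrite ler_wpM2l.
- by apply: le_trans b2 _; rewrite ler_wpM2l// mulr_ge0 ?nc_ge0.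
- by apply: le_trans b3 _; rewrite ler_wpM2l// mulr_ge0 ?exprn_ge0 ?nc_ge0.
Qed.

Let nc0 : nc 0 <= 1 / 4.
Proof. by have /eqP -> : nc 0 == 0 by rewrite nc_eq0. Qed.

Lemma summable_npow M s : 5 / 2 <= Re s + M%:R -> exists K, summable_at M (npow s) K.
Proof. by move=> /summable_bounds[K _ H]; exists K; have [] := H 0 nc0. Qed.

Let h14 : R[i] := (1 / 4)%:C.
Let nc14 : nc h14 = 1 / 4.
Proof. by rewrite nc_real ger0_norm. Qed.

Lemma lnpowE s x : lnpow s x = h14^-1 * rpow s h14 x + (- h14^-1) * dpow s h14 x.
Proof. by rewrite /lnpow /rpow; field. Qed.

Lemma summable_lnpow M s : 5 / 2 <= Re s + M%:R -> exists K, summable_at M (lnpow s) K.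
Proof.
move=> /summable_bounds[K _ H]; have [|_ h2 h3] := H h14; first by rewrite nc14.
eexists => n; rewrite (fdn_eq _ _ (lnpowE s)).
exact: summableD (summableZ _ h3) (summableZ _ h2) n.
Qed.

Lemma regsum_npow_le s M M' : 5 / 2 <= Re s + M%:R -> (M <= M')%N ->
  regsum M' (npow s) = regsum M (npow s).
Proof.
move=> sM; elim: M' => [|M' ih]; first by rewrite leqn0 => /eqP ->.
rewrite leq_eqVlt => /predU1P[->//|]; rewrite ltnS => MM'.
have MR : M%:R <= M'%:R :> R by rewrite ler_nat.
have [|K hK] := @summable_npow M' s; first by lra.
have [|K' hK'] := @summable_npow M'.+1 s; first by rewrite -natr1; lra.
by rewrite (regsumS hK hK') ih.
Qed.

Definition Lorder s : nat := (Num.truncn `|3 - Re s|).+1.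

Lemma LorderP s : 3 <= Re s + (Lorder s)%:R.
Proof.
have := truncnS_gt `|3 - Re s|; have := ler_norm (3 - Re s).
rewrite /Lorder; lra.
Qed.

Definition Lchi s : R[i] := regsum (Lorder s) (npow s).

Lemma LchiE s M : 5 / 2 <= Re s + M%:R -> Lchi s = regsum M (npow s).
Proof.
move=> sM; have h := LorderP s; rewrite /Lchi.
have [le|/ltnW le] := leqP (Lorder s) M.
  by rewrite (@regsum_npow_le s _ _ _ le)//; lra.
by rewrite (@regsum_npow_le s _ _ _ le).
Qed.

Definition Lchi' s : R[i] := - regsum (Lorder s).+1 (lnpow s).

Lemma Lchi_quad s : exists2 C : R, 0 <= C & forall h, nc h <= 1 / 4 ->
  nc (Lchi (s + h) - Lchi s - h * Lchi' s) <= C * nc h ^+ 2.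
Proof.
have hM := LorderP s; set M := (Lorder s).+1.
have sM : 7 / 2 <= Re s + M%:R by rewrite /M -natr1; lra.
have [|K K0 HK] := @summable_bounds M s; first lra.
have /boolp.choice[k Hk] : forall j, exists Kj, 0 <= Kj /\ forall h, nc h <= 1 / 4 ->
    nc (fdn j (rpow s h) 1) <= Kj * nc h ^+ 2.
  move=> j; have [Kj Kj0 HKj] := fdn_bound j s; exists Kj; split => // h h4.
  have [_ _] := HKj h h4 1 (lexx 1).
  by rewrite /decay ln1 mulr0 oppr0 expR0 mulr1.
exists (\sum_(j < M) k j + 4 * K).
  by rewrite addr_ge0 ?mulr_ge0// sumr_ge0// => j _; have [] := Hk j.
move=> h h4; have [s1 _ s3] := HK h h4.
have Reh : - (1 / 4) <= Re h by have := nc_Re h; rewrite ler_norml; lra.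
have [|Kh sh] := @summable_npow M (s + h); first by rewrite ReD; lra.
have [|Kl sl] := @summable_lnpow M s; first lra.
have -> : Lchi (s + h) - Lchi s - h * Lchi' s = regsum M (rpow s h).
  rewrite (@LchiE (s + h) M) ?ReD; last lra.
  rewrite (@LchiE s M); last lra.
  have -> : rpow s h = fun x => npow (s + h) x + (-1 * npow s x + h * lnpow s x).
    by apply/funext => x; rewrite /rpow /dpow /lnpow; ring.
  rewrite (regsumD sh (summableD (summableZ (-1) s1) (summableZ h sl))).
  rewrite (regsumD (summableZ (-1) s1) (summableZ h sl)) (regsumZ _ s1) (regsumZ _ sl).
  by rewrite /Lchi' -/M; ring.
apply: le_trans (nc_regsum s3) _; rewrite [leRHS]mulrDl mulr_suml.
apply: lerD; last by rewrite mulrA.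
by apply: ler_sum => j _; have [_] := Hk j; apply.
Qed.

Lemma Lchi_derive s :
  (h^-1 *: (Lchi (h *: 1 + s) - Lchi s) : R[i]^o) @[h --> (0 : R[i]^o)^'] --> (Lchi' s : R[i]^o).
Proof.
have [C C0 HC] := Lchi_quad s.
apply/cvgrPdist_le => -[e e']; rewrite ltcE /= => /andP[/eqP -> e0].
pose d := Num.min (1 / 4) (e / (C + 1)).
have d0 : 0 < d by rewrite lt_min !divr_gt0//; lra.
have d0C : 0 < d%:C by rewrite ltcR.
have H1 := @nbhs_dnbhs_neq (R[i]^o) 0.
have H2 := @dnbhs0_lt _ (R[i]^o) _ d0C.
near=> h.
have h0 : h != 0 by near: h.
have hd : nc h < d by rewrite -ltcR -normC_nc; near: h.
have [hd4 hdC] : nc h < 1 / 4 /\ nc h < e / (C + 1) by move: hd; rewrite lt_min => /andP[].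
rewrite normC_nc -[e +i* 0]/(e%:C) lecR.
have -> : Lchi' s - h^-1 *: (Lchi (h *: 1 + s) - Lchi s) =
    - (h^-1 * (Lchi (s + h) - Lchi s - h * Lchi' s)).
  rewrite -[h *: 1]/(h * 1) mulr1 [h + s]addrC -[_ *: _]/(_ * _).
  by rewrite [in RHS]mulrBr mulKf//; ring.
rewrite ncN ncM ncV mulrC ler_pdivrMr ?nc_gt0//.
apply: le_trans (HC h (ltW hd4)) _; rewrite expr2 mulrA ler_wpM2r ?nc_ge0//.
apply: (@le_trans _ _ (C * (e / (C + 1)))); first by rewrite ler_wpM2l// ltW.
by rewrite mulrA ler_pdivrMr; nra.
Unshelve. all: by end_near. Qed.

Lemma Lchi_dirichlet : is_dirichletL_chi3 (Lchi : R[i]^o -> R[i]^o).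
Proof.
split=> s.
  by apply/cvg_ex; exists (Lchi' s); exact: Lchi_derive.
move=> s1.
apply: ccvg_cvg.
have hM := LorderP s; set M := Lorder s in hM.
have [|K hK] := @summable_npow M s; first lra.
have bd : ccvg (bdry M (npow s)) 0.
  apply: bdry_cvg0 => j _; have [Kj Kj0 HKj] := fdn_bound j s.
  apply: (@ccvg_fdn0 _ _ Kj (Re s + j%:R - 1 / 2)).
    by move=> x x1; have [] := HKj 0 nc0 x x1.
  by have : 0 <= j%:R :> R by []; lra.
rewrite -[Lchi s]addr0 -[X in _ + X](mulr0 (-1)).
apply: ccvg_eq (ccvgD (regsum_cvg hK) (ccvgZ (-1) bd)) => N /=.
rewrite seriesEord /=; transitivity (psum 0 (npow s) N); first by ring.
apply: eq_bigr => k _; congr (_ * _).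
by rewrite /= /chi3r /chi3; case: (k.+1 %% 3)%N => [|[|[|n]]]//=; rewrite ?rmorphN.
Qed.

End LFunction.

(** * The derivative at -1 *)

Section CosineProduct.
Variable R : realType.
Implicit Types (t x y : R) (k n m N : nat).

Fixpoint wallis k : R :=
  if k is k'.+1 then wallis k' * (2 * k%:R / (2 * k%:R + 1)) else 1.

Lemma wallis_gt0 k : 0 < wallis k.
Proof.
elim: k => [|k ih] /=; first exact: ltr01.
by rewrite mulr_gt0// divr_gt0// ?mulr_gt0 ?addr_gt0 ?mulr_gt0 ?ltr0n.
Qed.

Definition cos_prod k y : R := \prod_(j < k) (1 - y ^+ 2 / (2 * j%:R + 1) ^+ 2).

Lemma cos_factor_gt0 k y : 0 <= y < 1 -> 0 < 1 - y ^+ 2 / (2 * k%:R + 1) ^+ 2.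
Proof.
move=> /andP[y0 y1]; have k0 : 0 <= k%:R :> R by [].
have k1 : 0 < (2 * k%:R + 1 : R) ^+ 2 by rewrite exprn_gt0//; lra.
by rewrite subr_gt0 ltr_pdivrMr// mul1r ltr_sqr ?nnegrE//; lra.
Qed.

Lemma cos_prod_gt0 k y : 0 <= y < 1 -> 0 < cos_prod k y.
Proof. by move=> y01; rewrite prodr_gt0// => j _; exact: cos_factor_gt0. Qed.

(* For J_n, the integral of cos(yt) cos^n t over [0, pi/2], the derivative of
   n cos(yt) cos^(n-1) t sin t - y sin(yt) cos^n t gives Wallis' recursion
   (n^2 - y^2) J_n = n (n - 1) J_(n-2). *)
Lemma wallis_primitive k y : 0 <= y < 1 ->
  exists K : R -> R, [/\ forall t, dv K t (cos (y * t) * cos t ^+ k.*2.+1), K 0 = 0 &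
    K (pi / 2) = wallis k * cos (y * (pi / 2)) / cos_prod k.+1 y].
Proof.
move=> y01; elim: k => [|k [K [dK K0 Kpi]]].
  have y1 : 1 + y != 0 by lra.
  have y1' : 1 - y != 0 by lra.
  have y1'' : 1 - y ^+ 2 != 0 
    by rewrite (_ : 1 - y ^+ 2 = (1 + y) * (1 - y)) ?mulf_neq0//; ring.
  exists (fun t => (1 + y)^-1 / 2 * sin ((1 + y) * t) + (1 - y)^-1 / 2 * sin ((1 - y) * t)); split.
  - move=> t; apply: dv_eq (dvD (dvZ _ (dv_sin (dvZ _ (dv_id t))))
      (dvZ _ (dv_sin (dvZ _ (dv_id t))))) _.
    rewrite expr1 !mulrDl !mul1r mulNr cosB cosD.
    by field; rewrite y1 y1'.
  - by rewrite !mulr0 sin0 !mulr0 addr0.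
  - rewrite /cos_prod big_ord1 /= mulr0 add0r expr1n divr1 (mulrDl 1 y) (mulrDl 1 (- y)) !mul1r mulNr.
    rewrite sinB sinD sin_pihalf cos_pihalf.
    by move: (y * _) => u; field; rewrite y1 y1' y1''.
have y2 : k.+1.*2.+1%:R ^+ 2 - y ^+ 2 != 0 :> R.
  have n0 : 0 <= k.+1%:R :> R by [].
  rewrite gt_eqF// -[k.+1.*2.+1%:R]natr1 -mul2n natrM subr_gt0 ltr_sqr ?nnegrE; lra.
set n : R := k.+1.*2.+1%:R in y2.
have nE : n = 2 * k.+1%:R + 1 by rewrite /n -natr1 -mul2n natrM.
exists (fun t => (n ^+ 2 - y ^+ 2)^-1 * (n * (cos (y * t) * (cos t ^+ k.+1.*2 * sin t))
   - y * (sin (y * t) * cos t ^+ k.+1.*2.+1) + n * (n - 1) * K t)); split.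
- move=> t; have d := dvZ y (dv_id t).
  have dc := dv_cos (dv_id t); have ds := dv_sin (dv_id t).
  apply: dv_eq (dvZ _ (dvD (dvB (dvZ _ (dvM (dv_cos d) (dvM (dvX _ dc) ds)))
    (dvZ _ (dvM (dv_sin d) (dvX _ dc)))) (dvZ _ (dK t)))) _.
  rewrite -/n.
  have -> : k.+1.*2%:R = n - 1 :> R by rewrite /n -natr1; ring.
  rewrite doubleS /= !(exprS (cos t)).
  have s2 : sin t * sin t = 1 - cos t * cos t.
    by rewrite -!expr2 -(cos2Dsin2 t); ring.
  apply: (mulfI y2); rewrite mulVKf//.
  move: s2; set C := cos t; set S := sin t; set q := C ^+ _; clearbody q => s2.
  transitivity (cos (y * t) * ((n ^+ 2 - y ^+ 2) * (C * (C * (C * q)))) +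
     n * (n - 1) * cos (y * t) * (C * q) * (1 - C * C - S * S)); first by ring.
  by rewrite s2; ring.
- by rewrite mulr0 sin0 K0 !(mul0r, mulr0) subrr addr0 mulr0.
- rewrite cos_pihalf sin_pihalf Kpi /cos_prod [in RHS]big_ord_recr /=.
  rewrite -/(cos_prod k.+1 y) doubleS !(exprS (0 : R)) !mul0r !mulr0 subrr add0r -nE.
  have p0 : cos_prod k.+1 y != 0 by rewrite gt_eqF// cos_prod_gt0.
  have n0 : n != 0 by rewrite pnatr_eq0.
  have f0 : 1 - y ^+ 2 / (n * n) != 0.
    by have := @cos_factor_gt0 k.+1 y y01; rewrite -nE expr2 => h; rewrite gt_eqF.
  have -> : 2 * k.+1%:R = n - 1 by rewrite nE; ring.
  rewrite expr2 in y2 *.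
  move: (cos_prod _ _) (wallis _) (cos _) p0 => P W C p0.
  field; rewrite n0 p0/= -?expr2.
  by rewrite ?expr2 ?y2.
Qed.

Lemma cos_prod0 k : cos_prod k 0 = 1.
Proof. by rewrite /cos_prod big1// => j _; rewrite expr0n mul0r subr0. Qed.

Lemma mulr_cos_le_sin t : 0 <= t <= pi / 2 -> t * cos t <= sin t.
Proof.
move=> /andP[t0 tpi]; rewrite -subr_ge0.
have -> : 0 = sin (0 : R) - 0 * cos (0 : R) by rewrite sin0 mul0r subr0.
apply: (@dv_ge0_le _ (fun x => sin x - x * cos x) (fun x => x * sin x)) => // x /andP[x0 xt].
  apply: dv_eq (dvB (dv_sin (dv_id x)) (dvM (dv_id x) (dv_cos (dv_id x)))) _; ring.
by rewrite mulr_ge0// sin_ge0_pi// x0/=; have := @pi_ge0 R; lra.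
Qed.

Lemma sin_le_id t : 0 <= t -> sin t <= t.
Proof.
move=> t0; rewrite -subr_ge0 -[X in X <= _](_ : 0 - sin (0 : R) = 0); last by rewrite sin0 subr0.
apply: (@dv_ge0_le _ (fun x => x - sin x) (fun x => 1 - cos x)) => // x _.
  by apply: dv_eq (dvB (dv_id x) (dv_sin (dv_id x))) _; ring.
Qed.

Lemma cos_ge_quad t : 0 <= t -> 1 - t ^+ 2 / 2 <= cos t.
Proof.
move=> t0; rewrite -subr_ge0 -[X in X <= _](_ : cos (0 : R) - (1 - 0 ^+ 2 / 2) = 0); last first.
  by rewrite cos0 expr0n mul0r subr0 subrr.
apply: (@dv_ge0_le _ (fun x => cos x - (1 - x ^+ 2 / 2)) (fun x => x - sin x)) => // x /andP[x0 _].
  apply: dv_eq (dvB (dv_cos (dv_id x)) (dvB (dv_cst 1 x) (dvM (dvX 2 (dv_id x)) (dv_cst (2^-1) x)))) _.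
  by field.
by rewrite subr_ge0 sin_le_id.
Qed.

Lemma cos_prod_ge k y : 0 <= y < 1 -> cos (y * (pi / 2)) <= cos_prod k.+1 y.
Proof.
move=> y01; have [K [dK K0 Kpi]] := wallis_primitive k y01.
have [|L [dL L0 Lpi]] := @wallis_primitive k 0; first by rewrite lexx ltr01.
have pi0 := @pi_ge0 R.
have : L 0 - K 0 <= L (pi / 2) - K (pi / 2).
  apply: (@dv_ge0_le _ (fun t => L t - K t) (fun t => (1 - cos (y * t)) * cos t ^+ k.*2.+1)).
  - lra.
  - move=> t _; apply: dv_eq (dvB (dL t) (dK t)) _; rewrite mul0r cos0; ring.
  - move=> t tpi; rewrite mulr_ge0 ?subr_ge0 ?cos_le1// exprn_ge0// cos_ge0_pihalf//.
    by move: tpi; lra.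
rewrite K0 L0 Kpi Lpi mul0r cos0 cos_prod0 subrr subr_ge0 divr1 mulr1.
rewrite ler_pdivrMr ?cos_prod_gt0//.
by rewrite ler_pM2l ?wallis_gt0.
Qed.

(* J_n(y) is compared with J_n(0) by means of 1 - (yt)^2 / 2 <= cos(yt) and
   t cos t <= sin t. *)
Lemma cos_prod_le k y : 0 <= y < 1 ->
  (1 - y ^+ 2 / (4 * k.+1%:R)) * cos_prod k.+2 y <= cos (y * (pi / 2)).
Proof.
move=> y01; have [K [dK K0 Kpi]] := wallis_primitive k.+1 y01.
have z01 : 0 <= (0 : R) < 1 by rewrite lexx ltr01.
have [L [dL L0 Lpi]] := @wallis_primitive k.+1 0 z01.
have [M [dM M0 Mpi]] := @wallis_primitive k 0 z01.
have pi0 := @pi_ge0 R; have [y0 y1] := andP y01.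
have : K 0 - L 0 + y ^+ 2 / 2 * (M 0 - L 0) <=
    K (pi / 2) - L (pi / 2) + y ^+ 2 / 2 * (M (pi / 2) - L (pi / 2)).
  apply: (@dv_ge0_le _ (fun t => K t - L t + y ^+ 2 / 2 * (M t - L t))
     (fun t => cos t ^+ k.*2.+1 * ((cos (y * t) - 1) * cos t ^+ 2 + y ^+ 2 / 2 * sin t ^+ 2))).
  - lra.
  - move=> t _; apply: dv_eq (dvD (dvB (dK t) (dL t)) (dvZ _ (dvB (dM t) (dL t)))) _.
    rewrite mul0r cos0 doubleS sin2cos2 !(exprS (cos t)).
    by field.
  - move=> t /andP[t0 tpi].
    have c0 : 0 <= cos t by apply: cos_ge0_pihalf; lra.
    apply: mulr_ge0; first by rewrite exprn_ge0.
    have := cos_ge_quad (mulr_ge0 y0 t0).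
    have : (t * cos t) ^+ 2 <= sin t ^+ 2.
      rewrite ler_sqr ?nnegrE ?mulr_ge0// ?mulr_cos_le_sin ?t0// sin_ge0_pi// t0; lra.
    rewrite !exprMn; have := sqr_ge0 (cos t); have := sqr_ge0 y.
    by move: (y ^+ 2) (cos t ^+ 2) (sin t ^+ 2) (t ^+ 2) (cos (y * t)) => Y C S T c; nra.
rewrite K0 L0 M0 Kpi Lpi Mpi mul0r cos0 !cos_prod0 !divr1 !mulr1 !subrr mulr0 addr0.
rewrite -[wallis k.+1]/(wallis k * (2 * k.+1%:R / (2 * k.+1%:R + 1))).
have W0 := wallis_gt0 k; have P0 := cos_prod_gt0 k.+2 y01.
have n0 : 0 < k.+1%:R :> R by rewrite ltr0n.
move: W0 P0 n0; move: (wallis k) (cos_prod _ y) (cos _) (k.+1%:R) => W P c n W0 P0 n0 h.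
rewrite -ler_pdivlMr// -subr_ge0.
have -> : c / P - (1 - y ^+ 2 / (4 * n)) = (2 * n + 1) / (2 * n * W) *
   (W * (2 * n / (2 * n + 1)) * c / P - W * (2 * n / (2 * n + 1)) +
    y ^+ 2 / 2 * (W - W * (2 * n / (2 * n + 1)))).
  by field; rewrite !gt_eqF//; lra.
by rewrite mulr_ge0// divr_ge0// ?mulr_ge0; lra.
Qed.

Lemma ln_cos_prod k y : 0 <= y < 1 ->
  ln (cos_prod k y) = \sum_(j < k) ln (1 - y ^+ 2 / (2 * j%:R + 1) ^+ 2).
Proof.
move=> y01; elim: k => [|k ih]; first by rewrite /cos_prod !big_ord0 ln1.
rewrite big_ord_recr -ih /cos_prod big_ord_recr /= lnM ?posrE//.
  exact: cos_prod_gt0.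
exact: cos_factor_gt0.
Qed.

Lemma cos_pos y : 0 <= y < 1 -> 0 < cos (y * (pi / 2)).
Proof.
move=> /andP[y0 y1]; have := @pi_gt0 R => p0; rewrite cos_gt0_pihalf//; nra.
Qed.

Lemma ln_cos_prod_bound k y : 0 <= y < 1 ->
  `|ln (cos_prod k.+2 y) - ln (cos (y * (pi / 2)))| <= k.+1%:R^-1.
Proof.
move=> y01; have P0 := cos_prod_gt0 k.+2 y01; have c0 := cos_pos y01.
have [y0 y1] := andP y01.
have n1 : 1 <= k.+1%:R :> R by rewrite ler1n.
rewrite ger0_norm; last by rewrite subr_ge0 ler_ln ?posrE// cos_prod_ge.
have := cos_prod_le k y01; move: n1 P0 c0; set P := cos_prod _ _; set c := cos _.
move: (k.+1%:R) => n n1 P0 c0 h; rewrite -ln_div ?posrE//.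
have Pc : 0 < P / c by rewrite divr_gt0.
have h1 : -1 < P / c - 1 by lra.
have := le_ln1Dx h1; rewrite addrC subrK => /le_trans; apply.
set u := y ^+ 2 / (4 * n) in h.
have u0 : 0 <= u by rewrite /u divr_ge0 ?sqr_ge0//; lra.
have y2 : y ^+ 2 <= 1 by rewrite expr_le1// ltW.
have un : u <= n^-1 / 4.
  have -> : u = y ^+ 2 * (n^-1 / 4) by rewrite /u; field; rewrite gt_eqF//; lra.
  by rewrite ler_piMl// divr_ge0 ?invr_ge0//; lra.
have n1' : n^-1 <= 1 by rewrite invf_le1//; lra.
rewrite lerBlDr ler_pdivrMr//.
have v0 : 0 <= n^-1 by rewrite invr_ge0; lra.
move: n^-1 n1' un v0 => v v1 uv v0.
have h2 : (1 - v / 4) * P <= c.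
  by apply: le_trans h; rewrite ler_pM2r//; lra.
apply: le_trans (_ : (v + 1) * ((1 - v / 4) * P) <= _); last by rewrite ler_pM2l//; lra.
by rewrite mulrA ler_peMl ?(ltW P0)//; nra.
Qed.

End CosineProduct.

Section LogSums.
Variable R : realType.
Implicit Types (t u x y : R) (k n m N : nat).

Lemma ln1D_pade u : 0 <= u -> `|(2 + u) * ln (1 + u) - 2 * u| <= u ^+ 3 / 3.
Proof.
move=> u0.
have -> : (2 + u) * ln (1 + u) - 2 * u =
    ((2 + u) * ln (1 + u) - 2 * u) - ((2 + 0) * ln (1 + 0) - 2 * 0).
  by rewrite !addr0 ln1 !mulr0 !subr0.
have -> : u ^+ 3 / 3 = u ^+ 3 / 3 - 0 ^+ 3 / 3 by rewrite expr0n mul0r subr0.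
apply: (@dv_norm_le _ (fun x => (2 + x) * ln (1 + x) - 2 * x)
  (fun x => ln (1 + x) - x / (1 + x)) (fun x => x ^+ 3 / 3) (fun x => x ^+ 2)) => //.
- move=> x /andP[x0 _]; have x1 : 0 < 1 + x by lra.
  apply: dv_eq (dvB (dvM (dvD (dv_cst 2 x) (dv_id x)) (dv_ln x1 (dvD (dv_cst 1 x) (dv_id x))))
    (dvZ 2 (dv_id x))) _.
  by field; rewrite gt_eqF.
- move=> x _; apply: dv_eq (dvM (dvX 3 (dv_id x)) (dv_cst (3^-1) x)) _.
  by field.
- move=> x /andP[x0 _]; have x1 : 0 < 1 + x by lra.
  have le1 : ln (1 + x) <= x by apply: le_ln1Dx; lra.
  have le2 : x / (1 + x) <= ln (1 + x).
    have -> : x / (1 + x) = 1 - (1 + x)^-1 by field; rewrite gt_eqF.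
    have h : -1 < (1 + x)^-1 - 1 by have : 0 < (1 + x)^-1 by [rewrite invr_gt0]; lra.
    have := le_ln1Dx h; rewrite addrC subrK lnV ?posrE//; lra.
  rewrite ger0_norm ?subr_ge0//; apply: (@le_trans _ _ (x - x / (1 + x))); first lra.
  have -> : x - x / (1 + x) = x ^+ 2 / (1 + x) by field; rewrite gt_eqF.
  by rewrite ler_pdivrMr// ler_peMr ?sqr_ge0//; lra.
Qed.

Definition stirling n : R := ln (n`!%:R) - (n%:R + 1 / 2) * ln n%:R + n%:R.

Lemma stirling_lim : exists l, forall n, `|stirling n.+1 - l| <= 2 / n.+1%:R.
Proof.
have [||l _ H] := @cvg_dom_telescope R (fun n => stirling n.+2 - stirling n.+1) (fun n => 2 / n.+1%:R).
- move=> n; rewrite /stirling factS natrM.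
  have f0 : 0 < (n.+1)`!%:R :> R by rewrite ltr0n fact_gt0.
  have x1 : 1 <= n.+1%:R :> R by rewrite ler1n.
  rewrite -[n.+2%:R]natr1; move: (n.+1%:R) x1 f0 => x x1; move: (_`!%:R) => f f0.
  have x0 : 0 < x by lra.
  have u0 : 0 <= x^-1 by rewrite invr_ge0 ltW.
  have := ln1D_pade u0.
  have -> : 1 + x^-1 = (x + 1) / x by field; rewrite gt_eqF.
  rewrite ln_div ?posrE ?lnM ?posrE//; try lra.
  have -> : (2 + x^-1) * (ln (x + 1) - ln x) - 2 * x^-1 =
    - (2 / x * (ln (x + 1) + ln f - (x + 1 + 1 / 2) * ln (x + 1) + (x + 1) -
     (ln f - (x + 1 / 2) * ln x + x))) by field; rewrite gt_eqF.
  rewrite normrN normrM (ger0_norm (_ : 0 <= 2 / x)); last by rewrite divr_ge0// ltW.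
  rewrite -ler_pdivlMl ?divr_gt0// => /le_trans; apply.
  have -> : (2 / x)^-1 * (x^-1 ^+ 3 / 3) = x ^- 2 / 6 by field; rewrite gt_eqF.
  have -> : 2 / x - 2 / (x + 1) = 2 / (x * (x + 1)) by field; rewrite !gt_eqF//; lra.
  rewrite -[leLHS]/(_ / _) -invfM ler_pdivlMr ?mulr_gt0//; last lra.
  rewrite mulrC ler_pdivrMr ?mulr_gt0 ?exprn_gt0//; nra.
- exact: cvg_2Vn.
exists (l + stirling 1) => n; have := H n.
rewrite (_ : series _ n = stirling n.+1 - stirling 1).
  by rewrite (_ : _ - l = stirling n.+1 - (l + stirling 1)); last ring.
by rewrite seriesEnat/= telescope_sumr.
Qed.

Lemma sum_ln_half N : \sum_(m < N) ln (m%:R + 1 / 2 : R) =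
  ln ((N.*2)`!%:R) - 2 * N%:R * ln 2 - ln (N`!%:R).
Proof.
elim: N => [|N ih]; first by rewrite big_ord0 !fact0 ln1; ring.
rewrite big_ord_recr /= ih doubleS !factS !natrM -[N.+1%:R]natr1.
have f0 n : 0 < n`!%:R :> R by rewrite ltr0n fact_gt0.
have n0 : 0 <= N%:R :> R by [].
have -> : N.*2.+2%:R = 2 * (N%:R + 1) :> R.
  by rewrite -[N.*2.+2%:R]natr1 -[N.*2.+1%:R]natr1 -mul2n natrM; ring.
have -> : N.*2.+1%:R = 2 * (N%:R + 1 / 2) :> R.
  by rewrite -[N.*2.+1%:R]natr1 -mul2n natrM; field.
move: (f0 N) (f0 N.*2) n0; move: (N`!%:R) ((N.*2)`!%:R) (N%:R) => f g x f1 g1 x0.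
have h1 : 0 < x + 1 by lra.
have h2 : 0 < x + 1 / 2 by lra.
rewrite !lnM ?posrE ?mulr_gt0//; ring.
Qed.

Lemma sum_ln_half_bound n (N : R) : N = n.+1%:R ->
  `|\sum_(m < n.+1) ln (m%:R + 1 / 2 : R) - N * ln N + N - ln 2 / 2| <= 3 / N.
Proof.
move=> NE; have [l H] := stirling_lim.
have N0 : 0 < N by rewrite NE ltr0n.
have -> : \sum_(m < n.+1) ln (m%:R + 1 / 2 : R) - N * ln N + N - ln 2 / 2 =
   (stirling n.+1.*2.-1.+1 - l) - (stirling n.+1 - l).
  rewrite sum_ln_half /stirling -NE /= -[n.*2.+2]/(n.+1.*2) -mul2n [(2 * _)%:R]natrM -NE.
  by rewrite lnM ?posrE//; field.
apply: le_trans (ler_normB _ _) _.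
have := H n; have := H n.+1.*2.-1; rewrite -NE /= -[n.*2.+2]/(n.+1.*2) -mul2n natrM -NE.
have -> : 2 / (2 * N) = 1 / N by field; rewrite gt_eqF.
lra.
Qed.

End LogSums.

Section LogSineLimit.
Variable R : realType.
Implicit Types (t u x y : R) (k n m N : nat).

Lemma cos_compl x : cos ((1 - 2 * x) * (pi / 2)) = sin (pi * x) :> R.
Proof.
rewrite (_ : (1 - 2 * x) * (pi / 2) = pi / 2 - pi * x).
  by rewrite cosB cos_pihalf sin_pihalf mul0r add0r mul1r.
by move: (pi : R) => p; field.
Qed.

Lemma sum_ln_reflect_bound n x (N : R) : N = n.+2%:R -> 1 / 3 <= x <= 1 / 2 ->
  `|\sum_(m < n.+2) (ln (m%:R + x) + ln (m%:R + 1 - x)) + 2 * N - 2 * N * ln N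
    - ln (2 * sin (pi * x))| <= 7 / n.+1%:R.
Proof.
move=> NE /andP[x3 x2]; set y := 1 - 2 * x.
have y01 : 0 <= y < 1 by rewrite /y; lra.
have s0 : 0 < sin (pi * x) by rewrite -cos_compl; exact: cos_pos y01.
have E m : ln (m%:R + x) + ln (m%:R + 1 - x) =
    ln (1 - y ^+ 2 / (2 * m%:R + 1) ^+ 2) + 2 * ln (m%:R + 1 / 2).
  have m0 : 0 <= m%:R :> R by [].
  have f0 := cos_factor_gt0 m y01.
  have h0 : 0 < m%:R + 1 / 2 :> R by lra.
  have -> : 2 * ln (m%:R + 1 / 2) = ln ((m%:R + 1 / 2) ^+ 2) :> R.
    by rewrite lnXn// mulr_natl.
  rewrite -!lnM ?posrE ?exprn_gt0//; try lra.
  by congr ln; rewrite /y; field; rewrite gt_eqF//; lra.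
under eq_bigr do rewrite E.
rewrite big_split /= -ln_cos_prod// -mulr_sumr lnM ?posrE//.
have := ln_cos_prod_bound n y01; rewrite cos_compl.
have := sum_ln_half_bound NE.
have le : 3 / N <= 3 / n.+1%:R :> R.
  by rewrite NE ler_wpM2l// lef_pV2 ?posrE ?ltr0n// ler_nat.
move=> /le_trans/(_ le).
move: (n.+1%:R^-1) (ln (cos_prod _ _)) (ln (sin _)) (ln N) (ln 2) (\sum_(m < _) _) => v c s l l2 S.
rewrite !ler_norml; lra.
Qed.

Definition sum_xlnx N x := \sum_(m < N)
  ((m%:R + x) * ln (m%:R + x) - (m%:R + 1 - x) * ln (m%:R + 1 - x)).

Lemma dv_xlnx (f : R -> R) x a : 0 < f x -> dv f x a ->
  dv (fun y => f y * ln (f y)) x (a * (ln (f x) + 1)).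
Proof.
move=> f0 hf; apply: dv_eq (dvM hf (dv_ln f0 hf)) _.
by field; rewrite gt_eqF.
Qed.

Lemma dv_sum_xlnx N x : 0 < x < 1 ->
  dv (sum_xlnx N) x (\sum_(m < N) (ln (m%:R + x) + ln (m%:R + 1 - x)) + 2 * N%:R).
Proof.
move=> /andP[x0 x1]; elim: N => [|N ih].
  apply: (@dv_near _ (fun=> 0)); last by rewrite big_ord0 mulr0 addr0; exact: dv_cst.
  by apply: filterE => y; rewrite /sum_xlnx big_ord0.
have N0 : 0 <= N%:R :> R by [].
apply: (@dv_near _ (fun y => sum_xlnx N y +
    ((N%:R + y) * ln (N%:R + y) - (N%:R + 1 - y) * ln (N%:R + 1 - y)))).
  by apply: filterE => y; rewrite /sum_xlnx big_ord_recr.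
apply: dv_eq (dvD ih (dvB (dv_xlnx _ (dvD (dv_cst N%:R x) (dv_id x)))
  (dv_xlnx _ (dvB (dv_cst (N%:R + 1) x) (dv_id x))))) _; try lra.
by rewrite big_ord_recr /= -[N.+1%:R]natr1; ring.
Qed.

Lemma dv_clausen_ln_sin x : 0 < x < 1 ->
  dv (fun x => - (clausen 1 (2 * pi * x) / (2 * pi))) x (ln (2 * sin (pi * x))).
Proof.
move=> /andP[x0 x1]; have p0 := @pi_gt0 R.
have s0 : 0 < sin (pi * x) by rewrite sin_gt0_pi// mulr_gt0//=; nra.
have q : qnorm 1 (2 * pi * x) = (2 * sin (pi * x)) ^+ 2.
  rewrite qnorm1E (_ : 2 * pi * x = pi * x + pi * x); last by ring.
  by rewrite cosD exprMn -!expr2 cos2sin2; ring.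
have h1 : 0 <= (1 : R) <= 1 by rewrite ler01 lexx.
have q0 : 0 < qnorm 1 (2 * pi * x) by rewrite q exprn_gt0// mulr_gt0.
have d := dv_comp (f := clausen 1) (g := fun x => 2 * pi * x) (clausen_dv h1 q0) (dvZ (2 * pi) (dv_id x)).
apply: dv_eq (dvN (dvM d (dv_cst (2 * pi)^-1 x))) _.
rewrite q lnXn ?mulr_gt0// -[_ *+ 2]mulr_natl mulr0 addr0.
move: (ln _) => l; move: p0; move: (pi : R) => p p0; by field; rewrite gt_eqF.
Qed.

Lemma clausen_pi3 : clausen 1 (pi / 3 : R) = 3 / 2 * clausen 1 (2 * pi / 3).
Proof.
have := clausen_dup (pi / 3 : R).
have -> : pi - pi / 3 = 2 * pi / 3 :> R by move: (pi : R) => p; field.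
have -> : 2 * (pi / 3) = 2 * pi / 3 :> R by move: (pi : R) => p; field.
lra.
Qed.

Lemma sum_xlnx_half N : sum_xlnx N (1 / 2) = 0.
Proof.
rewrite /sum_xlnx big1// => m _.
by rewrite (_ : m%:R + 1 - 1 / 2 = m%:R + 1 / 2) ?subrr//; field.
Qed.

Lemma sum_xlnx_third : (fun n => 3 * sum_xlnx n.+2 (1 / 3) + n.+2%:R * ln n.+2%:R)
  @ \oo --> - (clausen 1 (pi / 3) / pi : R).
Proof.
have p0 := @pi_gt0 R.
apply/cvgrPdist_le => e e0.
have e0' : 0 < 2 * e / 7 by lra.
have /cvgrPdist_le/(_ _ e0') := @cvg_harmonic R.
apply: filterS => n; rewrite sub0r normrN /harmonic /= => le.
rewrite ger0_norm ?invr_ge0// in le.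
have [N NE] : {N : R | N = n.+2%:R} by exists n.+2%:R.
pose f x := sum_xlnx n.+2 x - 2 * N * ln N * x - - (clausen 1 (2 * pi * x) / (2 * pi)).
have : `|f (1 / 2) - f (1 / 3)| <= 7 / n.+1%:R * (1 / 2) - 7 / n.+1%:R * (1 / 3).
  apply: (@dv_norm_le R f
    (fun x => \sum_(m < n.+2) (ln (m%:R + x) + ln (m%:R + 1 - x)) + 2 * N - 2 * N * ln N
    - ln (2 * sin (pi * x))) (fun x => 7 / n.+1%:R * x) (fun=> 7 / n.+1%:R) (1 / 3) (1 / 2)).
  - lra.
  - move=> x /andP[x3 x2]; have x01 : 0 < x < 1 by lra.
    apply: dv_eq (dvB (dvB (dv_sum_xlnx n.+2 x01) (dvZ (2 * N * ln N) (dv_id x)))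
      (dv_clausen_ln_sin x01)) _.
    by rewrite mulr1 -NE.
  - by move=> x _; apply: dv_eq (dvZ _ (dv_id x)) _; rewrite mulr1.
  - by move=> x xx; exact: sum_ln_reflect_bound.
have h1 : 0 <= (1 : R) <= 1 by rewrite ler01 lexx.
rewrite /f sum_xlnx_half -NE clausen_pi3 !opprK.
have -> : 2 * pi * (1 / 2) = pi :> R by move: (pi : R) => p; field.
have -> : 2 * pi * (1 / 3) = 2 * pi / 3 :> R by move: (pi : R) => p; field.
rewrite clausen_pi//.
move: (clausen _ _) (ln N) (sum_xlnx _ _) => c l S H.
have -> : - (3 / 2 * c / pi) - (3 * S + N * l) =
   3 * (0 - 2 * N * l * (1 / 2) + 0 / (2 * pi) - (S - 2 * N * l * (1 / 3) + c / (2 * pi))).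
  by move: p0; move: (pi : R) => p p0; field; rewrite gt_eqF.
rewrite normrM (ger0_norm (_ : 0 <= 3))//.
by move: le; move: n.+1%:R^-1 H => v; lra.
Qed.

End LogSineLimit.

Section DerivativeAtMinusOne.
Variable R : realType.
Implicit Types (t u x y : R) (k n m N : nat).
Local Notation nc := (@Normc.normc R).
Local Notation f := (@lnpow R (-1)).

Lemma lnpowN1 n : f n.+1%:R = (n.+1%:R * ln n.+1%:R)%:C.
Proof.
rewrite /lnpow /npow /cexp opprK mul1r /= lnK ?posrE ?ltr0n//.
by apply: complexP; rewrite /expi ?ReM ?ImM /= ?cos0 ?sin0; ring.
Qed.

Lemma ccvg_fdn_lnpow j (s : R[i]) : 1 <= complex.Re s + j%:R -> ccvg (fun n => fdn j (lnpow s) n.+1%:R) 0.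
Proof.
move=> sj; have [K K0 HK] := fdn_bound j s; set q := _ - 1 / 2 in HK.
have q2 : 1 / 2 <= q by rewrite /q; lra.
have [h2 h3] : ccvg (fun n => fdn j (dpow s (1 / 4)%:C) n.+1%:R) 0 /\
    ccvg (fun n => fdn j (rpow s (1 / 4)%:C) n.+1%:R) 0.
  have h : nc (1 / 4)%:C <= 1 / 4 by rewrite nc_real ger0_norm.
  by split; apply: (ccvg_fdn0 _ q2) => x x1; have [_ b2 b3] := HK _ h x x1; [exact: b2|exact: b3].
have := ccvgD (ccvgZ ((1 / 4)%:C^-1) h3) (ccvgZ (- (1 / 4)%:C^-1) h2).
rewrite !mulr0 addr0; apply: ccvg_eq => n.
by rewrite -!fdnZ -fdnD; apply: fdn_eq => y; rewrite lnpowE.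
Qed.

Lemma ccvg_bdry2 k (l : R[i]) : ccvg (fun N => psum 0 f N + bdry k.+2 f N) l ->
  ccvg (fun N => psum 0 f N + bdry 2 f N) l.
Proof.
elim: k => [//|k ih] h; apply: ih.
have t : ccvg (fun n => fdn k.+2 f n.+1%:R) 0.
  apply: ccvg_fdn_lnpow; rewrite ReN /= -natr1 -[k.+1%:R]natr1.
  have : 0 <= k%:R :> R by []; lra.
have := ccvgD h (ccvgZ (-1) (ccvg_bounded0 (fun n => antichi_le1 R k.+3 n) t)).
rewrite mulr0 addr0; apply: ccvg_eq => n.
by rewrite [bdry k.+3 f n]bdryS; ring.
Qed.

(* The partial sums of length 3 P + 2 are used because [antichi 2] vanishes there. *)
Lemma psum_lnpow P : psum 0 f (3 * P).+2 =
  (\sum_(m < P.+1) ((3 * m%:R + 1) * ln (3 * m%:R + 1) - (3 * m%:R + 2) * ln (3 * m%:R + 2)))%:C.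
Proof.
have S N : psum 0 f N.+1 = psum 0 f N + (chi3r R N.+1)%:C * f N.+1%:R.
  by rewrite /psum big_ord_recr.
have c n i : chi3r R (3 * n + i) = chi3r R i.
  by rewrite /chi3r mulnC modnMDl.
elim: P => [|P ih].
  rewrite muln0 !S /psum big_ord0 big_ord1 !lnpowN1 /chi3r /= add0r.
  by rewrite -rmorphM -rmorphM -rmorphD; congr _%:C; rewrite mulr0 !add0r; ring.
rewrite mulnS -[(3 + _).+2]/((3 * P).+2.+3) 3!S ih [in RHS]big_ord_recr /= !lnpowN1.
have -> : chi3r R (3 * P).+3 = 0 by rewrite -[(3 * P).+3]addn3 c.
have -> : chi3r R (3 * P).+4 = 1 by rewrite -[(3 * P).+4]addn4 c.
have -> : chi3r R (3 * P).+4.+1 = -1 by rewrite -[(3 * P).+4]addn4 -addnS c.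
have -> : 3 * P.+1%:R + 1 = (3 * P).+4%:R :> R
  by rewrite -[(3 * P).+4]addn4 natrD natrM -[P.+1%:R]natr1; ring.
have -> : 3 * P.+1%:R + 2 = (3 * P).+4.+1%:R :> R
  by rewrite -[(3 * P).+4]addn4 -addnS natrD natrM -[P.+1%:R]natr1; ring.
rewrite -!rmorphM -!rmorphD; congr _%:C; ring.
Qed.

Lemma bdry2_lnpow P : bdry 2 f (3 * P).+2 = (P.+1%:R * ln (3 * P.+1%:R))%:C.
Proof.
have per M : antichi R M (3 * P).+2 = antichi R M 2.
  by elim: P => [//|n ih]; rewrite -ih -[RHS]antichi_per; congr antichi; lia.
have a1 : antichi R 1 (3 * P).+2 = 3^-1.
  by rewrite per /= /chi3r /= sub0r opprK mul1r.
have a2 : antichi R 2 (3 * P).+2 = 0.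
  by rewrite per /= /chi3r /= sub0r opprK subr0 subrr mul0r.
rewrite !bdryS a1 a2 /bdry big_ord0 add0r mul0r addr0 -[fdn 0 f _]/(f _) lnpowN1.
rewrite -rmorphM; congr _%:C.
by rewrite (_ : (3 * P).+3 = 3 * P.+1)%N ?natrM; [field|lia].
Qed.

Lemma psum_bdry_lnpow P : psum 0 f (3 * P).+2 + bdry 2 f (3 * P).+2 =
  (3 * sum_xlnx P.+1 (1 / 3) + P.+1%:R * ln P.+1%:R)%:C.
Proof.
rewrite psum_lnpow bdry2_lnpow -rmorphD; congr _%:C.
have n0 : 0 < P.+1%:R :> R by rewrite ltr0n.
rewrite lnM ?posrE// mulrDr addrA; congr (_ + _).
elim: P.+1 => [|N ih]; first by rewrite /sum_xlnx !big_ord0; ring.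
have N0 : 0 <= N%:R :> R by [].
rewrite /sum_xlnx !big_ord_recr /= -/(sum_xlnx N _) mulrDr -ih -[N.+1%:R]natr1.
have -> : 3 * N%:R + 1 = 3 * (N%:R + 1 / 3) :> R by field.
have -> : 3 * N%:R + 2 = 3 * (N%:R + 2 / 3) :> R by field.
have -> : N%:R + 1 - 1 / 3 = N%:R + 2 / 3 :> R by field.
by rewrite !lnM ?posrE//; lra.
Qed.

Lemma Lchi'N1 : Lchi' (-1) = (clausen 1 (pi / 3) / pi : R)%:C.
Proof.
have h := @LorderP R (-1).
have h5 : 5 / 2 <= complex.Re (-1 : R[i]) + (Lorder (-1 : R[i])).+1%:R.
  by rewrite -[(Lorder _).+1%:R]natr1; lra.
have [K fK] := summable_lnpow h5.
have [h1 h2] := @ccvg_bdry2 (Lorder (-1 : R[i])).-1 _ (regsum_cvg fK).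
rewrite /Lchi'; apply/eqP; rewrite eqr_oppLR; apply/eqP.
have n3 n : (n <= (3 * n.+1).+2)%N by lia.
apply: (@ccvg_unique _ (fun n => psum 0 f (3 * n.+1).+2 + bdry 2 f (3 * n.+1).+2)).
  by split; [exact: cvg_subseq h1 n3 | exact: cvg_subseq h2 n3].
apply: (@ccvg_eq _ (fun n => (3 * sum_xlnx n.+2 (1 / 3) + n.+2%:R * ln n.+2%:R)%:C)).
  by move=> n; rewrite psum_bdry_lnpow.
rewrite -rmorphN; split => /=; last exact: cvg_cst.
exact: sum_xlnx_third.
Qed.

Lemma derive1_Lchi : derive1 (@Lchi R : R[i]^o -> R[i]^o) (-1) = (clausen 1 (pi / 3) / pi : R)%:C.
Proof.
rewrite derive1E -Lchi'N1; apply: cvg_lim; last exact: Lchi_derive.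
exact: norm_hausdorff.
Qed.

End DerivativeAtMinusOne.

Theorem theorem2p1 (R : realType) (r : nat) (r_gt0 : (1 <= r)%N)
    (x : nat -> laurent int) (x_seq : cluster_seq r x) :
  [/\ x 3%N = (lX 0 1 ^+ r + 1) * lX (-1) 0,
      x 4%N = ((lX 0 1 ^+ r + 1) ^+ r + lX 1 0 ^+ r) * lX (- r%:Z) (-1) &
      x 5%N = lX 0 (- r%:Z) *
        (\sum_(1 <= j < r.+1) x 3%N ^+ (j * r - 1) *+ 'C(r, j) + lX 1 0)] /\
  [/\ mahler (laurentC R[i] (x 4%N)) =
        (r%:R / pi * bloch_wigner (expi (pi / 3)))%:E,
      (r%:R / pi * bloch_wigner (expi (pi / 3)))%:E =
        (r%:R%:E * mahler (lX 1 0 + lX 0 1 + 1 : laurent R[i])%R)%E &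
      exists (L : R[i]^o -> R[i]^o) (l : R),
        [/\ is_dirichletL_chi3 L, derive1 L (-1) = l%:C &
            mahler (lX 1 0 + lX 0 1 + 1 : laurent R[i]) = l%:E]] /\
  ((2 <= r)%N -> exists t X : nat -> R,
    [/\ (forall i j, (1 <= i)%N -> (i < j <= r)%N -> t i < t j),
        (forall s : R,
           (0 < s < pi /\
            2 ^+ (r - 1) * `|sin (r%:R * s / 2)| ^+ r = sin (s / 2)) <->
           exists2 j, (1 <= j <= r)%N & t j = s),
        (forall Y : R, (-1 < Y < 1 /\ root (chebP R r) Y) <->
           exists2 j, (1 <= j <= r)%N & X j = Y),
        (forall j, (1 <= j <= r)%N -> t j = acos (X j)) &
        mahler (laurentC R[i] (x 5%N)) =
          (r%:R / pi * \sum_(1 <= j < r.+1) (-1) ^+ (j + 1) *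
             (bloch_wigner (expi (r%:R * t j)) - bloch_wigner (expi (t j))))%:E]).
Proof.
have h1 : 0 <= (1 : R) <= 1 by rewrite ler01 lexx.
have p0 := @pi_gt0 R.
split; [split; [exact: cluster3|exact: cluster4|exact: cluster5]|split].
  rewrite !bloch_wigner_expi (mahler_x4 R r_gt0 x_seq) mahler_smyth; split.
  - by congr _%:E; rewrite mulrA mulrAC.
  - by rewrite -EFinM; congr _%:E; rewrite mulrA mulrAC.
  by exists (@Lchi R), (clausen 1 (pi / 3) / pi); split;
    [exact: Lchi_dirichlet|exact: derive1_Lchi|].
move=> r2; have zpi := zero_seq_pi R r2.
have gap0 j : (1 <= j <= r)%N -> arch_gap r (zero_seq R r j) = 0.
  by move=> jr; have [] := @zero_seq_itv R r r2 j; first lia.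
exists (zero_seq R r), (fun j => cos (zero_seq R r j)); split.
- by move=> i j i1 /andP[ij jr]; apply: zero_seq_mono => //; lia.
- move=> s; split=> [[s0 E]|[j jr <-]].
    by apply: (zero_seqP r2 s0); apply/(arch_gap_eq r2) => //; lra.
  split; first exact: zpi.
  by apply/(arch_gap_eq r2); [have := zpi j jr; lra|exact: gap0].
- move=> Y; split=> [[/andP[Y0 Y1] rY]|[j jr <-]].
    have YK : cos (acos Y) = Y by rewrite acosK// in_itv/= !ltW.
    have a0 : 0 < acos Y < pi by rewrite acos_gt0 ?acos_ltpi ?Y0 ?Y1 ?(ltW Y0) ?(ltW Y1).
    have [|j jr E] := zero_seqP r2 a0; first by apply/(chebP_root r2 a0); rewrite YK.
    by exists j; rewrite // E.
  have /andP[z0 zp] := zpi j jr.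
  split; last by apply/(chebP_root r2 (zpi j jr)); exact: gap0.
  rewrite -cospi -cos0 !ltr_cos ?in_itv/= ?z0 ?zp ?lexx ?(ltW z0) ?(ltW zp) ?(ltW p0)//.
- by move=> j jr; have /andP[z0 zp] := zpi j jr; rewrite cosK// in_itv/= !ltW.
rewrite (mahler_x5 R r2 x_seq) /zero_sum; congr (_ * _)%:E.
by apply: eq_bigr => j _; rewrite !bloch_wigner_expi.
Qed.
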